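(* Let $E$ be a Courant algebroid of even rank over a manifold $M$. (i) The space of generalized connections adapted to a generalized complex structure $\mathcal J$ on $E$ is an affine space modelled on the vector space $$\{\mathrm{Re}\,(\mathrm{sk}\,\eta)\mid\eta\in\Gamma(S^2L^*\otimes\bar L^* )\}=\Gamma(\mathfrak u(E)^{\langle1\rangle}),$$ where $L$ is the $(1,0)$-bundle of $\mathcal J$ and $\mathfrak u(E)\subset\mathfrak{so}(E)$ is the bundle of Lie subalgebras which stabilizes $\mathcal J$. (ii) The space of generalized connections adapted to a generalized Kähler structure $(G,\mathcal J)$ on $E$ is an affine space modelled on the vector space $$\{\mathrm{Re}\,(\mathrm{sk}\,(\eta_++\eta_-))\mid\eta_\pm\in\Gamma(S^2(E_\pm^{\mathbb C}\cap L)^*\otimes(E_\pm^{\mathbb C}\cap\bar L)^* )\}=\Gamma(\mathfrak u(E)_G^{\langle1\rangle}),$$ where $L$ is the $(1,0)$-bundle of $\mathcal J$, $E_\pm$ are the $\pm1$-eigenbundles of $G^{\mathrm{end}}$, $\mathfrak u(E)_G=\mathfrak u(E_+)\oplus\mathfrak u(E_-)\subset\mathfrak u(E)$ denotes the stabilizer of $G$, and $\mathfrak u(E)_G^{\langle1\rangle}:=(\mathfrak u(E)_G)^{\langle1\rangle}=\mathfrak u(E_+)^{\langle1\rangle}\oplus\mathfrak u(E_-)^{\langle1\rangle}$.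
   Context: A Courant algebroid over a smooth manifold $M$ is a real vector bundle $E\to M$ with a non-degenerate symmetric bilinear form $\langle\cdot,\cdot\rangle$ (scalar product, of arbitrary signature), a bundle map $\pi:E\to TM$ (anchor) and an $\mathbb R$-bilinear bracket $[\cdot,\cdot]$ on $\Gamma(E)$ (Dorfman bracket) such that for all $u,v,w\in\Gamma(E)$, $f\in C^\infty(M)$: $[u,[v,w]]=[[u,v],w]+[v,[u,w]]$; $[u,fv]=f[u,v]+\pi(u)(f)v$; $\pi(u)\langle v,w\rangle=\langle[u,v],w\rangle+\langle v,[u,w]\rangle$; $\langle[u,v]+[v,u],w\rangle=\pi(w)\langle u,v\rangle$. All structures are extended complex-linearly to $E^{\mathbb C}=E\otimes\mathbb C$. A generalized connection on $E$ is an $\mathbb R$-linear map $D:\Gamma(E)\to\Gamma(E^*\otimes E)$ with $D_v(fu)=\pi(v)(f)u+fD_vu$ and $\pi(w)\langle u,v\rangle=\langle D_wu,v\rangle+\langle u,D_wv\rangle$. Its torsion is the 3-form $T^D(u,v,w)=\langle D_uv-D_vu-[u,v],w\rangle+\langle D_wu,v\rangle$. $D$ is extended to tensors as usual. $D$ is adapted to a set of tensor fields $\mathcal Q$ on $E$ if $T^D=0$ and $DA=0$ for all $A\in\mathcal Q$. A section $S\in\Gamma(E^*\otimes\Lambda^2E^* )$ acts by $\langle(D+S)_uv,w\rangle=\langle D_uv,w\rangle+S(u,v,w)$. A generalized complex structure on $E$ is a $\langle\cdot,\cdot\rangle$-skew-symmetric $\mathcal J\in\Gamma(\mathrm{End}\,E)$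 with $\mathcal J^2=-\mathrm{Id}$ which is integrable, i.e. the sections of its $i$-eigenbundle ($(1,0)$-bundle) $L\subset E^{\mathbb C}$ are closed under $[\cdot,\cdot]$. A generalized metric is (given by) a subbundle $E_-\subset E$ on which $\langle\cdot,\cdot\rangle$ is non-degenerate; $E_+:=(E_-)^\perp$, $G^{\mathrm{end}}|_{E_\pm}=\pm\mathrm{Id}$, $G(u,v)=\langle G^{\mathrm{end}}u,v\rangle$ ($G$ may be indefinite). A generalized Kähler structure is a pair $(G,\mathcal J)$ of a generalized metric and a generalized complex structure with $G^{\mathrm{end}}\mathcal J=\mathcal JG^{\mathrm{end}}$ such that $G^{\mathrm{end}}\mathcal J$ is also a generalized complex structure (i.e. integrable). $\mathfrak u(E_\pm)\subset\mathfrak{so}(E_\pm)$ denotes the bundle of skew endomorphisms of $E_\pm$ commuting with $\mathcal J|_{E_\pm}$. Identify $\mathfrak{so}(E)$ with $\Lambda^2E^*$ by means of $\langle\cdot,\cdot\rangle$. For a bundle of Lie subalgebras $\mathfrak h(E)\subset\mathfrak{so}(E)$ the first generalized prolongation is $\mathfrak h(E)^{\langle1\rangle}:=\{\alpha\in E^*\otimes\mathfrak h(E)\mid\partial\alpha=0\}$, where $(\partial\alpha)(u,v,w)=\alpha(u,v,w)+\alpha(v,w,u)+\alpha(w,u,v)$; similarly $\mathfrak u(E_\pm)^{\langle1\rangle}\subset E_\pm^*\otimes\mathfrak u(E_\pm)$ is defined with $E_\pm$ in place of $E$ and included in $E^*\otimes\mathfrak{so}(E)$ through $E=E_+\oplus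 E_-$. The map $\mathrm{sk}:S^2(E^{\mathbb C})^*\otimes(E^{\mathbb C})^*\to(E^{\mathbb C})^*\otimes\Lambda^2(E^{\mathbb C})^*$ is $(\mathrm{sk}\,\sigma)(u,v,w)=\sigma(u,v,w)-\sigma(u,w,v)$. The sections $\eta,\eta_\pm$ are extended by zero to sections of $S^2(E^{\mathbb C})^*\otimes(E^{\mathbb C})^*$ using $E^{\mathbb C}=L\oplus\bar L$ and $E^{\mathbb C}=\bigoplus_{\pm}\big((E_\pm^{\mathbb C}\cap L)\oplus(E_\pm^{\mathbb C}\cap\bar L)\big)$. $\mathrm{Re}\,\sigma\in\Gamma(E^*\otimes\Lambda^2E^* )$ maps real $u,v,w$ to the real part of $\sigma(u,v,w)$. *)

(* Defs.v *)
From HB Require Import structures.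
From mathcomp Require Import all_boot all_order all_algebra.
From mathcomp Require Import boolp classical_sets functions reals.
From mathcomp Require Import interval_inference topology.
From mathcomp Require Import normedtype landau derive.
From mathcomp.real_closed Require Import complex.

Set Implicit Arguments.
Unset Strict Implicit.
Unset Printing Implicit Defensive.

Import Order.TTheory GRing.Theory Num.Theory numFieldNormedType.Exports.

Local Open Scope classical_set_scope.
Local Open Scope ring_scope.

Lemma near_eq_differentiable (K : numFieldType) (V W : normedModType K)
    (f g : V -> W) (x : V) :
  (\near x, f x = g x) -> differentiable f x -> differentiable g x.
Proof.
move=> fg /diff_locallyP[cdf ef].
have e : g \o shift x = cst (g x) + 'd f x +o_ 0 id.
  apply/eqaddoP => _/posnumP[e].
  move/eqaddoP: ef => /(_ e%:num) /(_ [gt0 of e%:num]).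
  apply: filter_app.
  have : \forall h \near (0 : V), f (h + x) = g (h + x).
    by move: fg; rewrite (near_shift 0) subr0.
  apply: filter_app; near=> h => fgh.
  rewrite -![(_ + _ : _ -> _) _]/(_ + _) -![(- _ : _ -> _) _]/(- _) /=.
  by rewrite fgh /cst /= (nbhs_singleton fg).
by apply/diff_locallyP; rewrite (diff_unique cdf e).
Unshelve. all: by end_near. Qed.

Section SmoothEuclidean.
Variables (R : realType) (n : nat).
Implicit Types (U : set 'rV[R]_n) (f g : 'rV[R]_n -> R) (k : nat).

(* [f] is [k] times Frechet differentiable at every point of [U]; this is only
   used for open [U], so that the values of [f] outside [U] are irrelevant. *)
Fixpoint diff_times k U f : Prop :=
  if k is k'.+1 then
    (forall y, U y -> differentiable f y) /\
    (forall v, diff_times k' U (fun y => 'D_v f y))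
  else True.

Definition smooth_on U f := forall k, diff_times k U f.

Lemma diff_times_ext k U f g : open U -> (forall y, U y -> f y = g y) ->
  diff_times k U f -> diff_times k U g.
Proof.
move=> oU; elim: k f g => //= k IH f g fg [df ddf].
have nfg y : U y -> \near y, f y = g y.
  by move=> Uy; apply: filterS (open_nbhs_nbhs (conj oU Uy)).
split=> [y Uy|v].
  by apply: near_eq_differentiable (df _ Uy); exact: nfg.
by apply: IH (ddf v) => y Uy; apply: near_eq_derive; exact: nfg.
Qed.

Lemma diff_timesW k U f : diff_times k.+1 U f -> diff_times k U f.
Proof. by elim: k f => //= k IH f [df ddf]; split=> // v; exact: IH (ddf v). Qed.

Lemma diff_times_cst k U (a : R) : open U -> diff_times k U (cst a).
Proof.
move=> oU; elim: k a => //= k IH a; split=> [y _|v].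
  exact: differentiable_cst.
by apply: diff_times_ext oU _ (IH 0) => y _; rewrite derive_cst.
Qed.

Lemma diff_timesD k U f g : open U -> diff_times k U f -> diff_times k U g ->
  diff_times k U (fun y => f y + g y).
Proof.
move=> oU; elim: k f g => //= k IH f g [df ddf] [dg ddg]; split=> [y Uy|v].
  by apply: differentiableD; [exact: df|exact: dg].
apply: diff_times_ext oU _ (IH _ _ (ddf v) (ddg v)) => y Uy.
by rewrite -deriveD //; apply: diff_derivable; [exact: df|exact: dg].
Qed.

Lemma diff_timesM k U f g : open U -> diff_times k U f -> diff_times k U g ->
  diff_times k U (fun y => f y * g y).
Proof.
move=> oU; elim: k f g => //= k IH f g [df ddf] [dg ddg]; split=> [y Uy|v].
  by apply: differentiableM; [exact: df|exact: dg].
have fk : diff_times k U f by exact: diff_timesW.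
have gk : diff_times k U g by exact: diff_timesW.
apply: diff_times_ext oU _
  (diff_timesD oU (IH _ _ fk (ddg v)) (IH _ _ gk (ddf v))) => y Uy.
by rewrite -[RHS]/('D_v (f * g) y) deriveM //; apply: diff_derivable;
  [exact: df|exact: dg].
Qed.

End SmoothEuclidean.

Record chart (R : realType) (M : topologicalType) (n : nat) := Chart {
  chart_dom : set M;
  chart_cod : set 'rV[R]_n;
  chart_map : M -> 'rV[R]_n;
  chart_inv : 'rV[R]_n -> M;
  chart_dom_open : open chart_dom;
  chart_cod_open : open chart_cod;
  chart_map_cod : forall x, chart_dom x -> chart_cod (chart_map x);
  chart_inv_dom : forall y, chart_cod y -> chart_dom (chart_inv y);
  chart_mapK : forall x, chart_dom x -> chart_inv (chart_map x) = x;
  chart_invK : forall y, chart_cod y -> chart_map (chart_inv y) = y;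
  chart_map_continuous : {within chart_dom, continuous chart_map};
  chart_inv_continuous : {within chart_cod, continuous chart_inv} }.

Record manifold (R : realType) := Manifold {
  mfd_space :> topologicalType;
  mfd_hausdorff : hausdorff_space mfd_space;
  mfd_second_countable : @second_countable mfd_space;
  mfd_dim : nat;
  mfd_atlas : set (chart R mfd_space mfd_dim);
  mfd_cover : forall x, exists2 c, mfd_atlas c & chart_dom c x;
  mfd_compatible : forall c d (i : 'I_mfd_dim), mfd_atlas c -> mfd_atlas d ->
    smooth_on (chart_cod c `&` chart_inv c @^-1` chart_dom d)
              (fun y => chart_map d (chart_inv c y) 0 i) }.

Section SmoothFunctions.
Variables (R : realType) (M : manifold R).
Implicit Types (W : set M) (f g : M -> R).

Definition smooth_in W f := forall c : chart R M (mfd_dim M), mfd_atlas c ->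
  smooth_on (chart_cod c `&` chart_inv c @^-1` W) (f \o chart_inv c).

Lemma open_chart_preimage (c : chart R M (mfd_dim M)) W : open W ->
  open (chart_cod c `&` chart_inv c @^-1` W).
Proof.
move=> oW; have := @chart_inv_continuous _ _ _ c.
move=> /continuousP /(_ _ oW).
by rewrite -(open_setSI _ (@chart_cod_open _ _ _ c)).
Qed.

Lemma smooth_in_cst W (a : R) : open W -> smooth_in W (cst a).
Proof. by move=> oW c cA k; exact/diff_times_cst/open_chart_preimage. Qed.

Lemma smooth_inD W f g : open W -> smooth_in W f -> smooth_in W g ->
  smooth_in W (fun x => f x + g x).
Proof.
move=> oW sf sg c cA k.
by apply: diff_timesD (sf _ cA k) (sg _ cA k); exact: open_chart_preimage.
Qed.

Lemma smooth_inM W f g : open W -> smooth_in W f -> smooth_in W g ->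
  smooth_in W (fun x => f x * g x).
Proof.
move=> oW sf sg c cA k.
by apply: diff_timesM (sf _ cA k) (sg _ cA k); exact: open_chart_preimage.
Qed.

Lemma smooth_inS W W' f : W' `<=` W -> smooth_in W f -> smooth_in W' f.
Proof.
move=> sW sf c cA k; have := sf c cA k.
elim: k (f \o _) => //= k IH h [dh ddh]; split=> [y [cy Wy]|v].
  by apply: dh; split=> //; exact: sW.
exact: IH.
Qed.

Definition smoothfun_pred : {pred M -> R} := [pred f | `[< smooth_in setT f >]].

(* The algebra C^oo(M). *)
Record smoothfun := SmoothFun {
  smoothfun_val :> M -> R;
  smoothfunP : smoothfun_val \in smoothfun_pred }.

HB.instance Definition _ := [isSub for smoothfun_val].
HB.instance Definition _ := [Choice of smoothfun by <:].

Lemma smoothfun_subring_closed : subring_closed smoothfun_pred.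
Proof.
split=> [|f g /asboolP sf /asboolP sg|f g /asboolP sf /asboolP sg]; apply/asboolP.
- exact: smooth_in_cst openT.
- apply: (smooth_inD openT sf).
  have -> : - g = (fun x => cst (-1) x * g x).
    by apply/funext => x; rewrite /= mulN1r.
  by apply: smooth_inM sg; [exact: openT|exact: smooth_in_cst openT].
- exact: smooth_inM openT sf sg.
Qed.
HB.instance Definition _ :=
  GRing.isSubringClosed.Build _ smoothfun_pred smoothfun_subring_closed.
HB.instance Definition _ := GRing.SubChoice_isSubComPzRing.Build _ _ smoothfun
  smoothfun_subring_closed.

Lemma smoothfun_scaler_closed : GRing.scaler_closed smoothfun_pred.
Proof.
move=> a f /asboolP sf; apply/asboolP.
by apply: (smooth_inM openT _ sf); exact: smooth_in_cst openT.
Qed.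
HB.instance Definition _ :=
  GRing.isScaleClosed.Build _ _ smoothfun_pred smoothfun_scaler_closed.
HB.instance Definition _ := [SubZmodule_isSubLmodule of smoothfun by <:].

Lemma mk_smoothfun_subproof f : smooth_in setT f -> f \in smoothfun_pred.
Proof. by move=> sf; apply/asboolP. Qed.
Definition mk_smoothfun f (sf : smooth_in setT f) : smoothfun :=
  SmoothFun (mk_smoothfun_subproof sf).

(* Tangent vectors at [x], as derivations at [x] of the algebra C^oo(M). *)
Definition is_tangent_vector (x : M) (X : smoothfun -> R) :=
  scalar X /\ forall f g : smoothfun, X (f * g) = f x * X g + g x * X f.

End SmoothFunctions.

(* A vector bundle is given by its fibres and a bundle atlas: local fibrewise
   linear trivializations with smooth transition functions. *)

Record vbundle (R : realType) (M : manifold R) := VBundle {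
  vb_fiber :> M -> lmodType R;
  vb_rank : nat;
  vb_index : Type;
  vb_dom : vb_index -> set M;
  vb_triv : vb_index -> forall x, vb_fiber x -> 'rV[R]_vb_rank;
  vb_untriv : vb_index -> forall x, 'rV[R]_vb_rank -> vb_fiber x;
  vb_dom_open : forall i, open (vb_dom i);
  vb_cover : forall x, exists i, vb_dom i x;
  vb_triv_linear : forall i x, vb_dom i x -> linear (@vb_triv i x);
  vb_trivK : forall i x, vb_dom i x ->
    cancel (@vb_triv i x) (@vb_untriv i x);
  vb_untrivK : forall i x, vb_dom i x ->
    cancel (@vb_untriv i x) (@vb_triv i x);
  vb_transition : forall i j (v : 'rV[R]_vb_rank) (k : 'I_vb_rank),
    smooth_in (vb_dom i `&` vb_dom j)
      (fun x => vb_triv j (vb_untriv i x v) 0 k) }.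

(* Not necessarily smooth sections. *)
Definition field (R : realType) (T : Type) (E : T -> lmodType R) : Type :=
  forall x, E x.

Section FieldLmodule.
Variables (R : realType) (T : Type) (E : T -> lmodType R).

Lemma field_ext (s t : field E) : (forall x, s x = t x) -> s = t.
Proof. exact: functional_extensionality_dep. Qed.

HB.instance Definition _ := gen_eqMixin (field E).
HB.instance Definition _ := gen_choiceMixin (field E).

Program Definition field_zmodMixin := @GRing.isZmodule.Build (field E)
  (fun x => 0) (fun s x => - s x) (fun s t x => s x + t x) _ _ _ _.
Next Obligation. by move=> s t r; apply: field_ext => x; exact: addrA. Qed.
Next Obligation. by move=> s t; apply: field_ext => x; exact: addrC. Qed.
Next Obligation. by move=> s; apply: field_ext => x; exact: add0r. Qed.
Next Obligation. by move=> s; apply: field_ext => x; exact: addNr. Qed.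
HB.instance Definition _ := field_zmodMixin.

Let fscalar (a : R) (s : field E) : field E := fun x => a *: s x.
Let fscalarA a b s : fscalar a (fscalar b s) = fscalar (a * b) s.
Proof. by apply: field_ext => x; exact: scalerA. Qed.
Let fscalar1 : left_id 1 fscalar.
Proof. by move=> s; apply: field_ext => x; exact: scale1r. Qed.
Let fscalarDr : right_distributive fscalar +%R.
Proof. by move=> a s t; apply: field_ext => x; exact: scalerDr. Qed.
Let fscalarDl s : {morph fscalar^~ s : a b / a + b}.
Proof. by move=> a b; apply: field_ext => x; exact: scalerDl. Qed.
HB.instance Definition _ := @GRing.Zmodule_isLmodule.Build R (field E)
  fscalar fscalarA fscalar1 fscalarDr fscalarDl.

End FieldLmodule.

Section Sections.
Variables (R : realType) (M : manifold R) (E : vbundle M).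
Implicit Types (W : set M).

Definition smooth_field_in W (s : field E) :=
  forall (i : vb_index E) (k : 'I_(vb_rank E)),
    smooth_in (W `&` vb_dom i) (fun x => vb_triv i (s x) 0 k).

Definition section_pred : {pred field E} :=
  [pred s | `[< smooth_field_in setT s >]].

(* The space Gamma(E) of smooth sections. *)
Record sect := Sect {
  sect_val : field E;
  sectP : sect_val \in section_pred }.

Definition sect_fun (s : sect) : forall x, E x := sect_val s.
Coercion sect_fun : sect >-> Funclass.

HB.instance Definition _ := [isSub for sect_val].
HB.instance Definition _ := [Choice of sect by <:].

Lemma smooth_field_scaleD (f : smoothfun M) (s t : field E) :
  smooth_field_in setT s -> smooth_field_in setT t ->
  smooth_field_in setT (fun x => f x *: s x + t x).
Proof.
move=> ss st i k.
have oi : open (setT `&` vb_dom i) by rewrite setTI; exact: vb_dom_open.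
have sf : smooth_in (setT `&` vb_dom i) f.
  by apply: (@smooth_inS _ _ setT) => //; apply/asboolP; exact: smoothfunP.
move=> c cA.
have := smooth_inD oi (smooth_inM oi sf (ss i k)) (st i k) cA.
move=> H m; apply: diff_times_ext (H m); first exact: open_chart_preimage.
by move=> y [_ [_ yi]] /=; rewrite (vb_triv_linear yi) !mxE.
Qed.

Lemma section_submod_closed : submod_closed section_pred.
Proof.
split=> [|a s t /asboolP ss /asboolP st]; apply/asboolP.
  move=> i k c cA m.
  have oi : open (setT `&` vb_dom i) by rewrite setTI; exact: vb_dom_open.
  have op := @open_chart_preimage _ _ c _ oi.
  apply: diff_times_ext op _ (diff_times_cst m 0 op).
  move=> y [_ [_ yi]] /=.
  have := vb_triv_linear yi (-1) 0 0.
  by rewrite scaler0 addr0 scaleN1r addNr => ->; rewrite mxE.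
have sa := smooth_in_cst a (@openT M).
exact: (smooth_field_scaleD (mk_smoothfun sa) ss st).
Qed.
HB.instance Definition _ :=
  GRing.isSubmodClosed.Build _ _ section_pred section_submod_closed.
HB.instance Definition _ := [SubChoice_isSubLmodule of sect by <:].

Lemma mk_sect_subproof (s : field E) :
  smooth_field_in setT s -> s \in section_pred.
Proof. by move=> ss; apply/asboolP. Qed.
Definition mk_sect (s : field E) (ss : smooth_field_in setT s) : sect :=
  Sect (mk_sect_subproof ss).

Lemma fscale_subproof (f : smoothfun M) (s : sect) :
  smooth_field_in setT (fun x => f x *: s x).
Proof.
have /asboolP ss := sectP s.
have /asboolP s0 := sectP 0.
have := smooth_field_scaleD f ss s0.
by congr smooth_field_in; apply: field_ext => x; rewrite /= addr0.
Qed.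

Definition fscale (f : smoothfun M) (s : sect) : sect :=
  mk_sect (fscale_subproof f s).

(* Sections of End E = E^* (x) E.  Here and below, a family of (multi)linear
   maps on the fibres is smooth if it maps smooth sections to smooth sections
   or functions. *)
Record endo := Endo {
  endo_fun :> forall x, E x -> E x;
  endo_linear : forall x, linear (@endo_fun x);
  endo_smooth : forall s : sect, smooth_field_in setT (fun x => endo_fun (s x)) }.

Definition endo_app (A : endo) (s : sect) : sect := mk_sect (endo_smooth A s).

Lemma endo_comp_linear (A B : endo) x : linear (fun u : E x => A x (B x u)).
Proof. by move=> a u v; rewrite !endo_linear. Qed.
Lemma endo_comp_smooth (A B : endo) (s : sect) :
  smooth_field_in setT (fun x => A x (B x (s x))).
Proof. exact: (endo_smooth A (endo_app B s)). Qed.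
Definition endo_comp (A B : endo) : endo :=
  Endo (endo_comp_linear A B) (endo_comp_smooth A B).

(* Smooth subbundles: the fibres are spanned by local smooth frames.  The rank
   is allowed to depend on the connected component of [M]. *)
Definition subbundle (F : forall x, set (E x)) :=
  forall x, exists (W : set M) (k : nat) (e : 'I_k -> field E),
    [/\ open W, W x, forall i, smooth_field_in W (e i),
        forall y, W y ->
          F y = [set \sum_(i < k) c i *: e i y | c in [set: 'I_k -> R]] &
        forall y, W y -> forall c : 'I_k -> R,
          \sum_(i < k) c i *: e i y = 0 -> forall i, c i = 0].

End Sections.

Arguments smooth_field_in {R M E}.
Arguments Endo {R M E}.

Record pairing (R : realType) (M : manifold R) (E : vbundle M) := Pairing {
  pair_fun :> forall x, E x -> E x -> R;
  pair_linear : forall x (v : E x), scalar (fun u => pair_fun u v);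
  pair_sym : forall x (u v : E x), pair_fun u v = pair_fun v u;
  pair_nondeg : forall x (u : E x), (forall v, pair_fun u v = 0) -> u = 0;
  pair_smooth : forall s t : sect E,
    smooth_in setT (fun x => pair_fun (s x) (t x)) }.

Definition pair_sect (R : realType) (M : manifold R) (E : vbundle M)
    (g : pairing E) (s t : sect E) : smoothfun M :=
  mk_smoothfun (pair_smooth g s t).

(* A bundle map [pi : E -> TM]; [anchor_fun x e f] is [pi(e)(f)]. *)
Record anchor (R : realType) (M : manifold R) (E : vbundle M) := Anchor {
  anchor_fun :> forall x, E x -> smoothfun M -> R;
  anchor_tangent : forall x (e : E x), is_tangent_vector x (anchor_fun e);
  anchor_linear : forall x f, scalar (fun e : E x => anchor_fun e f);
  anchor_smooth : forall (s : sect E) f,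
    smooth_in setT (fun x => anchor_fun (s x) f) }.

Definition anchor_der (R : realType) (M : manifold R) (E : vbundle M)
    (p : anchor E) (s : sect E) (f : smoothfun M) : smoothfun M :=
  mk_smoothfun (anchor_smooth p s f).

Record courant (R : realType) (M : manifold R) := Courant {
  ca_bundle :> vbundle M;
  ca_pair : pairing ca_bundle;
  ca_anchor : anchor ca_bundle;
  ca_bracket : sect ca_bundle -> sect ca_bundle -> sect ca_bundle;
  ca_linearl : forall v, linear (ca_bracket^~ v);
  ca_linearr : forall u, linear (ca_bracket u);
  ca_jacobi : forall u v w, ca_bracket u (ca_bracket v w) =
    ca_bracket (ca_bracket u v) w + ca_bracket v (ca_bracket u w);
  ca_leibniz : forall u f v, ca_bracket u (fscale f v) =
    fscale f (ca_bracket u v) + fscale (anchor_der ca_anchor u f) v;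
  ca_invariant : forall u v w,
    anchor_der ca_anchor u (pair_sect ca_pair v w) =
    pair_sect ca_pair (ca_bracket u v) w + pair_sect ca_pair v (ca_bracket u w);
  ca_symmetric : forall u v w,
    pair_sect ca_pair (ca_bracket u v + ca_bracket v u) w =
    anchor_der ca_anchor w (pair_sect ca_pair u v) }.

(* The complexification of [V]; the pair [(a, b)] stands for [a + i b]. *)

Definition cplx (R : realType) (V : lmodType R) : Type := (V * V)%type.

Section Complexification.
Variables (R : realType) (V : lmodType R).

HB.instance Definition _ := GRing.Zmodule.copy (cplx V) (V * V)%type.

Definition cscale (c : R[i]) (u : cplx V) : cplx V :=
  (complex.Re c *: u.1 - complex.Im c *: u.2, complex.Re c *: u.2 + complex.Im c *: u.1).

Lemma cscaleA a b u : cscale a (cscale b u) = cscale (a * b) u.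
Proof.
case: a b u => [a a'] [b b'] [u v]; congr pair => /=;
  rewrite !(scalerDr, scalerN, scalerDl, scaleNr, scalerA, opprD) ?opprK;
  by rewrite [RHS]addrACA; congr (_ + _); exact: addrC.
Qed.
Lemma cscale1 : left_id 1 cscale.
Proof. by case=> u v; congr pair; rewrite /= scale1r scale0r ?subr0 ?addr0. Qed.
Lemma cscaleDr : right_distributive cscale +%R.
Proof.
by move=> c u v; congr pair; rewrite /= !scalerDr ?opprD addrACA.
Qed.
Lemma cscaleDl u : {morph cscale^~ u : a b / a + b}.
Proof.
by case=> [a a'] [b b']; congr pair; rewrite /= !scalerDl ?opprD addrACA.
Qed.
HB.instance Definition _ := @GRing.Zmodule_isLmodule.Build R[i] (cplx V)
  cscale cscaleA cscale1 cscaleDr cscaleDl.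

Definition cconj (u : cplx V) : cplx V := (u.1, - u.2).
Definition creal (u : V) : cplx V := (u, 0).

End Complexification.

Definition trilinear (K : pzRingType) (V : lmodType K) (s : V -> V -> V -> K) :=
  [/\ forall v w, scalar (fun u => s u v w),
      forall u w, scalar (fun v => s u v w) &
      forall u v, scalar (s u v)].

Section Generalized.
Variables (R : realType) (M : manifold R) (E : courant M).

Local Notation "<| u , v |>" := (ca_pair E _ u v).
Local Notation EC x := (cplx (E x)).

(* [D v : Gamma(E^* (x) E)]; thus [D_u v] is [endo_app (D v) u]. *)
Record gconn := GConn {
  gconn_fun :> sect E -> endo E;
  gconn_linear : forall (a : R) (u v : sect E) x (e : E x),
    gconn_fun (a *: u + v) x e = a *: gconn_fun u x e + gconn_fun v x e;
  gconn_leibniz : forall (f : smoothfun M) (u : sect E) x (e : E x),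
    gconn_fun (fscale f u) x e = ca_anchor E x e f *: u x + f x *: gconn_fun u x e;
  gconn_metric : forall (u v : sect E) x (e : E x),
    ca_anchor E x e (pair_sect (ca_pair E) u v) =
    <| gconn_fun u x e, v x |> + <| u x, gconn_fun v x e |> }.

Definition cov (D : gconn) (u v : sect E) : sect E := endo_app (D v) u.

Definition torsion (D : gconn) (u v w : sect E) : smoothfun M :=
  pair_sect (ca_pair E) (cov D u v - cov D v u - ca_bracket u v) w
  + pair_sect (ca_pair E) (cov D w u) v.

Definition torsion_free D := forall u v w, torsion D u v w = 0.

Definition endo_parallel (D : gconn) (A : endo E) :=
  forall u v, cov D u (endo_app A v) - endo_app A (cov D u v) = 0.

Definition form_parallel (D : gconn) (B : sect E -> sect E -> smoothfun M) :=
  forall u v w, anchor_der (ca_anchor E) u (B v w)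
    - B (cov D u v) w - B v (cov D u w) = 0.

(* Complex-linear extensions; [cplx (sect E)] is Gamma(E^C). *)
Definition ceval (u : cplx (sect E)) x : EC x := (u.1 x, u.2 x).

Definition cendo (A : endo E) x (u : EC x) : EC x := (A x u.1, A x u.2).

Definition cbracket (u v : cplx (sect E)) : cplx (sect E) :=
  (ca_bracket u.1 v.1 - ca_bracket u.2 v.2,
   ca_bracket u.1 v.2 + ca_bracket u.2 v.1).

Definition eigenbundle10 (J : endo E) x : set (EC x) :=
  [set u | cendo J u = (0 +i* 1)%C *: u].
Arguments eigenbundle10 J x : clear implicits.

Definition eigenbundle01 (J : endo E) x : set (EC x) :=
  [set u | eigenbundle10 J x (cconj u)].
Arguments eigenbundle01 J x : clear implicits.

Definition gen_complex (J : endo E) :=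
  [/\ forall x (u v : E x), <| J x u, v |> = - <| u, J x v |>,
      forall x (u : E x), J x (J x u) = - u &
      forall u v : cplx (sect E),
        (forall x, eigenbundle10 J x (ceval u x)) ->
        (forall x, eigenbundle10 J x (ceval v x)) ->
        forall x, eigenbundle10 J x (ceval (cbracket u v) x)].

Definition orthogonal (F : forall x, set (E x)) x : set (E x) :=
  [set u | forall v, F x v -> <| u, v |> = 0].
Arguments orthogonal F x : clear implicits.

(* [gm_end] is G^end; it is determined by the subbundle [E_-]. *)
Record gmetric := GMetric {
  gm_neg : forall x, set (E x);
  gm_subbundle : subbundle gm_neg;
  gm_nondeg : forall x (u : E x), gm_neg u ->
    (forall v, gm_neg v -> <| u, v |> = 0) -> u = 0;
  gm_end : endo E;
  gm_endN : forall x (u : E x), gm_neg u -> gm_end x u = - u;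
  gm_endP : forall x (u : E x), orthogonal gm_neg x u -> gm_end x u = u }.
Arguments gm_neg g x : clear implicits.

Definition gm_pos (G : gmetric) : forall x, set (E x) :=
  orthogonal (gm_neg G).
Arguments gm_pos G x : clear implicits.

Definition gm_form (G : gmetric) x (u v : E x) : R := <| gm_end G x u, v |>.

Definition gm_form_sect (G : gmetric) (u v : sect E) : smoothfun M :=
  pair_sect (ca_pair E) (endo_app (gm_end G) u) v.

Definition gen_kahler (G : gmetric) (J : endo E) :=
  [/\ gen_complex J,
      forall x (u : E x), gm_end G x (J x u) = J x (gm_end G x u) &
      gen_complex (endo_comp (gm_end G) J)].

Definition adapted_gen_complex (J : endo E) : set gconn :=
  [set D | torsion_free D /\ endo_parallel D J].

Definition adapted_gen_kahler (G : gmetric) (J : endo E) : set gconn :=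
  [set D | [/\ torsion_free D, form_parallel D (gm_form_sect G) &
               endo_parallel D J]].

Definition tensor3 : Type := forall x, E x -> E x -> E x -> R.
Definition ctensor3 : Type := forall x, EC x -> EC x -> EC x -> R[i].

Definition smooth_tensor3 (S : tensor3) := forall u v w : sect E,
  smooth_in setT (fun x => S x (u x) (v x) (w x)).

Definition smooth_ctensor3 (s : ctensor3) := forall u v w : cplx (sect E),
  smooth_in setT (fun x => complex.Re (s x (ceval u x) (ceval v x) (ceval w x))) /\
  smooth_in setT (fun x => complex.Im (s x (ceval u x) (ceval v x) (ceval w x))).

Definition ctensor_add (s t : ctensor3) : ctensor3 :=
  fun x u v w => s x u v w + t x u v w.

Definition sk (s : ctensor3) : ctensor3 :=
  fun x u v w => s x u v w - s x u w v.

Definition re_tensor (s : ctensor3) : tensor3 :=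
  fun x u v w => complex.Re (s x (creal u) (creal v) (creal w)).

(* For a decomposition [E^C = \bigoplus_i F i], the image of
   Gamma(S^2 (F a)^* (x) (F b)^* ) in Gamma(S^2 (E^C)^* (x) (E^C)^* ) under
   extension by zero. *)
Definition S2_sections (I : Type) (F : I -> forall x, set (EC x)) (a b : I) :
    set ctensor3 :=
  [set s | [/\ forall x, trilinear (s x),
               forall x u v w, s x u v w = s x v u w,
               smooth_ctensor3 s &
               forall x i j k u v w, F i x u -> F j x v -> F k x w ->
                 ~ [/\ i = a, j = a & k = b] -> s x u v w = 0]].

(* E^C = L (+) Lbar; [true] stands for L. *)
Definition split_gen_complex (J : endo E) (t : bool) x : set (EC x) :=
  if t then eigenbundle10 J x else eigenbundle01 J x.
Arguments split_gen_complex J t x : clear implicits.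

(* The four-fold decomposition of E^C; the first component of the index is the
   sign of E_+ / E_-, the second one is [true] for L. *)
Definition split_gen_kahler (G : gmetric) (J : endo E) (t : bool * bool) x :
    set (EC x) :=
  let F := if t.1 then gm_pos G x else gm_neg G x in
  [set u | F u.1 /\ F u.2] `&` split_gen_complex J t.2 x.
Arguments split_gen_kahler G J t x : clear implicits.

Definition is_so x (A : E x -> E x) :=
  linear A /\ forall u v, <| A u, v |> = - <| u, A v |>.

Definition u_bundle (J : endo E) x : set (E x -> E x) :=
  [set A | is_so A /\ forall u, A (J x u) = J x (A u)].
Arguments u_bundle J x : clear implicits.

Definition u_stabilizer (G : gmetric) (J : endo E) x : set (E x -> E x) :=
  [set A | u_bundle J x A /\
           forall v w, gm_form G (A v) w + gm_form G v (A w) = 0].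
Arguments u_stabilizer G J x : clear implicits.

(* u(F) for a [J]-invariant subbundle [F] on which the scalar product is
   non-degenerate, included in so(E) via E = F (+) F^perp. *)
Definition u_sub (F : forall x, set (E x)) (J : endo E) x : set (E x -> E x) :=
  [set A | [/\ linear A,
               forall u, F x u -> F x (A u),
               forall u, orthogonal F x u -> A u = 0,
               forall u v, F x u -> F x v -> <| A u, v |> = - <| u, A v |> &
               forall u, F x u -> A (J x u) = J x (A u)]].
Arguments u_sub F J x : clear implicits.

Definition cyclic_sum x (S : E x -> E x -> E x -> R) u v w : R :=
  S u v w + S v w u + S w u v.

(* so(E) is identified with Lambda^2 E^* by [A |-> <A v, w>]. *)
Definition prolong (h : forall x, set (E x -> E x)) x :
    set (E x -> E x -> E x -> R) :=
  [set S | [/\ trilinear (V := E x) S,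
               forall u, exists2 A, h x A & forall v w, S u v w = <| A v, w |> &
               forall u v w, cyclic_sum S u v w = 0]].
Arguments prolong h x : clear implicits.

(* The prolongation of h(F) inside F^* (x) h(F), for h(F) a bundle of
   endomorphisms of F included in so(E); the result is included in
   E^* (x) so(E). *)
Definition prolong_sub (F : forall x, set (E x))
    (h : forall x, set (E x -> E x)) x : set (E x -> E x -> E x -> R) :=
  [set S | [/\ trilinear (V := E x) S,
               forall u, orthogonal F x u -> forall v w, S u v w = 0,
               forall u, F x u ->
                 exists2 A, h x A & forall v w, S u v w = <| A v, w |> &
               forall u v w, F x u -> F x v -> F x w ->
                 cyclic_sum S u v w = 0]].
Arguments prolong_sub F h x : clear implicits.

Definition tensor_sections (P : forall x, set (E x -> E x -> E x -> R)) :
    set tensor3 :=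
  [set S | smooth_tensor3 S /\ forall x, P x (S x)].

Definition direct_sum (V : zmodType) (A B C : set V) :=
  C = [set a + b | a in A & b in B] /\ A `&` B = [set 0].

(* [D' = D + S]; this determines [D'] as the scalar product is
   non-degenerate. *)
Definition shifted_by (D : gconn) (S : tensor3) (D' : gconn) :=
  forall (v : sect E) x (u w : E x),
    <| D' v x u, w |> = <| D v x u, w |> + S x u (v x) w.

Definition tensor_subspace (V : set tensor3) :=
  V (fun x u v w => 0) /\
  forall (a : R) S S', V S -> V S' ->
    V (fun x u v w => a * S x u v w + S' x u v w).

Definition affine_over (X : set gconn) (V : set tensor3) :=
  [/\ tensor_subspace V, X !=set0,
      forall D S, X D -> V S -> exists! D', X D' /\ shifted_by D S D' &
      forall D D', X D -> X D' -> exists! S, V S /\ shifted_by D S D'].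

End Generalized.

Arguments eigenbundle10 {R M E} J x.
Arguments eigenbundle01 {R M E} J x.
Arguments orthogonal {R M E} F x.
Arguments gm_neg {R M E} g x.
Arguments gm_pos {R M E} G x.
Arguments split_gen_complex {R M E} J t x.
Arguments split_gen_kahler {R M E} G J t x.
Arguments u_bundle {R M E} J x.
Arguments u_stabilizer {R M E} G J x.
Arguments u_sub {R M E} F J x.
Arguments prolong {R M E} h x.
Arguments prolong_sub {R M E} F h x.

(* Main.v *)
(** The difference of two connections making [J] (and [G]) parallel is a tensor
  [S] with values in [u(E)], and the torsions differ by the cyclic sum of [S]:
  this gives the affine structure over the first prolongation.

  Existence.  Generalized connections exist by gluing flat local ones: if the
  [n]-th one is cut off so that its Leibniz rule carries a factor [a_n], then
  its multiples by [w_n] add up to a connection as soon as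
  [sum_n w_n a_n = 1]; taking [w_n = prod_(m < n) (1 - a_m)] the sum telescopes, and it is locally
  finite because every point has a neighbourhood on which some [a_m] is [1].
  Symmetrizing makes the connection metric, averaging over the group generated
  by [J] and [G] makes both parallel.  Integrability then says that the torsion
  [T] has no component of type (3,0) with respect to [J] and to [G J].  For such
  a [T], an explicit [S] with values in the stabilizer has cyclic sum [- T].

  Prolongation.  If [S] lies in the prolongation of [u(E)], its complex trilinear
  extension is determined by its values on [L, L, Lbar], where the vanishing of
  the cyclic sum turns into symmetry in the first two arguments; [eta] is twice
  that component.  For a generalized metric the vanishing cyclic sum moreover
  kills every component mixing [E_+] and [E_-].

  Part (i) of the existence statement is part (ii) with [G = id]. *)

Require Import Defs.
From mathcomp Require Import all_boot all_order all_algebra.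
From mathcomp Require Import boolp classical_sets functions cardinality reals.
From mathcomp Require Import topology normedtype derive sequences realfun exp.
From mathcomp Require Import ring lra.
From mathcomp.real_closed Require Import complex.

Set Implicit Arguments.
Unset Strict Implicit.
Unset Printing Implicit Defensive.

Import Order.TTheory GRing.Theory Num.Theory numFieldNormedType.Exports.
Local Open Scope classical_set_scope.
Local Open Scope ring_scope.

(** * Smooth bump functions *)

(** Why the explicit [S] exists: split arguments by sign ([E_+] or [E_-]) and by type ([L] or
    [Lbar]). Let [P] average a 3-form over the action of [1, J, G, G J] on its last two arguments.
    It keeps exactly the components whose last two arguments have equal sign and opposite type, that
    is, the values in the stabilizer. No (3,0)-part means that the three arguments never have the
    same type for [J], nor for [G J], whose types agree with those of [J] on [E_+] and are swapped
    on [E_-]. On a pure component two of the three pairs of arguments have opposite type, so the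
    cyclic sum of [P T] counts [T] twice. On a mixed component only the pair of equal sign can
    count, and its types are opposite, as otherwise the third argument would complete a
    (3,0)-component for [J] or for [G J]; so [T] is counted once. The coefficients must therefore be
    -1/2 and -1, which gives [S] as [- P T] plus half of the pure part. That pure part is the mean
    of [P T] and of [P T] at [(G u, G v, w)], so they enter [S] with coefficients -3/4 and 1/4; the
    1/4 inside [P] turns these into the 3 and the [16^-1] of the code. *)

Section Flat.
Variable R : realType.

(** The power of [t^-1] is a parameter because differentiation raises it: the family over all [m] is
    closed under derivatives up to linear combinations, so smoothness follows by induction on the
    order, uniformly in [m]. *)
Definition flat (m : nat) (t : R) : R :=
  if 0 < t then t^-1 ^+ m * expR (- t^-1) else 0.

Lemma flat_ge0 m t : 0 <= flat m t.
Proof.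
rewrite /flat; case: ifP => // t0.
by rewrite mulr_ge0 ?expR_ge0 ?exprn_ge0 ?invr_ge0 ?ltW.
Qed.

Lemma flat_gt0 m t : 0 < t -> 0 < flat m t.
Proof. by move=> t0; rewrite /flat t0 mulr_gt0 ?expR_gt0 ?exprn_gt0 ?invr_gt0. Qed.

Lemma flat_le0 m t : t <= 0 -> flat m t = 0.
Proof. by rewrite /flat ltNge => ->. Qed.

(** The exponential at [t^-1] dominates its Taylor term of degree [m.+1], one more than the power to
    be absorbed; the spare factor is the [t] that makes the bound vanish at 0. *)
Lemma flat_le m t : `|flat m t| <= m.+1`!%:R * `|t|.
Proof.
rewrite ger0_norm ?flat_ge0 //.
have [t0|t0] := ltP 0 t; last by rewrite flat_le0 // mulr_ge0.
rewrite /flat t0 gtr0_norm // expRN ler_pdivrMr ?expR_gt0 //.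
have u0 : 0 <= t^-1 by rewrite invr_ge0 ltW.
have := expR_ge1Dxn m u0.
have f0 : 0 < m.+1`!%:R :> R by rewrite ltr0n fact_gt0.
set e := expR _ => H.
have {H} : t^-1 ^+ m.+1 <= m.+1`!%:R * e.
  rewrite mulrC -ler_pdivrMr //; apply: le_trans H.
  by rewrite lerDr.
move=> H; rewrite mulrAC -ler_pdivrMr //; apply: le_trans H.
by rewrite exprSr.
Qed.

Lemma flat_cvg0 m : flat m t @[t --> 0^'] --> (0 : R).
Proof.
apply/cvgr0Pnorm_le => e e0.
have f0 : 0 < m.+1`!%:R :> R by rewrite ltr0n fact_gt0.
have d0 : 0 < e / m.+1`!%:R by rewrite divr_gt0.
near=> t; apply: le_trans (flat_le m t) _.
rewrite mulrC -ler_pdivlMr //.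
near: t; apply: dnbhs0_le => //.
Unshelve. all: by end_near. Qed.

Lemma is_derive_flat m (t : R) :
  is_derive t (1 : R) (flat m) (flat m.+2 t - m%:R * flat m.+1 t).
Proof.
have [t0|t0|<-] := ltgtP 0 t; last first.
- rewrite !flat_le0 // mulr0 subr0.
  (* The difference quotient of [flat m] at 0 is [flat m.+1 h], which tends to 0. *)
  have H : h^-1 *: ((flat m \o shift (0:R)) (h *: (1 : R)) - flat m 0)
             @[h --> 0^'] --> (0 : R).
    apply: cvg_trans (flat_cvg0 m.+1); apply: near_eq_cvg.
    near=> h; rewrite /= addr0 (flat_le0 _ (lexx 0)) subr0.
    rewrite [X in flat m X](mulr1 h) /flat; case: ifP => _; last by rewrite scaler0.
    by rewrite exprS -[_ *: _]/(_ * _) mulrA.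
  by apply: DeriveDef; [apply/cvg_ex; exists 0 | apply/cvg_lim].
- rewrite !flat_le0 ?ltW // mulr0 subr0.
  apply: near_eq_is_derive (is_derive_cst (0:R) t (1:R)).
  near=> s; rewrite flat_le0 //; apply/ltW; near: s; exact: lt_nbhsl.
- have tn0 : t != 0 by rewrite gt_eqF.
  suff D0 : is_derive t (1 : R) (fun s => s^-1 ^+ m * expR (- s^-1)) (flat m.+2 t - m%:R * flat m.+1 t).
    apply: near_eq_is_derive D0.
    near=> s; rewrite /flat ifT //; near: s; exact: lt_nbhsr.
  rewrite /flat t0.
  have D1 : is_derive t (1 : R) (fun s : R => s^-1) (- t^-1 ^+ 2).
    have di : derivable (id : R -> R) t 1 by exact: derivable_id.
    apply: DeriveDef; first exact: (derivableV (f := id)).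
    by rewrite (deriveV (f := id)) // derive_id exprVn -[_ *: _]/(_ * _) mulr1.
  have D2 : is_derive t (1 : R) (fun s : R => - s^-1) (t^-1 ^+ 2).
    by have := is_deriveN D1; rewrite opprK.
  have D3 : is_derive t (1 : R) (fun s : R => expR (- s^-1)) (t^-1 ^+ 2 * expR (- t^-1)).
    have := @is_derive1_comp _ expR (fun s => - s^-1) _ _ _ (is_derive_expR (- t^-1)) D2.
    by rewrite mulrC.
  have D4 : is_derive t (1 : R) (fun s : R => s^-1 ^+ m) (- (m%:R * t^-1 ^+ m.+1)).
    have := is_deriveX m D1.
    have -> : GRing.inv ^+ m = (fun s : R => s^-1 ^+ m) by apply/funext => s; rewrite fctE.
    move=> H; apply: (is_derive_eq H).
    case: (m) => [|k]; first by rewrite !mul0r scale0r oppr0.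
    by rewrite -[_ *: _]/(_ * _) /= !exprSr; ring.
  have := is_deriveM D4 D3.
  move=> H; apply: (is_derive_eq H).
  by rewrite -![_ *: _]/(_ * _) !exprSr; ring.
Unshelve. all: by end_near. Qed.

End Flat.

(** * Calculus of repeatedly differentiable functions on open sets *)

Section DiffTimes.
Variables (R : realType) (n : nat).
Implicit Types (U V : set 'rV[R]_n) (f g : 'rV[R]_n -> R) (k : nat).

(** [diff_times] only looks at ambient derivatives at the points of the set, so covering the points
    is enough and the sets [V] may be arbitrary. *)
Lemma diff_times_local k U f :
  (forall y, U y -> exists2 V, V y & diff_times k V f) -> diff_times k U f.
Proof.
elim: k f => //= k IH f H; split=> [y /H[V Vy [df _]]|v]; first exact: df.
by apply: IH => y /H[V Vy [_ ddf]]; exists V.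
Qed.

Lemma is_derive_chain (g : R -> R) (dg : R) f y v : differentiable f y ->
  is_derive (f y) 1 g dg ->
  differentiable (g \o f) y /\ 'D_v (g \o f) y = dg * 'D_v f y.
Proof.
move=> df [dg1 dgE]; have dg' : differentiable g (f y) by exact/derivable1_diffP.
have dgf := differentiable_comp df dg'; split=> //.
rewrite deriveE // diff_comp //= -(deriveE v df) deriv1E // derive1E dgE.
by rewrite -[LHS]/(_ * _) mulrC.
Qed.

Lemma diff_times_flat k U f : open U -> diff_times k U f ->
  forall m, diff_times k U (fun y => flat m (f y)).
Proof.
move=> oU; elim: k f => //= k IH f [df ddf] m.
have fk : diff_times k U f by apply: diff_timesW; split.
have H v y (Uy : U y) := is_derive_chain v (df y Uy) (is_derive_flat m (f y)).
split=> [y Uy|v]; first by case: (H 0 y Uy).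
have d1 := diff_timesD oU (IH f fk m.+2)
  (diff_timesM oU (diff_times_cst k (- m%:R) oU) (IH f fk m.+1)).
apply: diff_times_ext oU _ (diff_timesM oU d1 (ddf v)) => y Uy.
by rewrite (H v y Uy).2 mulNr.
Qed.

Lemma diff_timesV k U f : open U -> (forall y, U y -> f y != 0) ->
  diff_times k U f -> diff_times k U (fun y => (f y)^-1).
Proof.
move=> oU f0; elim: k f f0 => //= k IH f f0 [df ddf].
have fk : diff_times k U f by apply: diff_timesW; split.
split=> [y Uy|v]; first by apply: differentiableV; [exact: df|exact: f0].
have d1 := diff_timesM oU (IH f f0 fk) (IH f f0 fk).
apply: diff_times_ext oU _
  (diff_timesM oU (diff_timesM oU (diff_times_cst k (- 1) oU) d1) (ddf v)) => y Uy.
rewrite deriveV; [|exact: f0|exact/diff_derivable/df].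
by rewrite -[_ *: _ in RHS]/(_ * _) mulN1r -exprVn expr2.
Qed.

Lemma diff_times_coord k U (i : 'I_n) : open U -> diff_times k U (fun y => y 0 i).
Proof.
move=> oU; case: k => //= k; split=> [y _|v]; first exact: differentiable_coord.
apply: diff_times_ext oU _ (diff_times_cst k (v 0 i) oU) => y Uy.
have @l : {linear 'rV[R]_n -> R}.
  by exists (fun N : 'rV[R]_n => N 0 i); do 2![eexists]; do ?[constructor];
     rewrite ?mxE// => ? *; rewrite ?mxE//; move=> ?; rewrite !mxE.
rewrite deriveE; last exact: differentiable_coord.
have -> : (fun y : 'rV[R]_n => y 0 i) = l by [].
by rewrite diff_lin //; exact: coord_continuous.
Qed.

End DiffTimes.

(** * Smooth functions on a manifold and cut-offs *)

Section SmoothIn.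
Variables (R : realType) (M : manifold R).
Implicit Types (W V : set M) (f g : M -> R).

Lemma smooth_in_local W f :
  (forall x, W x -> exists2 V, V x & smooth_in V f) -> smooth_in W f.
Proof.
move=> H c cA k; apply: diff_times_local => y [cy /H[V Vy sf]].
by exists (chart_cod c `&` chart_inv c @^-1` V); last exact: sf.
Qed.

Lemma smooth_in_ext W f g : open W -> (forall x, W x -> f x = g x) ->
  smooth_in W f -> smooth_in W g.
Proof.
move=> oW fg sf c cA k; apply: diff_times_ext (sf c cA k).
  exact: open_chart_preimage.
by move=> y [_ /fg].
Qed.

Lemma smooth_inN W f : open W -> smooth_in W f -> smooth_in W (fun x => - f x).
Proof.
move=> oW sf; apply: smooth_in_ext oW _ (smooth_inM oW (smooth_in_cst (- 1) oW) sf).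
by move=> x _; rewrite mulN1r.
Qed.

Lemma smooth_inB W f g : open W -> smooth_in W f -> smooth_in W g ->
  smooth_in W (fun x => f x - g x).
Proof. by move=> oW sf sg; apply: smooth_inD => //; exact: smooth_inN. Qed.

Lemma smooth_inV W f : open W -> (forall x, W x -> f x != 0) ->
  smooth_in W f -> smooth_in W (fun x => (f x)^-1).
Proof.
move=> oW f0 sf c cA k; apply: diff_timesV (sf c cA k).
  exact: open_chart_preimage.
by move=> y [_ /f0].
Qed.

Lemma smooth_in_sum W (I : Type) (s : seq I) (P : pred I) (F : I -> M -> R) :
  open W -> (forall i, smooth_in W (F i)) ->
  smooth_in W (fun x => \sum_(i <- s | P i) F i x).
Proof.
move=> oW sF; elim: s => [|i s IH].
  by apply: smooth_in_ext (smooth_in_cst 0 oW) => // x _; rewrite big_nil.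
case: (boolP (P i)) => Pi.
  by apply: smooth_in_ext (smooth_inD oW (sF i) IH) => // x _; rewrite big_cons Pi.
by apply: smooth_in_ext IH => // x _; rewrite big_cons (negPf Pi).
Qed.

Lemma smooth_in_prod W (I : Type) (s : seq I) (P : pred I) (F : I -> M -> R) :
  open W -> (forall i, smooth_in W (F i)) ->
  smooth_in W (fun x => \prod_(i <- s | P i) F i x).
Proof.
move=> oW sF; elim: s => [|i s IH].
  by apply: smooth_in_ext (smooth_in_cst 1 oW) => // x _; rewrite big_nil.
case: (boolP (P i)) => Pi.
  by apply: smooth_in_ext (smooth_inM oW (sF i) IH) => // x _; rewrite big_cons Pi.
by apply: smooth_in_ext IH => // x _; rewrite big_cons (negPf Pi).
Qed.

Lemma smooth_in_det W n (A : M -> 'M[R]_n) : open W ->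
  (forall i j, smooth_in W (fun x => A x i j)) ->
  smooth_in W (fun x => \det (A x)).
Proof.
move=> oW sA; apply: smooth_in_sum => // s; apply: smooth_inM => //.
  exact: smooth_in_cst.
exact: smooth_in_prod.
Qed.

Lemma smooth_in_invmx W n (A : M -> 'M[R]_n) : open W ->
  (forall x, W x -> A x \in unitmx) ->
  (forall i j, smooth_in W (fun x => A x i j)) ->
  forall i j, smooth_in W (fun x => invmx (A x) i j).
Proof.
move=> oW uA sA i j.
have sc : smooth_in W (fun x => \adj (A x) i j).
  have H : smooth_in W (fun x => (-1) ^+ (j + i) * \det (row' j (col' i (A x)))).
    apply: smooth_inM => //; first exact: smooth_in_cst.
    apply: smooth_in_det => // k l.
    by apply: smooth_in_ext (sA (lift j k) (lift i l)) => // x _; rewrite !mxE.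
  by apply: smooth_in_ext H => // x _; rewrite mxE.
have sd := smooth_in_det oW sA.
have d0 x : W x -> \det (A x) != 0 by move=> /uA; rewrite unitmxE unitfE.
apply: smooth_in_ext (smooth_inM oW (smooth_inV oW d0 sd) sc) => // x Wx.
by rewrite /invmx (uA x Wx) [RHS]mxE.
Qed.

(** [V] is covered by [W] and the complement of [K]; on the latter, open since [K] is closed, the
    function is constant. *)
Lemma smooth_in_zero_ext V W K f : open V -> closed K -> K `<=` W ->
  (forall x, ~ K x -> f x = 0) -> smooth_in (V `&` W) f -> smooth_in V f.
Proof.
move=> oV cK KW f0 sf; apply: smooth_in_local => x Vx.
have [Kx|nKx] := pselect (K x); first by exists (V `&` W) => //; split=> //; exact: KW.
have oK : open (V `&` ~` K) by apply: openI => //; exact: closed_openC.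
exists (V `&` ~` K) => //.
by apply: smooth_in_ext (smooth_in_cst 0 oK) => // y [_ /f0].
Qed.

Lemma open_chart_mappre (c : chart R M (mfd_dim M)) U : open U ->
  open (chart_dom c `&` chart_map c @^-1` U).
Proof.
move=> oU; have := @chart_map_continuous _ _ _ c.
move=> /continuousP /(_ _ oU).
by rewrite -(open_setSI _ (@chart_dom_open _ _ _ c)).
Qed.

(** A radial step function is transported from a chart and extended by zero; the work lies in
    finding a support that is closed in [M] and not only in the chart. *)
Lemma exists_bump W x0 : open W -> W x0 -> exists (b : smoothfun M) (K : set M),
  [/\ closed K, K `<=` W, forall x, ~ K x -> b x = 0 & \near x0, b x0 = 1].
Proof.
move=> oW Wx0; have [c cA cx0] := mfd_cover x0.
set n := mfd_dim M in c cA cx0; set y0 := chart_map c x0.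
have oO := open_chart_preimage (c := c) oW; set O := _ `&` _ in oO.
have Oy0 : O y0.
  by split; [exact: chart_map_cod|rewrite /preimage /= chart_mapK].
have [e /= e0 eO] : exists2 e : R, 0 < e & ball y0 e `<=` O.
  by apply/nbhs_ballP; exact: open_nbhs_nbhs.
pose C : set 'rV[R]_n := [set y | forall i, `[y0 0 i - e / 2, y0 0 i + e / 2]%classic (y 0 i)].
have CO : C `<=` O.
  move=> y Cy; apply: eO; rewrite /ball /= /mx_ball; split=> // i j.
  rewrite ord1 /ball /=; have := Cy j; rewrite /= in_itv /= => /andP[h1 h2].
  by rewrite ltr_norml; apply/andP; split; lra.
have cC : compact C.
  by apply: (rV_compact (A := fun i => `[y0 0 i - e / 2, y0 0 i + e / 2]%classic)) => i; exact: segment_compact.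
(* The image of the cube is compact, hence closed because [M] is Hausdorff. *)
pose K := chart_inv c @` C.
have cK : closed K.
  apply: compact_closed; first exact: mfd_hausdorff.
  apply: continuous_compact => //.
  apply: continuous_subspaceW (@chart_inv_continuous _ _ _ c).
  by move=> y /CO[].
have KW : K `<=` W by move=> _ [y /CO[_ Wy] <-].
have Kc : K `<=` chart_dom c by move=> _ [y /CO[cy _] <-]; exact: chart_inv_dom.
(* The squared Euclidean distance is used since it is a polynomial; a point outside the cube has one
   coordinate that already makes [q] at least [r]. *)
pose q (y : 'rV[R]_n) : R := \sum_i (y 0 i - y0 0 i) ^+ 2.
have q0 : q y0 = 0 by rewrite /q big1 // => i _; rewrite subrr expr0n.
pose r := (e / 2) ^+ 2.
have r0 : 0 < r by rewrite exprn_gt0 // divr_gt0.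
have qC y : ~ C y -> r <= q y.
  move=> nC; rewrite leNgt; apply/negP => qr; apply: nC => i /=.
  have : (y 0 i - y0 0 i) ^+ 2 < (e / 2) ^+ 2.
    apply: le_lt_trans qr; rewrite /q (bigD1 i) //= lerDl.
    by apply: sumr_ge0 => j _; exact: sqr_ge0.
  rewrite -ltr_sqrt ?sqr_gt0 ?gt_eqF ?divr_gt0 // !sqrtr_sqr.
  rewrite (gtr0_norm (x := e / 2)) ?divr_gt0 // ltr_norml in_itv /= => /andP[h1 h2].
  by apply/andP; split; lra.
(* [h] is 1 for [t <= r / 2] and 0 for [t >= r]; the two terms of the denominator never vanish
   together. *)
pose h t := flat 0 (r - t) / (flat 0 (r - t) + flat 0 (t - r / 2)).
have hd t : 0 < flat 0 (r - t) + flat 0 (t - r / 2).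
  have [rt|rt] := ltP t r.
    by rewrite ltr_pwDl ?flat_ge0 // flat_gt0 // subr_gt0.
  by rewrite ltr_wpDl ?flat_ge0 // flat_gt0 //; lra.
pose b x := if x \in chart_dom c then h (q (chart_map c x)) else 0.
have b0 x : ~ K x -> b x = 0.
  rewrite /b; case: ifPn => // /set_mem cx nK.
  rewrite /h flat_le0 ?mul0r // subr_le0; apply: qC => Cx.
  by apply: nK; exists (chart_map c x) => //; rewrite chart_mapK.
have sb : smooth_in setT b.
  apply: (smooth_in_zero_ext (W := chart_dom c) (K := K)) => //; first exact: openT.
  rewrite setTI; have oc := @chart_dom_open _ _ _ c.
  suff sh : smooth_in (chart_dom c) (fun x => h (q (chart_map c x))).
    by apply: smooth_in_ext sh => // x cx; rewrite /b mem_set.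
  have sq : smooth_in (chart_dom c) (fun x => q (chart_map c x)).
    apply: smooth_in_sum => // i.
    have sy : smooth_in (chart_dom c) (fun x => chart_map c x 0 i - y0 0 i).
      apply: smooth_inB => //; last exact: smooth_in_cst.
      by move=> d dA; exact: mfd_compatible.
    by apply: smooth_in_ext (smooth_inM oc sy sy) => // x _; rewrite expr2.
  have sflat f : smooth_in (chart_dom c) f -> smooth_in (chart_dom c) (fun x => flat 0 (f x)).
    move=> sf d dA k; apply: diff_times_flat; last exact: sf.
    exact: open_chart_preimage.
  have s1 : smooth_in (chart_dom c) (fun x => flat 0 (r - q (chart_map c x))).
    by apply: sflat; apply: smooth_inB => //; exact: smooth_in_cst.
  apply: smooth_inM => //; apply: smooth_inV => //.
    by move=> x _; rewrite gt_eqF.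
  apply: smooth_inD => //; apply: sflat; apply: smooth_inB => //.
  exact: smooth_in_cst.
exists (mk_smoothfun sb), K; split => //.
have qcont : continuous q.
  have sq : diff_times 1 setT q.
    rewrite /q; elim: (index_enum _) => [|i s IH].
      by apply: diff_times_ext (diff_times_cst _ 0 openT) => [|y _];
        [exact: openT|rewrite big_nil].
    have d1 := diff_timesD openT (diff_times_coord 1 i openT) (diff_times_cst 1 (- y0 0 i) openT).
    apply: diff_times_ext (diff_timesD openT (diff_timesM openT d1 d1) IH) => [|y _].
      exact: openT.
    by rewrite big_cons expr2.
  by move=> y; apply: differentiable_continuous; exact: sq.1.
have oq : open [set y | q y < r / 2].
  have -> : [set y | q y < r / 2] = q @^-1` [set t | t < r / 2] by [].
  by apply: open_comp => [y _|]; [exact: qcont|exact: open_lt].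
have := open_chart_mappre c oq.
move=> oN; have : nbhs x0 (chart_dom c `&` chart_map c @^-1` [set y | q y < r / 2]).
  apply: open_nbhs_nbhs; split=> //; split=> //=.
  by rewrite -/y0 q0 divr_gt0.
apply: filterS => x [cx /= qx]; rewrite /b mem_set //.
rewrite /h [X in _ / (_ + X)]flat_le0 ?addr0 ?divff ?subr_le0 ?ltW //.
by rewrite gt_eqF // flat_gt0 // subr_gt0; lra.
Qed.

End SmoothIn.

(** * Frames, tensoriality and the Riesz isomorphism *)

Section LinearFun.
Variable R : pzRingType.

Section Linear.
Variables (V W : lmodType R) (f : V -> W).
Hypothesis lf : linear f.

Lemma linear_fun0 : f 0 = 0.
Proof. by have := lf (-1) 0 0; rewrite scaler0 addr0 scaleN1r addNr. Qed.

Lemma linear_funD u v : f (u + v) = f u + f v.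
Proof. by have := lf 1 u v; rewrite !scale1r. Qed.

Lemma linear_funZ a u : f (a *: u) = a *: f u.
Proof. by have := lf a u 0; rewrite !addr0 linear_fun0 addr0. Qed.

Lemma linear_funN u : f (- u) = - f u.
Proof. by rewrite -scaleN1r linear_funZ scaleN1r. Qed.

Lemma linear_funB u v : f (u - v) = f u - f v.
Proof. by rewrite linear_funD linear_funN. Qed.

Lemma linear_fun_sum (I : Type) (s : seq I) (P : pred I) (c : I -> R) (v : I -> V) :
  f (\sum_(i <- s | P i) c i *: v i) = \sum_(i <- s | P i) c i *: f (v i).
Proof.
elim: s => [|i s IH]; first by rewrite !big_nil linear_fun0.
by rewrite !big_cons; case: ifP => // _; rewrite lf IH.
Qed.

End Linear.

Lemma scalar_fun_sum (V : lmodType R) (f : V -> R) (I : Type) (s : seq I)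
    (P : pred I) (c : I -> R) (v : I -> V) : scalar f ->
  f (\sum_(i <- s | P i) c i *: v i) = \sum_(i <- s | P i) c i * f (v i).
Proof. by move=> lf; exact: (@linear_fun_sum V R^o f lf). Qed.

Lemma scalar_sum (V : lmodType R) (f : V -> R) (I : Type) (s : seq I)
    (P : pred I) (v : I -> V) : scalar f ->
  f (\sum_(i <- s | P i) v i) = \sum_(i <- s | P i) f (v i).
Proof.
move=> lf; rewrite -[in LHS](eq_bigr _ (fun i _ => scale1r (v i))).
by rewrite scalar_fun_sum //; apply: eq_bigr => i _; rewrite mul1r.
Qed.

End LinearFun.

Section Gram.
Variables (R : fieldType) (V : lmodType R) (B : V -> V -> R) (k : nat).
Variable e : 'I_k -> V.
Hypothesis Bl : forall v, scalar (B^~ v).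
Hypothesis e_free : forall c : 'I_k -> R, \sum_i c i *: e i = 0 -> forall i, c i = 0.
Hypothesis e_nondeg : forall c : 'I_k -> R,
  (forall j, B (\sum_i c i *: e i) (e j) = 0) -> \sum_i c i *: e i = 0.

Definition gram : 'M[R]_k := \matrix_(i, j) B (e i) (e j).

Lemma gram_mul (c : 'rV_k) j : (c *m gram) 0 j = B (\sum_i c 0 i *: e i) (e j).
Proof.
rewrite (scalar_fun_sum _ _ _ _ (Bl (e j))) mxE.
by apply: eq_bigr => i _; rewrite mxE.
Qed.

Lemma gram_unit : gram \in unitmx.
Proof.
rewrite -row_free_unit; apply/row_freeP/row_freeP.
rewrite -kermx_eq0; apply/eqP/row_matrixP => i; rewrite row0.
have : row i (kermx gram) *m gram = 0 by rewrite -row_mul mulmx_ker row0.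
move: (row i _) => c c0; apply/rowP => j; rewrite [RHS]mxE; apply: e_free.
by apply: e_nondeg => l; rewrite -gram_mul c0 mxE.
Qed.

(** Coordinates of the vector in the span of [e] that represents [phi] through [B]. The frame is not
    assumed to span [V], so this serves both the Riesz isomorphism and the orthogonal projection
    onto a nondegenerate subbundle. *)
Definition gram_coord (phi : 'I_k -> R) (i : 'I_k) : R :=
  \sum_j phi j * invmx gram j i.

Lemma gram_coordP phi j : B (\sum_i gram_coord phi i *: e i) (e j) = phi j.
Proof.
have := congr1 (fun A : 'rV_k => A 0 j) (mulmxKV gram_unit (\row_i phi i)).
rewrite /= mxE => <-; rewrite gram_mul; congr B; apply: eq_bigr => i _.
by congr (_ *: _); rewrite mxE; apply: eq_bigr => l _; rewrite mxE.
Qed.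

End Gram.

Section Bundle.
Variables (R : realType) (M : manifold R) (E : vbundle M).
Implicit Types (W V : set M) (f : smoothfun M) (s t : sect E).

Lemma sectDE s t x : (s + t : sect E) x = s x + t x. Proof. by []. Qed.
Lemma sectNE s x : (- s : sect E) x = - s x. Proof. by []. Qed.
Lemma sect0E x : (0 : sect E) x = 0. Proof. by []. Qed.
Lemma fscaleE f s x : fscale f s x = f x *: s x. Proof. by []. Qed.
Lemma endo_appE (A : endo E) s x : endo_app A s x = A x (s x). Proof. by []. Qed.
Lemma pair_sectE (g : pairing E) s t x : pair_sect g s t x = g x (s x) (t x).
Proof. by []. Qed.
Lemma sfDE (f h : smoothfun M) x : (f + h) x = f x + h x. Proof. by []. Qed.
Lemma sfNE (f : smoothfun M) x : (- f) x = - f x. Proof. by []. Qed.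
Lemma sfME (f h : smoothfun M) x : (f * h) x = f x * h x. Proof. by []. Qed.
Lemma sf0E x : (0 : smoothfun M) x = 0. Proof. by []. Qed.
Lemma sf1E x : (1 : smoothfun M) x = 1. Proof. by []. Qed.
Lemma sfZE a (f : smoothfun M) x : (a *: f) x = a * f x. Proof. by []. Qed.

Lemma sect_sumE (I : Type) (r : seq I) (P : pred I) (F : I -> sect E) x :
  (\sum_(i <- r | P i) F i) x = \sum_(i <- r | P i) F i x.
Proof. by elim/big_rec2: _ => [|i u s _ <-]; rewrite ?sect0E ?sectDE. Qed.

Lemma smooth_fun f : smooth_in setT f.
Proof. by apply/asboolP; exact: smoothfunP. Qed.

Lemma smooth_sect s : smooth_field_in setT s.
Proof. by apply/asboolP; exact: sectP. Qed.

Lemma smoothfun_ext (f h : smoothfun M) : (forall x, f x = h x) -> f = h.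
Proof. by move=> fh; apply/val_inj/funext. Qed.

Lemma sect_ext s t : (forall x, s x = t x) -> s = t.
Proof. by move=> st; apply/val_inj/field_ext. Qed.

Lemma smooth_field_inS W V (s : field E) : V `<=` W ->
  smooth_field_in W s -> smooth_field_in V s.
Proof. by move=> VW ss i k; apply: smooth_inS (ss i k) => x [/VW]. Qed.

Lemma smooth_field_local W (s : field E) :
  (forall x, W x -> exists2 V, V x & smooth_field_in V s) -> smooth_field_in W s.
Proof.
move=> H i k; apply: smooth_in_local => x [/H[V Vx sV] ix].
by exists (V `&` vb_dom i).
Qed.

Lemma smooth_field_ext W (s t : field E) : open W ->
  (forall x, W x -> s x = t x) -> smooth_field_in W s -> smooth_field_in W t.
Proof.
move=> oW st ss i k; apply: smooth_in_ext (ss i k).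
  by apply: openI => //; exact: vb_dom_open.
by move=> x [/st->].
Qed.

Lemma smooth_field_sum W (I : Type) (r : seq I) (c : I -> M -> R)
    (s : I -> field E) : open W ->
  (forall i, smooth_in W (c i)) -> (forall i, smooth_field_in W (s i)) ->
  smooth_field_in W (fun x => \sum_(i <- r) c i x *: s i x).
Proof.
move=> oW sc ss i k; have oi : open (W `&` vb_dom i).
  by apply: openI => //; exact: vb_dom_open.
have H : smooth_in (W `&` vb_dom i)
    (fun x => \sum_(j <- r) c j x * vb_triv i (s j x) 0 k).
  apply: smooth_in_sum => // j; apply: smooth_inM => //; last exact: ss.
  by apply: smooth_inS (sc j) => x [].
apply: smooth_in_ext H => // x [_ ix].
rewrite (linear_fun_sum (vb_triv_linear ix)) summxE.
by apply: eq_bigr => j _; rewrite mxE.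
Qed.

Lemma smooth_field_zero_ext W K (s : field E) : closed K -> K `<=` W ->
  (forall x, ~ K x -> s x = 0) -> smooth_field_in W s -> smooth_field_in setT s.
Proof.
move=> cK KW s0 ss; apply: smooth_field_local => x _.
have [Kx|nKx] := pselect (K x); first by exists W => //; exact: KW.
exists (~` K) => //; apply: smooth_field_ext (closed_openC cK) _ _.
  by move=> y /s0 ->; exact: (sect0E y).
by apply: (smooth_field_inS (W := setT)) => //; exact: smooth_sect.
Qed.

Lemma vb_untriv_linear (i : vb_index E) x : vb_dom i x ->
  linear (vb_untriv i x).
Proof.
move=> ix a u v; apply: (can_inj (vb_trivK ix)).
by rewrite (vb_triv_linear ix) !vb_untrivK.
Qed.

(* A frame of [E] near [x0], cut off so that its members [e i] are global
   sections and its coordinate functions [th i] are defined on global sections;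
   the expansion of a section in the frame is then off by a factor [a], which
   is [1] near [x0]. *)
Lemma exists_frame (x0 : M) : exists (e : 'I_(vb_rank E) -> sect E)
    (th : 'I_(vb_rank E) -> sect E -> smoothfun M) (a : smoothfun M),
  [/\ forall i f s t, th i (fscale f s + t) = f * th i s + th i t,
      forall i s t x, s x = t x -> th i s x = th i t x,
      forall s, fscale a s = \sum_i fscale (th i s) (e i),
      \near x0, a x0 = 1 &
      \near x0, (forall c : 'I_(vb_rank E) -> R,
         \sum_i c i *: e i x0 = 0 -> forall i, c i = 0) /\
         forall u : E x0, exists c : 'I_(vb_rank E) -> R, u = \sum_i c i *: e i x0].
Proof.
have [j jx0] := vb_cover E x0.
have [b [K [cK KW bK b1]]] := exists_bump (@vb_dom_open _ _ E j) jx0.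
pose d (i : 'I_(vb_rank E)) : 'rV[R]_(vb_rank E) := delta_mx 0 i.
pose e0 i : field E := fun x => b x *: vb_untriv j x (d i).
have se i : smooth_field_in setT (e0 i).
  apply: smooth_field_zero_ext cK KW _ _ => [x /bK|]; first by rewrite /e0 => ->; rewrite scale0r.
  have oj := @vb_dom_open _ _ E j.
  have := @smooth_field_sum (vb_dom j) _ [:: tt] (fun _ => b) (fun _ x => vb_untriv j x (d i)) oj.
  have bj : smooth_in (vb_dom j) b by apply: smooth_inS (smooth_fun b).
  move=> /(_ (fun _ => bj)) H; apply: smooth_field_ext (H _) => // [x _|_ l k].
    by rewrite big_seq1.
  exact: vb_transition.
pose t0 (i : 'I_(vb_rank E)) (s : sect E) x : R := b x * vb_triv j (s x) 0 i.
have st i s : smooth_in setT (t0 i s).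
  apply: (smooth_in_zero_ext (W := vb_dom j) (K := K)) => //; first exact: openT.
    by move=> x /bK; rewrite /t0 => ->; rewrite mul0r.
  rewrite setTI; apply: smooth_inM; first exact: vb_dom_open.
    by apply: smooth_inS (smooth_fun b).
  by have := @smooth_sect s j i; rewrite setTI.
have bj x : b x != 0 -> vb_dom j x.
  by have [/KW //|/bK ->] := pselect (K x); rewrite eqxx.
exists (fun i => mk_sect (se i)), (fun i s => mk_smoothfun (st i s)), (b * b).
have trivd x : vb_dom j x -> forall c : 'I_(vb_rank E) -> R,
    vb_untriv j x (\row_i c i) = \sum_i c i *: vb_untriv j x (d i).
  move=> jx c; rewrite -(linear_fun_sum (vb_untriv_linear jx)).
  congr (vb_untriv _ _ _); rewrite [LHS]row_sum_delta.
  by apply: eq_bigr => i _; rewrite mxE.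
have eE x (c : 'I_(vb_rank E) -> R) : vb_dom j x ->
    \sum_i c i *: mk_sect (se i) x = b x *: vb_untriv j x (\row_i c i).
  move=> jx; rewrite trivd // scaler_sumr; apply: eq_bigr => i _.
  by rewrite !scalerA mulrC.
split.
- move=> i f s t; apply: smoothfun_ext => x; rewrite sfDE sfME /= /t0.
  have [->|/bj jx] := eqVneq (b x) 0; first by rewrite !mul0r mulr0 addr0.
  rewrite sectDE fscaleE (vb_triv_linear jx) !mxE; ring.
- by move=> i s t x; rewrite /= /t0 => ->.
- move=> s; apply: sect_ext => x; rewrite sect_sumE fscaleE.
  have [b0|/bj jx] := eqVneq (b x) 0.
    rewrite sfME b0 mul0r scale0r big1 // => i _.
    by rewrite fscaleE /= /t0 b0 mul0r scale0r.
  rewrite (eq_bigr (fun i => t0 i s x *: mk_sect (se i) x)) // eE //.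
  rewrite (_ : \row_i _ = b x *: vb_triv j (s x)); last first.
    by apply/rowP => i; rewrite !mxE.
  by rewrite (linear_funZ (vb_untriv_linear jx)) vb_trivK // scalerA.
- by apply: filterS b1 => x bx; rewrite sfME bx mulr1.
- apply: filterS b1 => x bx; have jx : vb_dom j x by apply: bj; rewrite bx oner_eq0.
  split=> [c|u].
    rewrite eE // bx scale1r => /(congr1 (vb_triv j (x := x))).
    rewrite vb_untrivK // (linear_fun0 (vb_triv_linear jx)) => /rowP c0 i.
    by have := c0 i; rewrite !mxE.
  exists (fun i => vb_triv j u 0 i); rewrite eE // bx scale1r.
  rewrite (_ : \row_i _ = vb_triv j u) ?vb_trivK //.
  by apply/rowP => i; rewrite mxE.
Qed.

Lemma exists_sect_at x (u : E x) : exists s : sect E, s x = u.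
Proof.
have [e [th [a [_ _ _ _ /nbhs_singleton[_ /(_ u)[c ->]]]]]] := exists_frame x.
by exists (\sum_i c i *: e i); rewrite sect_sumE.
Qed.

(** An arbitrary choice of global section, with no linearity in [u]; tensoriality removes the
    dependence on the choice. *)
Definition extend x (u : E x) : sect E := xget 0 [set s : sect E | s x = u].

Lemma extendE x (u : E x) : extend u x = u.
Proof. by have [s su] := exists_sect_at u; rewrite /extend; case: xgetP => [|/(_ s)]. Qed.

(** With a frame cut off near [x], the factor [a] is 1 at [x], so [Phi s] equals [Phi (a s)], a
    combination of the [Phi (e i)] whose coefficients depend only on [s x]. *)
Lemma tensorial (Phi : sect E -> R) x :
  (forall f s t, Phi (fscale f s + t) = f x * Phi s + Phi t) ->
  forall s t, s x = t x -> Phi s = Phi t.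
Proof.
move=> PhiL s t st; have [e [th [a [_ thx ex /nbhs_singleton a1 _]]]] := exists_frame x.
have Phi0 : Phi 0 = 0.
  have := PhiL 1 0 0; rewrite (_ : fscale 1 0 + 0 = 0); first by rewrite sf1E; lra.
  by apply: sect_ext => y; rewrite sectDE fscaleE !sect0E scaler0 addr0.
have PhiZ f r : Phi (fscale f r) = f x * Phi r.
  by rewrite -[fscale f r]addr0 PhiL Phi0 addr0.
have PhiS r : Phi r = \sum_i th i r x * Phi (e i).
  transitivity (Phi (fscale a r)); first by rewrite PhiZ a1 mul1r.
  rewrite ex; elim: (index_enum _) => [|i l IH]; first by rewrite !big_nil.
  by rewrite !big_cons PhiL IH.
by rewrite (PhiS s) (PhiS t); apply: eq_bigr => i _; rewrite (thx i s t).
Qed.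

Variable g : pairing E.

Lemma pair_linearr x (u : E x) : scalar (g x u).
Proof. by move=> a v w; rewrite ![g x u _]pair_sym pair_linear. Qed.

Lemma pair_inj x (u v : E x) : (forall w, g x u w = g x v w) -> u = v.
Proof.
move=> uv; apply: subr0_eq; apply: (@pair_nondeg _ _ _ g) => w.
by rewrite addrC -scaleN1r pair_linear uv mulN1r addNr.
Qed.

Definition riesz x (phi : E x -> R) : E x :=
  xget 0 [set u | forall w, g x u w = phi w].

Lemma riesz_eq x (phi : E x -> R) u : (forall w, g x u w = phi w) -> riesz phi = u.
Proof.
move=> u_phi; rewrite /riesz; case: xgetP => [v _ vphi|/(_ u)//].
by apply: pair_inj => w; rewrite vphi u_phi.
Qed.

Lemma riesz_frame x k (e : 'I_k -> E x) (phi : E x -> R) :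
  scalar phi ->
  (forall c : 'I_k -> R, \sum_i c i *: e i = 0 -> forall i, c i = 0) ->
  (forall u, exists c : 'I_k -> R, u = \sum_i c i *: e i) ->
  gram (g x) e \in unitmx /\
  forall w, g x (\sum_i gram_coord (g x) e (phi \o e) i *: e i) w = phi w.
Proof.
move=> lphi efree espan.
have Bl v : scalar ((g x)^~ v) by exact: pair_linear.
have nd (c : 'I_k -> R) : (forall j, g x (\sum_i c i *: e i) (e j) = 0) -> \sum_i c i *: e i = 0.
  move=> c0; apply: (@pair_nondeg _ _ _ g) => v; have [d ->] := espan v.
  rewrite (scalar_fun_sum _ _ _ _ (pair_linearr _)) big1 // => i _.
  by rewrite c0 mulr0.
split=> [|w]; first exact: gram_unit.
have [d ->] := espan w.
rewrite (scalar_fun_sum _ _ _ _ (pair_linearr _)) (scalar_fun_sum _ _ _ _ lphi).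
by apply: eq_bigr => i _; rewrite gram_coordP.
Qed.

Lemma rieszP x (phi : E x -> R) : scalar phi -> forall w, g x (riesz phi) w = phi w.
Proof.
move=> lphi; have [e [_ [_ [_ _ _ _ /nbhs_singleton[efree espan]]]]] := exists_frame x.
have [_ H] := riesz_frame lphi efree espan.
by rewrite (riesz_eq H).
Qed.

(** In a local frame the representing vector is given by the inverse Gram matrix, whose entries are
    smooth by Cramer's rule. *)
Lemma smooth_riesz (phi : forall x, E x -> R) : (forall x, scalar (phi x)) ->
  (forall s, smooth_in setT (fun x => phi x (s x))) ->
  smooth_field_in setT (fun x => riesz (phi x)).
Proof.
move=> lphi sphi; apply: smooth_field_local => x0 _.
have [e [_ [_ [_ _ _ _ near_e]]]] := exists_frame x0.
have : nbhs x0 [set x | (forall c : 'I_(vb_rank E) -> R,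
         \sum_i c i *: e i x = 0 -> forall i, c i = 0) /\
         forall u : E x, exists c : 'I_(vb_rank E) -> R, u = \sum_i c i *: e i x].
  exact: near_e.
rewrite nbhsE => -[W [oW Wx0] We]; exists W => //.
have rf x (Wx : W x) := riesz_frame (lphi x) (We x Wx).1 (We x Wx).2.
have H : smooth_field_in W (fun x => \sum_i
    gram_coord (g x) (fun i => e i x) (fun i => phi x (e i x)) i *: e i x).
  apply: smooth_field_sum => // i; last first.
    exact: smooth_field_inS (smooth_sect (e i)).
  apply: smooth_in_sum => // j; apply: smooth_inM => //.
    exact: smooth_inS (sphi (e j)).
  apply: smooth_in_invmx => // [x Wx|k l]; first by case: (rf x Wx).
  have sg := smooth_inS (subsetT W) (@pair_smooth _ _ _ g (e k) (e l)).
  by apply: smooth_in_ext sg => // x _; rewrite mxE.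
apply: smooth_field_ext H => // x Wx; apply/esym/riesz_eq => w.
by have [_ ->] := rf x Wx.
Qed.

End Bundle.

(** * Existence of generalized connections *)

Arguments sect_fun : simpl never.
Arguments smoothfun_val : simpl never.

Section Connections.
Variables (R : realType) (M : manifold R) (E : courant M).
Local Notation "<| u , v |>" := (ca_pair E _ u v).
Local Notation rho := (ca_anchor E).
Implicit Types (f : smoothfun M) (u v w : sect E).

Lemma anchorD x (e : E x) f h : rho x e (f + h) = rho x e f + rho x e h.
Proof. by have [l _] := anchor_tangent rho e; rewrite (linear_funD (W := R^o) l). Qed.

Lemma anchorM x (e : E x) f h : rho x e (f * h) = f x * rho x e h + h x * rho x e f.
Proof. by have [_ ->] := anchor_tangent rho e. Qed.

Lemma anchorN x (e : E x) f : rho x e (- f) = - rho x e f.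
Proof. by have [l _] := anchor_tangent rho e; rewrite (linear_funN (W := R^o) l). Qed.

Lemma anchorZ x (e : E x) (c : R) f : rho x e (c *: f) = c * rho x e f.
Proof. by have [l _] := anchor_tangent rho e; rewrite (linear_funZ (W := R^o) l). Qed.

Lemma anchor1 x (e : E x) : rho x e 1 = 0.
Proof. by have := anchorM e 1 1; rewrite mulr1 sf1E; lra. Qed.

Lemma pairC x (u v : E x) : <|u, v|> = <|v, u|>. Proof. exact: pair_sym. Qed.
Lemma pairDl x (u v w : E x) : <|u + v, w|> = <|u, w|> + <|v, w|>.
Proof. by rewrite (linear_funD (W := R^o) (pair_linear _ _)). Qed.
Lemma pairNl x (u w : E x) : <|- u, w|> = - <|u, w|>.
Proof. by rewrite (linear_funN (W := R^o) (pair_linear _ _)). Qed.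
Lemma pairZl x a (u w : E x) : <|a *: u, w|> = a * <|u, w|>.
Proof. by rewrite (linear_funZ (W := R^o) (pair_linear _ _)). Qed.
Lemma pairBl x (u v w : E x) : <|u - v, w|> = <|u, w|> - <|v, w|>.
Proof. by rewrite pairDl pairNl. Qed.
Lemma pairDr x (u v w : E x) : <|u, v + w|> = <|u, v|> + <|u, w|>.
Proof. by rewrite ![<|u, _|>]pairC pairDl. Qed.
Lemma pairNr x (u w : E x) : <|u, - w|> = - <|u, w|>.
Proof. by rewrite ![<|u, _|>]pairC pairNl. Qed.
Lemma pairZr x a (u w : E x) : <|u, a *: w|> = a * <|u, w|>.
Proof. by rewrite ![<|u, _|>]pairC pairZl. Qed.
(* [Phi u v w] plays the role of [<D_u v, w>]; the factor [a] in front of the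
   derivative term allows cut-offs. *)
Definition pre_connection (a : smoothfun M)
    (Phi : sect E -> sect E -> sect E -> M -> R) :=
  [/\ forall u v w, smooth_in setT (Phi u v w),
      forall f u u' v w x,
        Phi (fscale f u + u') v w x = f x * Phi u v w x + Phi u' v w x,
      forall f u v w w' x,
        Phi u v (fscale f w + w') x = f x * Phi u v w x + Phi u v w' x &
      forall f u v v' w x, Phi u (fscale f v + v') w x =
        f x * Phi u v w x + a x * rho x (u x) f * <|v x, w x|> + Phi u v' w x].

(** This is the connection for which a local frame is parallel: it differentiates the coordinates
    [th i v]. Since these recombine to [a v] and not to [v], the factor [a] appears in the Leibniz
    rule. *)
Lemma exists_local_connection (x0 : M) :
  exists a Phi, pre_connection a Phi /\ \near x0, a x0 = 1.
Proof.
have [e [th [a [thL thx ex a1 _]]]] := exists_frame E x0.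
exists a, (fun u v w x => \sum_i rho x (u x) (th i v) * <|e i x, w x|>); split=> //.
split=> [u v w|f u u' v w x|f u v w w' x|f u v v' w x].
- apply: smooth_in_sum => [|i]; first exact: openT.
  by apply: smooth_inM; [exact: openT|exact: anchor_smooth|exact: pair_smooth].
- rewrite mulr_sumr -big_split; apply: eq_bigr => i _ /=.
  by rewrite sectDE fscaleE (anchor_linear rho (th i v)) mulrDl mulrA.
- rewrite mulr_sumr -big_split; apply: eq_bigr => i _ /=.
  by rewrite sectDE fscaleE pairDr pairZr; ring.
- transitivity (\sum_i (f x * (rho x (u x) (th i v) * <|e i x, w x|>) +
      rho x (u x) f * (th i v x * <|e i x, w x|>) +
      rho x (u x) (th i v') * <|e i x, w x|>)).
    by apply: eq_bigr => i _; rewrite thL anchorD anchorM; ring.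
  rewrite !big_split /= -!mulr_sumr; congr (_ + _ + _).
  rewrite [a x * _]mulrC -mulrA; congr (_ * _).
  have /(congr1 (fun s : sect E => s x)) := ex v.
  rewrite sect_sumE fscaleE => av; rewrite -pairZl av.
  rewrite (scalar_fun_sum _ _ _ _ (pair_linear _ _)).
  by apply: eq_bigr.
Qed.

(** Second countability provides the enumeration: a basic open set on which some local connection
    has factor 1 contributes one such connection, at the index that codes the set. *)
Lemma exists_connection_cover : exists (a : nat -> smoothfun M)
    (Phi : nat -> sect E -> sect E -> sect E -> M -> R),
  (forall n, pre_connection (a n) (Phi n)) /\
  forall x : M, exists n, \near x, a n x = 1.
Proof.
have [B /countable_injP[code code_inj] [oB basisB]] := @mfd_second_countable _ M.
pose conn (p : smoothfun M * (sect E -> sect E -> sect E -> M -> R)) :=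
  pre_connection p.1 p.2.
pose on_set (U : set M) p := conn p /\ forall x, U x -> p.1 x = 1.
have /choice[F FP] : forall n : nat, exists p, conn p /\
    forall U, B U -> code U = n -> (exists p, on_set U p) -> on_set U p.
  move=> n.
  have [[U [BU Un [p Up]]]|noU] :=
      pselect (exists U, [/\ B U, code U = n & exists p, on_set U p]).
    exists p; split; first by case: Up.
    move=> V BV Vn _; suff -> : V = U by [].
    by apply: code_inj; rewrite ?mem_set // Un.
  exists (0, fun _ _ _ _ => 0); split; last first.
    by move=> U BU Un Up; case: noU; exists U.
  split=> [u v w|f u u' v w x|f u v w w' x|f u v v' w x] /=.
  - exact: smooth_in_cst openT.
  - by rewrite mulr0 addr0.
  - by rewrite mulr0 addr0.
  - by rewrite sf0E mulr0 !mul0r !addr0.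
exists (fun n => (F n).1), (fun n => (F n).2); split=> [n|x].
  by case: (FP n).
have [a [Phi [aPhi a1]]] := exists_local_connection x.
have [U [BU Ux] Ua] := basisB x _ a1.
have [_ /(_ U BU erefl)[|_ F1]] := FP (code U).
  by exists (a, Phi); split.
exists (code U); apply: filterS F1 _.
by apply: open_nbhs_nbhs; split=> //; exact: oB.
Qed.

Lemma exists_pre_connection : exists Phi, pre_connection 1 Phi.
Proof.
have [a [F [aF a1]]] := exists_connection_cover.
(* Some [a n] is 1 near [x], so [wt m] vanishes near [x] for all [m > n]; the successor keeps the
   term of index [n] in the sum up to [N x]. *)
pose N (x : M) := (sval (cid (a1 x))).+1.
have N1 (x : M) : \forall y \near x, a (N x).-1 y = 1 by exact: (svalP (cid (a1 x))).
pose wt n x : R := \prod_(m < n) (1 - a m x).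
have wt0 m n x : (m < n)%N -> a m x = 1 -> wt n x = 0.
  by move=> mn am; rewrite /wt (bigD1 (Ordinal mn)) //= am subrr mul0r.
have wtS n x : wt n.+1 x = wt n x * (1 - a n x) by rewrite /wt big_ord_recr.
have wt_sum n x : \sum_(m < n) wt m x * a m x = 1 - wt n x.
  elim: n => [|n IH]; first by rewrite big_ord0 /wt big_ord0 subrr.
  by rewrite big_ord_recr /= IH wtS; ring.
(* The bound [N y] varies uncontrollably with [y]. Both truncations equal the one at [N y + N x], so
   near [x] the fixed bound [N x] may be used, which gives smoothness. *)
have trunc x y (f : nat -> R) : a (N x).-1 y = 1 ->
    \sum_(m < N y) wt m y * f m = \sum_(m < N x) wt m y * f m.
  have aux n k z : a n.-1 z = 1 -> (0 < n)%N ->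
      \sum_(m < n + k) wt m z * f m = \sum_(m < n) wt m z * f m.
    move=> az n0; elim: k => [|k IH]; first by rewrite addn0.
    rewrite addnS big_ord_recr /= IH (wt0 n.-1) ?mul0r ?addr0 //.
    by rewrite (leq_trans _ (leq_addr k n)) // prednK.
  move=> ay; rewrite -(aux (N y) (N x)) ?(nbhs_singleton (N1 y)) //.
  by rewrite addnC aux.
have smooth_wt n : smooth_in setT (wt n).
  apply: smooth_in_prod => [|m]; first exact: openT.
  apply: smooth_inB; [exact: openT|exact: smooth_in_cst openT|exact: smooth_fun].
exists (fun u v w x => \sum_(n < N x) wt n x * F n u v w x).
split=> [u v w|f u u' v w x|f u v w w' x|f u v v' w x].
- apply: smooth_in_local => x _.
  have : nbhs x [set y | a (N x).-1 y = 1] by exact: N1.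
  rewrite nbhsE => - [W [oW Wx] W1]; exists W => //.
  have H : smooth_in W (fun y => \sum_(n < N x) wt n y * F n u v w y).
    apply: smooth_in_sum => // n; apply: smooth_inM => //.
      exact: smooth_inS (smooth_wt n).
    by have [sF _ _ _] := aF n; exact: smooth_inS (sF u v w).
  apply: smooth_in_ext H => // y Wy.
  by apply/esym/(trunc x y (fun n => F n u v w y)); exact: W1.
- rewrite mulr_sumr -big_split; apply: eq_bigr => n _ /=.
  by have [_ -> _ _] := aF n; ring.
- rewrite mulr_sumr -big_split; apply: eq_bigr => n _ /=.
  by have [_ _ -> _] := aF n; ring.
- rewrite sf1E mul1r.
  have -> : rho x (u x) f * <|v x, w x|> =
      (\sum_(m < N x) wt m x * a m x) * (rho x (u x) f * <|v x, w x|>).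
    by rewrite wt_sum (wt0 (N x).-1) ?subr0 ?mul1r //; exact: nbhs_singleton (N1 x).
  rewrite mulr_sumr mulr_suml -!big_split; apply: eq_bigr => n _ /=.
  by have [_ _ _ ->] := aF n; ring.
Qed.

(** The form is the mean of [F] and of its adjoint connection, which sends [(u, v, w)] to
    [rho(u)<v,w> - F(u, w, v)]. *)
Lemma exists_metric_pre_connection : exists Phi, pre_connection 1 Phi /\
  forall u v w x, Phi u v w x + Phi u w v x =
    rho x (u x) (pair_sect (ca_pair E) v w).
Proof.
have [F [sF Fu Fw Fv]] := exists_pre_connection.
have pC v w : pair_sect (ca_pair E) v w = pair_sect (ca_pair E) w v.
  by apply: smoothfun_ext => x; rewrite !pair_sectE pairC.
have pL f v v' w : pair_sect (ca_pair E) (fscale f v + v') w =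
    f * pair_sect (ca_pair E) v w + pair_sect (ca_pair E) v' w.
  apply: smoothfun_ext => x.
  by rewrite sfDE sfME !pair_sectE sectDE fscaleE pairDl pairZl.
exists (fun u v w x => 2^-1 *
  (rho x (u x) (pair_sect (ca_pair E) v w) + F u v w x - F u w v x)).
split=> [|u v w x]; last by rewrite (pC w v); field.
have oT := @openT M.
split=> [u v w|f u u' v w x|f u v w w' x|f u v v' w x].
- apply: smooth_inM => //; first exact: smooth_in_cst.
  apply: smooth_inB => //; apply: smooth_inD => //.
  exact: anchor_smooth rho u (pair_sect (ca_pair E) v w).
- by rewrite !Fu sectDE fscaleE (anchor_linear rho); ring.
- rewrite Fw Fv sf1E (pC v) pL anchorD anchorM !pair_sectE (pC w) (pairC (w x)) (pC w').
  by ring.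
- rewrite Fw Fv sf1E pL anchorD anchorM !pair_sectE.
  by field.
Qed.

(** The form is tensorial in its first and last arguments, so it descends to the fibres there; the
    Riesz isomorphism then converts the last argument into a value in [E]. *)
Lemma gconn_of_form (F : sect E -> sect E -> sect E -> M -> R) :
  pre_connection 1 F ->
  (forall u v w x, F u v w x + F u w v x =
     rho x (u x) (pair_sect (ca_pair E) v w)) ->
  exists D : gconn E, forall u v w x, <|D v x (u x), w x|> = F u v w x.
Proof.
move=> [sF Fu Fw Fv] Fm.
pose B (v : sect E) x (e w : E x) := F (extend e) v (extend w) x.
have FB u v w x : F u v w x = B v x (u x) (w x).
  rewrite /B (@tensorial _ _ _ (fun u => F u v w x) x _ u (extend (u x))) //.
  - rewrite (@tensorial _ _ _ (fun w => F (extend (u x)) v w x) x _ w (extend (w x))) //.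
    by rewrite extendE.
  - by rewrite extendE.
have Bl v x (w : E x) : scalar (fun e => B v x e w).
  move=> c e e'; rewrite -(extendE e) -(extendE e') -(extendE w).
  rewrite -!FB -[in RHS](_ : mk_smoothfun (smooth_in_cst c (@openT M)) x = c) //.
  rewrite -Fu FB; congr B; by rewrite sectDE fscaleE.
have Br v x (e : E x) : scalar (B v x e).
  move=> c w w'; rewrite -(extendE e) -(extendE w) -(extendE w').
  rewrite -!FB -[in RHS](_ : mk_smoothfun (smooth_in_cst c (@openT M)) x = c) //.
  rewrite -Fw FB; congr B; by rewrite sectDE fscaleE.
pose D v x e := riesz (ca_pair E) (B v x e).
have DE v x e (w : E x) : <|D v x e, w|> = B v x e w by exact: rieszP.
have Dl v x : linear (D v x).
  move=> c e e'; apply: (@pair_inj _ _ _ (ca_pair E)) => w.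
  by rewrite pairDl pairZl !DE Bl.
have sD v (s : sect E) : smooth_field_in setT (fun x => D v x (s x)).
  apply: smooth_riesz => // t.
  by apply: smooth_in_ext (sF s v t) => [|x _]; [exact: openT|exact: FB].
have Dlin (c : R) (u v : sect E) x (e : E x) :
    D (c *: u + v) x e = c *: D u x e + D v x e.
  apply: (@pair_inj _ _ _ (ca_pair E)) => w; rewrite pairDl pairZl !DE /B.
  (* A real scalar is read as a constant function; the anchor kills constants, so the Leibniz rule
     reduces to linearity. *)
  pose cf := mk_smoothfun (smooth_in_cst c (@openT M)).
  have -> : c *: u + v = fscale cf u + v by apply: sect_ext.
  rewrite Fv; have -> : cf = c *: (1 : smoothfun M).
    by apply: smoothfun_ext => y; rewrite sfZE sf1E mulr1.
  by rewrite anchorZ anchor1 mulr0 mulr0 mul0r addr0 sfZE sf1E mulr1.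
have F0 u w x : F u 0 w x = 0.
  have := Fv 1 u 0 0 w x; rewrite (_ : fscale 1 0 + 0 = 0).
    by rewrite anchor1 sf1E; lra.
  by apply: sect_ext => y; rewrite sectDE fscaleE !sect0E scaler0 addr0.
have Dleib f (u : sect E) x (e : E x) :
    D (fscale f u) x e = rho x e f *: u x + f x *: D u x e.
  apply: (@pair_inj _ _ _ (ca_pair E)) => w.
  rewrite pairDl !pairZl !DE /B -[fscale f u]addr0 Fv sf1E mul1r !extendE F0.
  by ring.
have Dmet (u v : sect E) x (e : E x) : rho x e (pair_sect (ca_pair E) u v) =
    <|D u x e, v x|> + <|u x, D v x e|>.
  by rewrite (pairC (u x)) !DE -(extendE e) -!FB Fm extendE.
exists (@GConn _ _ E (fun v => Endo (D v) (Dl v) (sD v)) Dlin Dleib Dmet).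
by move=> u v w x; rewrite /= DE -FB.
Qed.

End Connections.

(** * Torsion and change of connection *)

Section Shift.
Variables (R : realType) (M : manifold R) (E : courant M).
Local Notation "<| u , v |>" := (ca_pair E _ u v).
Local Notation rho := (ca_anchor E).
Implicit Types (D : gconn E) (f : smoothfun M) (u v w : sect E) (S : tensor3 E).

Lemma gconn_ext D D' : (forall v x e, D v x e = D' v x e) -> D = D'.
Proof.
move=> DD'; have Dfun : gconn_fun D = gconn_fun D'.
  apply/funext => v; have Dv : (D v : forall x, _) = D' v.
    by apply: functional_extensionality_dep => x; apply/funext => e; exact: DD'.
  move: Dv; case: (D v) (D' v) => A lA sA [B lB sB] /= AB.
  by subst B; congr Endo; exact: Prop_irrelevance.
move: Dfun {DD'}; case: D D' => D l1 l2 l3 [D' l1' l2' l3'] /= DD'.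
by subst D'; congr GConn; exact: Prop_irrelevance.
Qed.

Lemma gconnD D v v' x (e : E x) : D (v + v') x e = D v x e + D v' x e.
Proof. by have := gconn_linear D 1 v v' e; rewrite !scale1r. Qed.

Lemma gconn_pre_connection D :
  pre_connection 1 (fun u v w x => <|D v x (u x), w x|>).
Proof.
split=> [u v w|f u u' v w x|f u v w w' x|f u v v' w x].
- exact: pair_smooth (endo_app (D v) u) w.
- by rewrite sectDE fscaleE endo_linear pairDl pairZl.
- by rewrite sectDE fscaleE pairDr pairZr.
- by rewrite gconnD gconn_leibniz !pairDl !pairZl sf1E; ring.
Qed.

Lemma gconn_form_metric D u v w x :
  <|D v x (u x), w x|> + <|D w x (u x), v x|> =
  rho x (u x) (pair_sect (ca_pair E) v w).
Proof. by rewrite (gconn_metric D) (pairC (v x)). Qed.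

Definition tri_tensor S := forall x, trilinear (V := E x) (S x).
Definition skew_tensor S := forall x (u v w : E x), S x u v w = - S x u w v.

Lemma exists_shift D S : smooth_tensor3 S -> tri_tensor S -> skew_tensor S ->
  exists D', shifted_by D S D'.
Proof.
move=> sS tS kS.
have [D1 D2 D3 D4] := gconn_pre_connection D.
have [||D' D'E] := @gconn_of_form _ _ E
    (fun u v w x => <|D v x (u x), w x|> + S x (u x) (v x) (w x)).
- split=> [u v w|f u u' v w x|f u v w w' x|f u v v' w x].
  + by apply: smooth_inD; [exact: openT|exact: D1|exact: sS].
  + have [S1 _ _] := tS x.
    by rewrite D2 sectDE fscaleE S1; ring.
  + have [_ _ S3] := tS x.
    by rewrite D3 sectDE fscaleE S3; ring.
  + have [_ S2 _] := tS x.
    by rewrite D4 sectDE fscaleE S2; ring.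
- by move=> u v w x; rewrite (kS x) -(gconn_form_metric D); ring.
exists D' => v x u w.
by have := D'E (extend u) v (extend w) x; rewrite !extendE.
Qed.

Lemma shifted_unique D S D1 D2 : shifted_by D S D1 -> shifted_by D S D2 -> D1 = D2.
Proof.
move=> h1 h2; apply: gconn_ext => v x e.
by apply: (@pair_inj _ _ _ (ca_pair E)) => w; rewrite h1 h2.
Qed.

(** The derivative terms of the two Leibniz rules cancel, which makes the difference tensorial in
    the differentiated section; both connections being metric makes it skew. *)
Lemma shift_difference D D' : exists S, [/\ shifted_by D S D', smooth_tensor3 S,
  tri_tensor S & skew_tensor S].
Proof.
pose S : tensor3 E := fun x (u v w : E x) =>
  <|D' (extend v) x u, w|> - <|D (extend v) x u, w|>.
have SE x (u w : E x) (v : sect E) : S x u (v x) w = <|D' v x u, w|> - <|D v x u, w|>.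
  apply/esym; rewrite /S.
  apply: (@tensorial _ _ _ (fun v => <|D' v x u, w|> - <|D v x u, w|>) x _ v (extend (v x))).
    move=> f s t.
    by rewrite !gconnD !gconn_leibniz !pairDl !pairZl; ring.
  by rewrite extendE.
have SE2 x (u v w : sect E) : S x (u x) (v x) (w x) = <|D' v x (u x), w x|> - <|D v x (u x), w x|>.
  exact: SE.
have [s1 _ _ _] := gconn_pre_connection D.
have [s2 _ _ _] := gconn_pre_connection D'.
have kS : skew_tensor S.
  move=> x u v w; rewrite -(extendE u) -(extendE v) -(extendE w) !SE2.
  have := gconn_form_metric D (extend u) (extend v) (extend w) x.
  by rewrite -(gconn_form_metric D'); lra.
exists S; split=> //.
- by move=> v x u w; rewrite SE; ring.
- move=> u v w; apply: smooth_in_ext (smooth_inB openT (s2 u v w) (s1 u v w)) => [|x _].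
    exact: openT.
  by rewrite SE2.
- move=> x; have tr (u v : E x) : scalar (S x u v).
    by move=> c w w'; rewrite /S !pairDr !pairZr; ring.
  split=> // [v w c u u'|u w c v v'].
    by rewrite /S !endo_linear !pairDl !pairZl; ring.
  by rewrite ![S x u _ w]kS tr; ring.
Qed.

Lemma endo_parallelP D (A : endo E) :
  endo_parallel D A <-> forall v x (e : E x), D (endo_app A v) x e = A x (D v x e).
Proof.
split=> [DA v x e|DA u v].
  have /(congr1 (fun s : sect E => s x)) := DA (extend e) v.
  rewrite sectDE sectNE !endo_appE sect0E extendE => /eqP.
  by rewrite subr_eq0 => /eqP.
apply: sect_ext => x; rewrite sectDE sectNE !endo_appE sect0E DA subrr //.
Qed.

(** The condition on [S] says that each endomorphism [S_u] commutes with [A], written through the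
    adjoint [c A] so that only the form [S] occurs. *)
Lemma parallel_shift D S D' (A : endo E) (c : R) :
  (forall x (u v : E x), <|A x u, v|> = c * <|u, A x v|>) ->
  shifted_by D S D' -> endo_parallel D A ->
  (forall x (u v w : E x), S x u (A x v) w = c * S x u v (A x w)) <->
  endo_parallel D' A.
Proof.
move=> Ac DD' /endo_parallelP DA; split=> [SA|/endo_parallelP D'A x u v w].
  apply/endo_parallelP => v x e; apply: (@pair_inj _ _ _ (ca_pair E)) => w.
  by rewrite Ac !DD' DA Ac endo_appE SA; ring.
have := DD' (endo_app A (extend v)) x u w.
rewrite D'A Ac DD' DA Ac endo_appE extendE; lra.
Qed.

Lemma torsionE D u v w x : torsion D u v w x =
  <|D v x (u x), w x|> - <|D u x (v x), w x|> - <|ca_bracket u v x, w x|>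
  + <|D u x (w x), v x|>.
Proof. by rewrite /torsion sfDE !pair_sectE !sectDE !sectNE !endo_appE !pairDl !pairNl. Qed.

Lemma torsion_shift D S D' u v w x : skew_tensor S -> shifted_by D S D' ->
  torsion D' u v w x = torsion D u v w x + cyclic_sum (S x) (u x) (v x) (w x).
Proof.
move=> kS DD'; rewrite !torsionE !DD' /cyclic_sum (kS x (v x) (u x)); lra.
Qed.

(** The failure of the bracket to be skew is [rho(w)<u,v>]; as [D] is metric, this is the sum of the
    two terms differentiated along [w]. *)
Lemma torsion_skew12 D u v w x : torsion D u v w x = - torsion D v u w x.
Proof.
have := congr1 (fun f : smoothfun M => f x) (ca_symmetric u v w).
rewrite /= [LHS]pair_sectE sectDE pairDl => br.
have : <|ca_bracket u v x, w x|> + <|ca_bracket v u x, w x|> =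
    rho x (w x) (pair_sect (ca_pair E) u v) by exact: br.
by rewrite -(gconn_form_metric D) !torsionE; lra.
Qed.

(** Here the invariance of the scalar product under the bracket is compared with its invariance
    under [D]. *)
Lemma torsion_skew23 D u v w x : torsion D u v w x = - torsion D u w v x.
Proof.
have : <|ca_bracket u v x, w x|> + <|v x, ca_bracket u w x|> =
    rho x (u x) (pair_sect (ca_pair E) v w).
  exact/esym/(congr1 (fun f : smoothfun M => f x) (ca_invariant u v w)).
by rewrite -(gconn_form_metric D) (pairC (v x)) !torsionE; lra.
Qed.

Lemma torsionL3 D f u v w w' x :
  torsion D u v (fscale f w + w') x = f x * torsion D u v w x + torsion D u v w' x.
Proof.
by rewrite !torsionE sectDE fscaleE endo_linear !pairDl !pairDr !pairZl !pairZr; ring.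
Qed.

Definition torsion_tensor D : tensor3 E :=
  fun x (u v w : E x) => torsion D (extend u) (extend v) (extend w) x.

(** Linearity over functions is immediate in the third argument, which is never differentiated;
    skewness carries it to the other two. *)
Lemma torsion_tensorE D u v w x :
  torsion_tensor D (u x) (v x) (w x) = torsion D u v w x.
Proof.
have c3 u1 v1 w1 w2 : w1 x = w2 x -> torsion D u1 v1 w1 x = torsion D u1 v1 w2 x.
  apply: (@tensorial _ _ _ (fun w => torsion D u1 v1 w x)) => f s t.
  exact: torsionL3.
rewrite /torsion_tensor (c3 _ _ _ w) ?extendE //.
rewrite torsion_skew23 (c3 _ _ _ v) ?extendE // -torsion_skew23.
rewrite torsion_skew12 torsion_skew23 (c3 _ _ _ u) ?extendE //.
by rewrite -torsion_skew23 -torsion_skew12.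
Qed.

Lemma torsion_tensor_skew12 D x (u v w : E x) :
  torsion_tensor D u v w = - torsion_tensor D v u w.
Proof. exact: torsion_skew12. Qed.

Lemma torsion_tensor_skew : forall D, skew_tensor (torsion_tensor D).
Proof. by move=> D x u v w; exact: torsion_skew23. Qed.

Lemma torsion_tensor_tri D : tri_tensor (torsion_tensor D).
Proof.
move=> x; have l3 (u v : E x) : scalar (torsion_tensor D u v).
  move=> c w w'; rewrite -(extendE u) -(extendE v) -(extendE w) -(extendE w').
  pose cf := mk_smoothfun (smooth_in_cst c (@openT M)).
  have -> : c *: extend w x + extend w' x = (fscale cf (extend w) + extend w') x by [].
  by rewrite !torsion_tensorE torsionL3.
have l2 (u w : E x) : scalar (fun v : E x => torsion_tensor D u v w).
  by move=> c v v'; rewrite !(torsion_tensor_skew D u _ w) l3; ring.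
split=> // v w c u u'.
by rewrite !(torsion_tensor_skew12 D _ v w) l2; ring.
Qed.

Lemma torsion_tensor_smooth D : smooth_tensor3 (torsion_tensor D).
Proof.
move=> u v w; apply: smooth_in_ext (smooth_fun (torsion D u v w)) => [|x _].
  exact: openT.
by rewrite torsion_tensorE.
Qed.

(* Generalized Kaehler and generalized complex structures are treated at once
   through a set [Q] of endomorphisms [A], each with the sign [c] such that
   [A^* = c A]. *)
Definition adapted (Q : set (R * endo E)) : set (gconn E) :=
  [set D | torsion_free D /\ forall p, Q p -> endo_parallel D p.2].

Definition prolongations (Q : set (R * endo E)) : set (tensor3 E) :=
  [set S | [/\ smooth_tensor3 S, tri_tensor S, skew_tensor S,
     forall x (u v w : E x), cyclic_sum (S x) u v w = 0 &
     forall p, Q p -> forall x (u v w : E x),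
       S x u (p.2 x v) w = p.1 * S x u v (p.2 x w)]].

Lemma affine_adapted (Q : set (R * endo E)) :
  (forall p, Q p -> forall x (u v : E x), <|p.2 x u, v|> = p.1 * <|u, p.2 x v|>) ->
  adapted Q !=set0 -> affine_over (adapted Q) (prolongations Q).
Proof.
move=> QA Q0; split=> //.
- split.
    split=> //.
    + by move=> u v w; exact: smooth_in_cst openT.
    + by move=> x; split=> [v w|u w|u v] c a b; rewrite mulr0 addr0.
    + by move=> x u v w; rewrite oppr0.
    + by move=> x u v w; rewrite /cyclic_sum !addr0.
    + by move=> p _ x u v w; rewrite mulr0.
  move=> c S S' [s1 t1 k1 c1 a1] [s2 t2 k2 c2 a2]; split.
  + move=> u v w; apply: smooth_inD => //; first exact: openT.
      apply: smooth_inM => //; first exact: openT.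
    exact: smooth_in_cst openT.
  + move=> x; have [l1 l2 l3] := t1 x; have [m1 m2 m3] := t2 x.
    by split=> [v w|u w|u v] d a b; rewrite ?l1 ?l2 ?l3 ?m1 ?m2 ?m3; ring.
  + by move=> x u v w; rewrite k1 k2; ring.
  + move=> x u v w; have := c1 x u v w; have := c2 x u v w.
    rewrite /cyclic_sum => e2 e1.
    transitivity (c * (S x u v w + S x v w u + S x w u v) +
      (S' x u v w + S' x v w u + S' x w u v)); first by ring.
    by rewrite e1 e2 mulr0 addr0.
  + by move=> p Qp x u v w; rewrite a1 // a2 //; ring.
- move=> D S [tD pD] [sS tS kS cS aS].
  have [D' DD'] := exists_shift D sS tS kS.
  exists D'; split; last by move=> D'' [_ DD'']; exact: shifted_unique DD' DD''.
  split=> //; split.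
    move=> u v w; apply: smoothfun_ext => x.
    by rewrite (torsion_shift _ _ _ _ kS DD') tD cS addr0.
  move=> p Qp; apply/(parallel_shift (QA p Qp) DD' (pD p Qp)).
  exact: aS.
- move=> D D' [tD pD] [tD' pD'].
  have [S [DD' sS tS kS]] := shift_difference D D'.
  exists S; split; last first.
    move=> S' [_ DD'']; apply: functional_extensionality_dep => x.
    apply/funext => u; apply/funext => v; apply/funext => w.
    have := DD' (extend v) x u w; rewrite DD'' extendE.
    by move/(addrI _).
  split=> //; split=> //.
    move=> x u v w; have := torsion_shift (extend u) (extend v) (extend w) x kS DD'.
    by rewrite tD tD' !extendE !sf0E add0r.
  by move=> p Qp; exact/(parallel_shift (QA p Qp) DD' (pD p Qp))/pD'.
Qed.

End Shift.

(** * Existence of adapted connections *)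

Section Existence.
Variables (R : realType) (M : manifold R) (E : courant M).
Local Notation "<| u , v |>" := (ca_pair E _ u v).
Local Notation rho := (ca_anchor E).
Implicit Types (D : gconn E) (f : smoothfun M) (u v w : sect E) (J : endo E).

Lemma eigenbundle10P J x (u : cplx (E x)) :
  eigenbundle10 J x u <-> J x u.1 = - u.2 /\ J x u.2 = u.1.
Proof.
case: u => u v; rewrite /eigenbundle10 /= /cendo /=.
have -> : (0 +i* 1)%C *: ((u, v) : cplx (E x)) = (- v, u).
  by congr pair; rewrite /= scale0r scale1r ?sub0r ?add0r.
by split=> [[-> ->]|[-> ->]].
Qed.

Section ComplexStructure.
Variable J : endo E.
Hypothesis cJ : gen_complex J.

Lemma gc_skew x (u v : E x) : <|J x u, v|> = -1 * <|u, J x v|>.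
Proof. by have [-> _ _] := cJ; rewrite mulN1r. Qed.

Lemma gc_sqr x (u : E x) : J x (J x u) = - u.
Proof. by have [_ -> _] := cJ. Qed.

Lemma gc_isometry x (u v : E x) : <|J x u, J x v|> = <|u, v|>.
Proof. by rewrite gc_skew gc_sqr pairNr; ring. Qed.

(** Real part of the closure of [L] under the bracket, applied to the sections [u - i J u] and
    [v - i J v]. *)
Lemma gc_integrable u v x :
  J x (ca_bracket u v x - ca_bracket (endo_app J u) (endo_app J v) x) =
  ca_bracket u (endo_app J v) x + ca_bracket (endo_app J u) v x.
Proof.
have [_ _ int] := cJ.
pose c (u : sect E) : cplx (sect E) := (u, - endo_app J u).
have cL u' y : eigenbundle10 J y (ceval (c u') y).
  apply/eigenbundle10P; rewrite /= sectNE endo_appE opprK.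
  by rewrite (linear_funN (endo_linear J (x := y))) gc_sqr opprK.
have /eigenbundle10P[+ _] := int (c u) (c v) (cL u) (cL v) x.
have lr := ca_linearr (c := E); have ll := ca_linearl (c := E).
rewrite /= !(linear_funN (lr _)) !(linear_funN (ll _)) opprK.
by rewrite !sectDE !sectNE opprD !opprK.
Qed.

(** The terms in [D] satisfy the identity by themselves once [J] is parallel, the bracket terms by
    integrability. On a (3,0)-component the right-hand side is [-3 T], on a (2,1)-component it is
    [T], so the identity expresses the vanishing of the (3,0)-part and its conjugate. *)
Lemma torsion_type D u v w x : endo_parallel D J ->
  torsion D u v w x = torsion D (endo_app J u) (endo_app J v) w x +
    torsion D (endo_app J u) v (endo_app J w) x +
    torsion D u (endo_app J v) (endo_app J w) x.
Proof.
move=> /endo_parallelP DJ.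
have : <|J x (ca_bracket u v x - ca_bracket (endo_app J u) (endo_app J v) x), J x (w x)|> =
    <|ca_bracket u v x, w x|> - <|ca_bracket (endo_app J u) (endo_app J v) x, w x|>.
  by rewrite gc_isometry pairBl.
rewrite gc_integrable pairDl !torsionE !DJ !endo_appE !gc_isometry !gc_skew.
lra.
Qed.

End ComplexStructure.

(** Conjugating a connection by an isometry leaves the derivative term [rho(u)(f)<v,w>]
    unchanged. *)
Lemma pre_connection_comp (A : endo E) F :
  (forall x (u v : E x), <|A x u, A x v|> = <|u, v|>) ->
  pre_connection 1 F ->
  pre_connection 1 (fun u v w => F u (endo_app A v) (endo_app A w)).
Proof.
move=> isoA [F1 F2 F3 F4].
have Al f s t : endo_app A (fscale f s + t) = fscale f (endo_app A s) + endo_app A t.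
  by apply: sect_ext => x; rewrite sectDE fscaleE !endo_appE sectDE fscaleE endo_linear.
split=> [u v w|f u u' v w x|f u v w w' x|f u v v' w x]; first exact: F1.
- exact: F2.
- by rewrite Al F3.
- by rewrite Al F4 !endo_appE isoA.
Qed.

Lemma pre_connectionN F u v w x : pre_connection 1 F -> F u (- v) w x = - F u v w x.
Proof.
move=> [_ _ _ F4]; have F0 : F u 0 w x = 0.
  have := F4 1 u 0 0 w x; rewrite (_ : fscale 1 0 + 0 = 0).
    by rewrite anchor1 sf1E; lra.
  by apply: sect_ext => y; rewrite sectDE fscaleE !sect0E scaler0 addr0.
have := F4 (-1) u v 0 w x; rewrite (_ : fscale (-1) v + 0 = - v).
  by rewrite anchorN anchor1 sfNE !sf1E F0; lra.
by apply: sect_ext => y; rewrite sectDE sectNE fscaleE sfNE sf1E sect0E scaleN1r addr0.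
Qed.

Lemma pre_connectionNr F u v w x : pre_connection 1 F -> F u v (- w) x = - F u v w x.
Proof.
move=> [_ _ F3 _]; have F0 : F u v 0 x = 0.
  have := F3 1 u v 0 0 x; rewrite (_ : fscale 1 0 + 0 = 0).
    by rewrite sf1E; lra.
  by apply: sect_ext => y; rewrite sectDE fscaleE !sect0E scaler0 addr0.
have := F3 (-1) u v w 0 x; rewrite (_ : fscale (-1) w + 0 = - w).
  by rewrite sfNE !sf1E F0; lra.
by apply: sect_ext => y; rewrite sectDE sectNE fscaleE sfNE sf1E sect0E scaleN1r addr0.
Qed.

Lemma pre_connection_avg (F1 F2 : sect E -> sect E -> sect E -> M -> R) :
  pre_connection 1 F1 -> pre_connection 1 F2 ->
  pre_connection 1 (fun u v w x => 2^-1 * (F1 u v w x + F2 u v w x)).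
Proof.
move=> [a1 a2 a3 a4] [b1 b2 b3 b4].
have oT := @openT M.
split=> [u v w|f u u' v w x|f u v w w' x|f u v v' w x].
- by apply: smooth_inM => //; [exact: smooth_in_cst|exact: smooth_inD].
- by rewrite a2 b2; ring.
- by rewrite a3 b3; ring.
- by rewrite a4 b4; field.
Qed.

Section Kahler.
Variables G J : endo E.
Hypotheses (G_sqr : forall x (u : E x), G x (G x u) = u)
  (G_sym : forall x (u v : E x), <|G x u, v|> = 1 * <|u, G x v|>)
  (GJ : forall x (u : E x), G x (J x u) = J x (G x u))
  (cJ : gen_complex J) (cGJ : gen_complex (endo_comp G J)).
Let K := endo_comp G J.

Lemma G_isometry x (u v : E x) : <|G x u, G x v|> = <|u, v|>.
Proof. by rewrite G_sym G_sqr mul1r. Qed.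

(* Averaging a metric connection over the group generated by [J] and [G] makes
   both parallel. *)
Lemma exists_parallel_connection :
  exists D, endo_parallel D J /\ endo_parallel D G.
Proof.
have [F [pF Fm]] := @exists_metric_pre_connection _ _ E.
have isoJ := gc_isometry cJ; have isoG := G_isometry.
pose F2 := fun u v w x => 2^-1 * (F u v w x + F u (endo_app J v) (endo_app J w) x).
have pF2 : pre_connection 1 F2.
  exact: pre_connection_avg pF (pre_connection_comp isoJ pF).
have JJ s : endo_app J (endo_app J s) = - s.
  by apply: sect_ext => x; rewrite !endo_appE (gc_sqr cJ) sectNE.
have GG s : endo_app G (endo_app G s) = s.
  by apply: sect_ext => x; rewrite !endo_appE G_sqr.
have GJs s : endo_app G (endo_app J s) = endo_app J (endo_app G s).
  by apply: sect_ext => x; rewrite !endo_appE GJ.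
have pair_iso (A : endo E) v w : (forall x (u v : E x), <|A x u, A x v|> = <|u, v|>) ->
    pair_sect (ca_pair E) (endo_app A v) (endo_app A w) = pair_sect (ca_pair E) v w.
  by move=> iA; apply: smoothfun_ext => x; rewrite !pair_sectE !endo_appE iA.
have F2m u v w x : F2 u v w x + F2 u w v x = rho x (u x) (pair_sect (ca_pair E) v w).
  have := Fm u (endo_app J v) (endo_app J w) x; rewrite pair_iso // -Fm /F2; lra.
have [D DE] := @gconn_of_form _ _ E
  (fun u v w x => 2^-1 * (F2 u v w x + F2 u (endo_app G v) (endo_app G w) x))
  (pre_connection_avg pF2 (pre_connection_comp isoG pF2))
  (fun u v w x => ltac:(have := F2m u (endo_app G v) (endo_app G w) x; rewrite pair_iso // -F2m; lra)).
(* Because [J] squares to -1, invariance of the average under [J] is the same as skewness of [J]. *)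
have F2J u v w x : F2 u (endo_app J v) w x = - F2 u v (endo_app J w) x.
  by rewrite /F2 !JJ (pre_connectionN _ _ _ _ pF) (pre_connectionNr _ _ _ _ pF); ring.
exists D; split; apply/endo_parallelP => v x e;
  apply: (@pair_inj _ _ _ (ca_pair E)) => w; rewrite -(extendE e) -(extendE w) DE.
- by rewrite (gc_skew cJ) -(endo_appE J) DE !GJs !F2J; ring.
- by rewrite G_sym -(endo_appE G) DE !GG; ring.
Qed.

Lemma exists_adapted : exists D, torsion_free D /\ endo_parallel D J /\ endo_parallel D G.
Proof.
have [D [DJ DG]] := exists_parallel_connection.
have Ks s : endo_app K s = endo_app G (endo_app J s) by exact: sect_ext.
have DK : endo_parallel D K.
  move/endo_parallelP : DJ => DJ; move/endo_parallelP : DG => DG.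
  apply/endo_parallelP => v x e;
  by rewrite Ks DG DJ.
(* The torsion is abstracted to a 3-form known only through its values on sections, its symmetries
   and its smoothness. *)
have [T [[TE sT] [T12 T23 tT]]] : exists T : tensor3 E,
    ((forall u v w x, T x (u x) (v x) (w x) = torsion D u v w x) /\ smooth_tensor3 T) /\
    [/\ forall x (u v w : E x), T x u v w = - T x v u w, skew_tensor T & tri_tensor T].
  exists (torsion_tensor D); split; split.
  - exact: torsion_tensorE.
  - exact: torsion_tensor_smooth.
  - exact: torsion_tensor_skew12.
  - exact: torsion_tensor_skew.
  - exact: torsion_tensor_tri.
have TJ x (u v w : E x) : T x u v w = T x (J x u) (J x v) w + T x (J x u) v (J x w) +
    T x u (J x v) (J x w).
  rewrite -(extendE u) -(extendE v) -(extendE w) -!endo_appE !TE.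
  exact: torsion_type.
have TK x (u v w : E x) : T x u v w =
    T x (G x (J x u)) (G x (J x v)) w + T x (G x (J x u)) v (G x (J x w)) +
    T x u (G x (J x v)) (G x (J x w)).
  rewrite -(extendE u) -(extendE v) -(extendE w) -!endo_appE !TE.
  rewrite -!Ks; exact: (torsion_type cGJ).
have Tcyc x (u v w : E x) : T x u v w = T x w u v by rewrite T23 T12 opprK.
(* With [P T] the average of [T u v w], [T u (J v) (J w)], [T u (G v) (G w)] and
   [T u (G J v) (G J w)], the cyclic sum of [P T] is [2 T] on pure components
   and [T] on components mixing [E_+] and [E_-]; so [S] is [- P T] plus half of
   the pure part of [P T]. *)
pose S : tensor3 E := fun x (u v w : E x) => 16^-1 *
  (T x (G x u) (G x v) w + T x (G x u) v (G x w) +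
   T x (G x u) (G x (J x v)) (J x w) + T x (G x u) (J x v) (G x (J x w))
   - 3 * (T x u v w + T x u (J x v) (J x w) + T x u (G x v) (G x w) +
          T x u (G x (J x v)) (G x (J x w)))).
have sS : smooth_tensor3 S.
  move=> u v w; have oT := @openT M.
  apply: smooth_inM => //; first exact: smooth_in_cst.
  apply: smooth_inB => //; last (apply: smooth_inM => //; first exact: smooth_in_cst);
    do ![apply: smooth_inD => //].
  - exact: (sT (endo_app G u) (endo_app G v) w).
  - exact: (sT (endo_app G u) v (endo_app G w)).
  - exact: (sT (endo_app G u) (endo_app G (endo_app J v)) (endo_app J w)).
  - exact: (sT (endo_app G u) (endo_app J v) (endo_app G (endo_app J w))).
  - exact: (sT u (endo_app J v) (endo_app J w)).
  - exact: (sT u (endo_app G v) (endo_app G w)).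
  - exact: (sT u (endo_app G (endo_app J v)) (endo_app G (endo_app J w))).
have tS : tri_tensor S.
  move=> x; have [T1 T2 T3] := tT x.
  by split=> [v w|u w|u v] c a b; rewrite /S !endo_linear ?T1 ?T2 ?T3; ring.
have kS : skew_tensor S.
  move=> x u v w; rewrite /S.
  rewrite (T23 x (G x u) (G x v)) (T23 x (G x u) v) (T23 x (G x u) (G x (J x v))).
  rewrite (T23 x (G x u) (J x v)) (T23 x u v) (T23 x u (J x v)) (T23 x u (G x v)).
  by rewrite (T23 x u (G x (J x v))); ring.
have cS x (u v w : E x) : cyclic_sum (S x) u v w = - T x u v w.
  have h1 := TJ x u v w; have h2 := TK x u v w.
  have h3 := TJ x (G x u) (G x v) w; have h4 := TJ x (G x u) v (G x w).
  have h5 := TJ x u (G x v) (G x w).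
  move: h1 h2 h3 h4 h5; rewrite -!GJ /cyclic_sum /S.
  (* Cyclic invariance brings every term to the order [u, v, w]; what remains is a linear
     combination of the five type identities. *)
  rewrite !(Tcyc x _ _ v) !(Tcyc x _ _ (J x v)) !(Tcyc x _ _ (G x v))
    !(Tcyc x _ _ (G x (J x v))).
  rewrite !(Tcyc x _ _ u) !(Tcyc x _ _ (J x u)) !(Tcyc x _ _ (G x u))
    !(Tcyc x _ _ (G x (J x u))).
  lra.
have [D' DD'] := exists_shift D sS tS kS.
exists D'; split=> [u v w|].
  apply: smoothfun_ext => x; rewrite (torsion_shift _ _ _ _ kS DD') cS.
  by rewrite TE subrr.
have NT2 x (a b c : E x) : T x a (- b) c = - T x a b c.
  by have [_ T2 _] := tT x; exact: (linear_funN (W := R^o) (T2 a c)).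
have NT3 x (a b c : E x) : T x a b (- c) = - T x a b c.
  by have [_ _ T3] := tT x; exact: (linear_funN (W := R^o) (T3 a b)).
split.
  apply/(parallel_shift (gc_skew cJ) DD' DJ) => x u v w; rewrite /S !(gc_sqr cJ).
  by rewrite !(linear_funN (endo_linear G (x := x))) !NT2 !NT3; ring.
apply/(parallel_shift G_sym DD' DG) => x u v w; rewrite /S -!GJ !G_sqr.
ring.
Qed.

End Kahler.
End Existence.

(** * The complex description of the prolongation *)

Section ComplexTensors.
Variables (R : realType) (M : manifold R) (E : courant M).
Local Notation EC x := (cplx (E x)).
Local Notation "''i'" := (0 +i* 1)%C.
Implicit Types (J q : endo E) (S : tensor3 E) (s : ctensor3 E).

(* [s] is of type (2,0) in its first two arguments and (0,1) in the third one,
   and only depends on the [q]-components of its arguments. *)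
Definition typed_tensors J q : set (ctensor3 E) :=
  [set s | [/\ forall x, trilinear (s x),
     forall x u v w, s x u v w = s x v u w,
     smooth_ctensor3 s,
     forall x u v w, s x (cendo J u) v w = 'i * s x u v w /\
                     s x u v (cendo J w) = - 'i * s x u v w &
     forall x u v w, s x (cendo q u) v w = s x u v w /\
                     s x u v (cendo q w) = s x u v w]].

Definition only_on q S := forall x (u v w : E x),
  S x (q x u) v w = S x u v w /\ S x u (q x v) w = S x u v w.

(** The cyclic sum cancels by the symmetry of [s] in its first two arguments. In both terms of
    [sk s] the last two arguments have opposite types, which is why each [S_u] commutes with [J]. *)
Lemma re_sk_typed J q s : typed_tensors J q s ->
  prolongations [set (-1, J)] (re_tensor (sk s)) /\ only_on q (re_tensor (sk s)).
Proof.
move=> [tri_s sym_s sm_s Js qs].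
have crealJ (A : endo E) x (u : E x) : creal (A x u) = cendo A (creal u).
  by rewrite /creal /cendo /= (linear_fun0 (endo_linear A (x := x))).
have crealL x (c : R) (u v : E x) : creal (c *: u + v) = (c%:C)%C *: creal u + creal v.
  congr pair => /=; first by rewrite scale0r subr0.
  by rewrite scaler0 scale0r !addr0.
have ReL (c : R) (z t : R[i]) : complex.Re ((c%:C)%C * z + t) = c * complex.Re z + complex.Re t.
  by case: z t => [a b] [a' b'] /=; rewrite mul0r subr0.
have rs x (u v w : E x) : re_tensor (sk s) u v w =
    complex.Re (s x (creal u) (creal v) (creal w)) -
    complex.Re (s x (creal u) (creal w) (creal v)).
  by rewrite /re_tensor /sk; case: (s _ _ _ _) (s _ _ _ _) => [a b] [a' b'].
split; last first.
  move=> x u v w; rewrite !rs !crealJ.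
  have q1 u' v' w' := (qs x u' v' w').1; have q3 u' v' w' := (qs x u' v' w').2.
  by rewrite !q1 !q3; split=> //; rewrite (sym_s x _ (cendo q _)) q1 (sym_s x (creal v)).
split.
- move=> u v w.
  have [h1 _] := sm_s (u, 0) (v, 0) (w, 0).
  have [h2 _] := sm_s (u, 0) (w, 0) (v, 0).
  apply: smooth_in_ext (smooth_inB openT h1 h2) => [|x _]; first exact: openT.
  by rewrite rs.
- move=> x; have [t1 t2 t3] := tri_s x.
  by split=> [v w|u w|u v] c a b; rewrite !rs crealL ?t1 ?t2 ?t3 !ReL; ring.
- by move=> x u v w; rewrite !rs; ring.
- move=> x u v w; rewrite /cyclic_sum !rs (sym_s x (creal v) (creal u)).
  by rewrite (sym_s x (creal w) (creal u)) (sym_s x (creal w) (creal v)); ring.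
- move=> _ -> x u v w /=; rewrite !rs !crealJ.
  have J1 u' v' w' := (Js x u' v' w').1; have J3 u' v' w' := (Js x u' v' w').2.
  rewrite !J3 (sym_s x (creal u) (cendo J (creal v))) (sym_s x (creal u) (cendo J (creal w))).
  rewrite !J1 (sym_s x (creal v)) (sym_s x (creal w)).
  case: (s _ _ _ _) (s _ _ _ _) => [a b] [a' b'] /=; ring.
Qed.

Definition cext (a : tensor3 E) : ctensor3 E := fun x (u v w : EC x) =>
  ((a x u.1 v.1 w.1 - a x u.1 v.2 w.2 - a x u.2 v.1 w.2 - a x u.2 v.2 w.1)
   +i* (a x u.1 v.1 w.2 + a x u.1 v.2 w.1 + a x u.2 v.1 w.1 - a x u.2 v.2 w.2))%C.

Lemma cext_tri a : tri_tensor a -> forall x, trilinear (@cext a x).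
Proof.
move=> ta x; have [t1 t2 t3] := ta x.
(* These are the two shapes in which a complex multiple [c + i d] of a pair presents its real and
   imaginary parts. *)
have L (f : E x -> R) : scalar f -> forall (c d : R) y z y',
    f (c *: y - d *: z + y') = c * f y - d * f z + f y' /\
    f (c *: y + d *: z + y') = c * f y + d * f z + f y'.
  move=> lf c d y z y'.
  rewrite !(linear_funD (W := R^o) lf) (linear_funN (W := R^o) lf).
  by rewrite !(linear_funZ (W := R^o) lf).
have L1 v w c d y z y' := (L _ (t1 v w) c d y z y').1.
have L1' v w c d y z y' := (L _ (t1 v w) c d y z y').2.
have L2 u w c d y z y' := (L _ (t2 u w) c d y z y').1.
have L2' u w c d y z y' := (L _ (t2 u w) c d y z y').2.
have L3 u v c d y z y' := (L _ (t3 u v) c d y z y').1.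
have L3' u v c d y z y' := (L _ (t3 u v) c d y z y').2.
split=> [[v v'] [w w'] [c d] [y z] [y' z']|[u u'] [w w'] [c d] [y z] [y' z']|
  [u u'] [v v'] [c d] [y z] [y' z']]; rewrite /cext /=;
  rewrite ?L1 ?L1' ?L2 ?L2' ?L3 ?L3';
  by apply/eqP; rewrite eq_complex /=; apply/andP; split; apply/eqP; ring.
Qed.

Lemma cext_smooth a :
  (forall u v w : sect E, smooth_in setT (fun x => a x (u x) (v x) (w x))) ->
  smooth_ctensor3 (cext a).
Proof.
move=> sa u v w; split; rewrite /cext /=.
  by do ![apply: smooth_inB; first exact: openT].
apply: smooth_inB; [exact: openT| |exact: sa].
by do ![apply: smooth_inD; first exact: openT].
Qed.

(** The complexified [S] is the sum of [sk] of its component on [L, L, Lbar] and the complex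
    conjugate of that. Taking the real part halves such a sum, hence the factor two in the choice of
    [s]. *)
Lemma exists_typed J q S : gen_complex J ->
  (forall x (u : E x), q x (J x u) = J x (q x u)) ->
  prolongations [set (-1, J)] S -> only_on q S ->
  exists2 s, typed_tensors J q s & re_tensor (sk s) = S.
Proof.
move=> cJ qJ [sS tS kS cS JS] oS.
have {}JS x (u v w : E x) : S x u (J x v) w = - S x u v (J x w).
  by rewrite (JS _ erefl) /= mulN1r.
have JJ x (u : E x) := gc_sqr cJ u.
have SN x (u v w : E x) : [/\ S x (- u) v w = - S x u v w, S x u (- v) w = - S x u v w &
    S x u v (- w) = - S x u v w].
  have [t1 t2 t3] := tS x.
  by split; [exact: (linear_funN (W := R^o) (t1 v w))|
    exact: (linear_funN (W := R^o) (t2 u w))|exact: (linear_funN (W := R^o) (t3 u v))].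
have SJJ x (u v w : E x) : S x u (J x v) (J x w) = S x u v w.
  by rewrite JS JJ; have [_ _ ->] := SN x u v w; rewrite opprK.
(* Real and imaginary part, on real arguments, of twice the component of the
   complexified [S] in L^* (x) L^* (x) Lbar^*. *)
pose a : tensor3 E := fun x (u v w : E x) => 2^-1 * (S x u v w - S x (J x u) (J x v) w).
pose b : tensor3 E := fun x (u v w : E x) => - 2^-1 * (S x (J x u) v w + S x u (J x v) w).
have ab1 x (u v w : E x) : a x (J x u) v w = - b x u v w /\ b x (J x u) v w = a x u v w.
  by rewrite /a /b !JJ; have [-> _ _] := SN x u (J x v) w; have [-> _ _] := SN x u v w; split; ring.
have ab3 x (u v w : E x) : a x u v (J x w) = b x u v w /\ b x u v (J x w) = - a x u v w.
  have e1 := JS x u v w; have e2 := JS x (J x u) v w.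
  have e3 := SJJ x u v w; have e4 := SJJ x (J x u) v w.
  by rewrite /a /b e3 e4 (_ : S x u v (J x w) = - S x u (J x v) w) ?e1 ?opprK //
    (_ : S x (J x u) v (J x w) = - S x (J x u) (J x v) w) ?e2 ?opprK //; split; ring.
(* Cyclic sums at triples twisted by [J] are combined so that the terms led by [w] cancel, since
   [S_w] commutes with [J]; what is left is the symmetry. *)
have sym_ab x (u v w : E x) : a x u v w = a x v u w /\ b x u v w = b x v u w.
  have c1 := cS x u v w; have c2 := cS x (J x u) (J x v) w.
  have c3 := cS x (J x u) v w; have c4 := cS x u (J x v) w.
  have k1 := kS x v u w; have k2 := kS x (J x v) (J x u) w.
  have k3 := kS x (J x v) u w; have k4 := kS x v (J x u) w.
  have e1 := SJJ x w u v; have e2 := JS x w u v.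
  move: c1 c2 c3 c4; rewrite /cyclic_sum /a /b k1 k2 k3 k4 e1 e2 => c1 c2 c3 c4.
  by split; lra.
have ta : tri_tensor a.
  move=> x; have [t1 t2 t3] := tS x.
  by split=> [v w|u w|u v] c y z; rewrite /a ?endo_linear ?t1 ?t2 ?t3; ring.
have tb : tri_tensor b.
  move=> x; have [t1 t2 t3] := tS x.
  by split=> [v w|u w|u v] c y z; rewrite /b ?endo_linear ?t1 ?t2 ?t3; ring.
have sa (u v w : sect E) : smooth_in setT (fun x => a x (u x) (v x) (w x)).
  apply: smooth_inM; [exact: openT|exact: smooth_in_cst openT|].
  apply: smooth_inB; [exact: openT|exact: sS|exact: sS (endo_app J u) (endo_app J v) w].
have sb (u v w : sect E) : smooth_in setT (fun x => b x (u x) (v x) (w x)).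
  apply: smooth_inM; [exact: openT|exact: smooth_in_cst openT|].
  by apply: smooth_inD; [exact: openT|exact: sS (endo_app J u) v w|exact: sS u (endo_app J v) w].
have qa x (u v w : E x) : a x (q x u) v w = a x u v w /\ b x (q x u) v w = b x u v w.
  have h1 := (oS x u v w).1; have h2 := (oS x (J x u) v w).1.
  have h3 := (oS x u (J x v) w).1; have h4 := (oS x (J x u) (J x v) w).1.
  by rewrite /a /b -!qJ h1 h2 h3 h4.
have qb x (u v w : E x) : a x u v (q x w) = a x u v w /\ b x u v (q x w) = b x u v w.
  have h u' v' w' : S x u' v' (q x w') = S x u' v' w'.
    by rewrite kS (oS x u' w' v').2 -kS.
  by rewrite /a /b !h.
pose s : ctensor3 E := fun x u v w => cext a u v w + 'i * cext b u v w.
exists s.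
split.
- move=> x; have [p1 p2 p3] := cext_tri ta x; have [r1 r2 r3] := cext_tri tb x.
  by split=> [v w|u w|u v] c y z; rewrite /s ?p1 ?p2 ?p3 ?r1 ?r2 ?r3; ring.
- have A x u v w := (sym_ab x u v w).1; have B x u v w := (sym_ab x u v w).2.
  move=> x u v w; rewrite /s /cext.
  rewrite !(A x u.1 v.1) !(A x u.1 v.2) !(A x u.2 v.1) !(A x u.2 v.2).
  rewrite !(B x u.1 v.1) !(B x u.1 v.2) !(B x u.2 v.1) !(B x u.2 v.2).
  by apply/eqP; rewrite eq_complex /=; apply/andP; split; apply/eqP; ring.
- move=> u v w; have [ra ia] := cext_smooth sa u v w; have [rb ib] := cext_smooth sb u v w.
  split.
    by apply: smooth_in_ext (smooth_inB openT ra ib) => [|x _]; [exact: openT|rewrite /s /cext /=; ring].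
  by apply: smooth_in_ext (smooth_inD openT ia rb) => [|x _]; [exact: openT|rewrite /s /cext /=; ring].
- have A1 x u v w := (ab1 x u v w).1; have B1 x u v w := (ab1 x u v w).2.
  have A3 x u v w := (ab3 x u v w).1; have B3 x u v w := (ab3 x u v w).2.
  move=> x u v w; rewrite /s /cext /cendo /= !A1 !B1 !A3 !B3.
  by split; apply/eqP; rewrite eq_complex /=; apply/andP; split; apply/eqP; ring.
- have A1 x u v w := (qa x u v w).1; have B1 x u v w := (qa x u v w).2.
  have A3 x u v w := (qb x u v w).1; have B3 x u v w := (qb x u v w).2.
  by move=> x u v w; rewrite /s /cext /cendo /= !A1 !B1 !A3 !B3.
apply: functional_extensionality_dep => x.
apply/funext => u; apply/funext => v; apply/funext => w.
have [a1 a2 a3] := ta x; have [b1 b2 b3] := tb x.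
have a02 y z : a x y 0 z = 0 := linear_fun0 (W := R^o) (a2 y z).
have a03 y z : a x y z 0 = 0 := linear_fun0 (W := R^o) (a3 y z).
have a01 y z : a x 0 y z = 0 := linear_fun0 (W := R^o) (a1 y z).
have b02 y z : b x y 0 z = 0 := linear_fun0 (W := R^o) (b2 y z).
have b03 y z : b x y z 0 = 0 := linear_fun0 (W := R^o) (b3 y z).
have b01 y z : b x 0 y z = 0 := linear_fun0 (W := R^o) (b1 y z).
rewrite /re_tensor /sk /s /cext /creal /= ?(a01, a02, a03, b01, b02, b03) /a.
have k1 := kS x u w v; have k2 := kS x (J x u) (J x w) v; have j := JS x (J x u) v w.
by rewrite k1 k2 j; field.
Qed.

(** Both sides say that [s] factors through [p a], [p a] and [p b]. For the converse inclusion, an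
    argument from a wrong summand either has the opposite eigenvalue of [J], which forces [s = - s],
    or is killed by [q]. *)
Lemma S2_sections_typed (I : finType) (F : I -> forall x, set (EC x))
    (p : I -> forall x, EC x -> EC x) (a b : I) J q :
  (forall x u, u = \sum_i p i x u) -> (forall i x u, F i x (p i x u)) ->
  (forall x u, p a x (cendo J u) = 'i *: p a x u) ->
  (forall x u, p b x (cendo J u) = - 'i *: p b x u) ->
  (forall x u, p a x (cendo q u) = p a x u) ->
  (forall x u, p b x (cendo q u) = p b x u) ->
  (forall i x u, F i x u -> i <> a -> cendo J u = - 'i *: u \/ cendo q u = 0) ->
  (forall i x u, F i x u -> i <> b -> cendo J u = 'i *: u \/ cendo q u = 0) ->
  S2_sections F a b = typed_tensors J q.
Proof.
move=> psum pF paJ pbJ paq pbq Fa Fb.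
have dbl (z : R[i]) : z = - z -> z = 0.
  by move/eqP; rewrite -addr_eq0 -mulr2n mulrn_eq0 => /eqP.
have iI : ('i : R[i]) * 'i = -1 by apply/eqP; rewrite eq_complex /=; apply/andP; split; apply/eqP; ring.
apply/seteqP; split=> s.
  move=> [tri_s sym_s sm_s van].
  have z1 x i u v w : F i x u -> i <> a -> s x u v w = 0.
    move=> Fu ia; have [_ t2 t3] := tri_s x.
    rewrite (psum x v) (scalar_sum _ _ _ (t2 u w)) big1 // => j _.
    rewrite (psum x w) (scalar_sum _ _ _ (t3 u _)) big1 // => k _.
    by apply: (van x i j k) => // - [].
  have z3 x i u v w : F i x w -> i <> b -> s x u v w = 0.
    move=> Fw ib; have [t1 t2 _] := tri_s x.
    rewrite (psum x v) (scalar_sum _ _ _ (t2 u w)) big1 // => j _.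
    rewrite (psum x u) (scalar_sum _ _ _ (t1 _ w)) big1 // => k _.
    by apply: (van x k j i) => // - [].
  have e1 x u v w : s x u v w = s x (p a x u) v w.
    have [t1 _ _] := tri_s x.
    rewrite [in LHS](psum x u) (scalar_sum _ _ _ (t1 v w)) (bigD1 a) //= big1 ?addr0 //.
    by move=> i /eqP ia; exact: z1 ia.
  have e3 x u v w : s x u v w = s x u v (p b x w).
    have [_ _ t3] := tri_s x.
    rewrite [in LHS](psum x w) (scalar_sum _ _ _ (t3 u v)) (bigD1 b) //= big1 ?addr0 //.
    by move=> i /eqP ib; exact: z3 ib.
  split=> // x u v w; have [t1 _ t3] := tri_s x; split.
  - by rewrite e1 paJ (linear_funZ (W := (R[i])^o) (t1 v w)) -e1.
  - by rewrite e3 pbJ (linear_funZ (W := (R[i])^o) (t3 u v)) -e3.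
  - by rewrite e1 paq -e1.
  - by rewrite e3 pbq -e3.
move=> [tri_s sym_s sm_s Js qs].
have z1 x i u v w : F i x u -> i <> a -> s x u v w = 0.
  move=> Fu ia; have [t1 _ _] := tri_s x.
  have [Ju|qu] := Fa i x u Fu ia; last first.
    by rewrite -(qs x u v w).1 qu (linear_fun0 (W := (R[i])^o) (t1 v w)).
  have := (Js x u v w).1; rewrite Ju (linear_funZ (W := (R[i])^o) (t1 v w)) => h.
  apply: dbl; have /(congr1 (fun z => 'i * z)) := h.
  by rewrite -[_ *: _]/(_ * _) !mulrA mulrN iI opprK !mulN1r mul1r.
have z3 x i u v w : F i x w -> i <> b -> s x u v w = 0.
  move=> Fw ib; have [_ _ t3] := tri_s x.
  have [Jw|qw] := Fb i x w Fw ib; last first.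
    by rewrite -(qs x u v w).2 qw (linear_fun0 (W := (R[i])^o) (t3 u v)).
  have := (Js x u v w).2; rewrite Jw (linear_funZ (W := (R[i])^o) (t3 u v)) => h.
  apply: dbl; have /(congr1 (fun z => - 'i * z)) := h.
  by rewrite -[_ *: _]/(_ * _) !mulrA mulrNN mulNr iI opprK !mulN1r mul1r.
split=> // x i j k u v w Fu Fv Fw nabk.
have [ia|ia] := pselect (i = a); last exact: z1 Fu ia.
have [ja|ja] := pselect (j = a); last by rewrite sym_s; exact: z1 Fv ja.
have [kb|kb] := pselect (k = b); last exact: z3 Fw kb.
by case: nabk.
Qed.

End ComplexTensors.

Lemma scale_half (K : numFieldType) (V : lmodType K) (u : V) : 2^-1 *: (u + u) = u.
Proof. by rewrite -mulr2n -(scaler_nat 2 u) scalerA mulVf ?scale1r ?pnatr_eq0. Qed.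

(** * Stabilizers and their prolongations *)

Section Prolongations.
Variables (R : realType) (M : manifold R) (E : courant M).
Local Notation "<| u , v |>" := (ca_pair E _ u v).
Implicit Types (A G J : endo E).

Lemma endoD A x (u v : E x) : A x (u + v) = A x u + A x v.
Proof. exact: (linear_funD (endo_linear A (x := x))). Qed.
Lemma endoN A x (u : E x) : A x (- u) = - A x u.
Proof. exact: (linear_funN (endo_linear A (x := x))). Qed.
Lemma endoZ A x c (u : E x) : A x (c *: u) = c *: A x u.
Proof. exact: (linear_funZ (endo_linear A (x := x))). Qed.
Lemma endo0 A x : A x 0 = 0.
Proof. exact: (linear_fun0 (endo_linear A (x := x))). Qed.

Lemma endo_ext (A B : endo E) : (forall x u, A x u = B x u) -> A = B.
Proof.
move=> AB; have {}AB : endo_fun A = endo_fun B.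
  by apply: functional_extensionality_dep => x; exact/funext.
move: AB; case: A B => A lA sA [B lB sB] /= AB.
by subst B; congr Endo; exact: Prop_irrelevance.
Qed.

Definition prolong_form J x (S : E x -> E x -> E x -> R) :=
  [/\ trilinear (V := E x) S, forall u v w, S u v w = - S u w v,
      forall u v w, cyclic_sum S u v w = 0 &
      forall u v w, S u (J x v) w = -1 * S u v (J x w)].

Lemma riesz_linear x (S : E x -> E x -> R) :
  (forall w, scalar (fun v => S v w)) -> (forall v, scalar (S v)) ->
  linear (fun v => riesz (ca_pair E) (S v)).
Proof.
move=> l1 l2 c u v; apply: (@pair_inj _ _ _ (ca_pair E)) => w.
by rewrite pairDl pairZl !rieszP // l1.
Qed.

(** The endomorphism [S_u] is recovered from the form by the Riesz isomorphism; skewness in the last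
    two arguments is membership in so(E). *)
Lemma prolong_uP J x S : gen_complex J ->
  prolong (u_bundle J) x S <-> prolong_form J S.
Proof.
move=> cJ; split=> [[tS SA cS]|[tS kS cS JS]]; split=> //.
- move=> u v w; have [A [[_ skA] _] SE] := SA u.
  by rewrite !SE skA (pairC v).
- move=> u v w; have [A [[_ skA] AJ] SE] := SA u.
  by rewrite !SE AJ (gc_skew cJ).
- move=> u; have [_ t2 t3] := tS.
  exists (fun v => riesz (ca_pair E) (S u v)); last by move=> v w; rewrite rieszP.
  split; first split.
  + exact: riesz_linear.
  + by move=> v w; rewrite rieszP // (pairC v) rieszP.
  + move=> v; apply: (@pair_inj _ _ _ (ca_pair E)) => w.
    by rewrite (gc_skew cJ) !rieszP.
Qed.

Lemma prolong_stabP (G : gmetric E) J x S : gen_complex J ->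
  (forall x (u v : E x), <|gm_end G x u, v|> = 1 * <|u, gm_end G x v|>) ->
  prolong (u_stabilizer G J) x S <->
  prolong_form J S /\ forall u v w, S u (gm_end G x v) w = 1 * S u v (gm_end G x w).
Proof.
move=> cJ Gsym; split=> [[tS SA cS]|[/(prolong_uP _ cJ)[tS SA cS] GS]].
  split.
    apply/(prolong_uP _ cJ); split=> // u.
    by have [A [uA _] SE] := SA u; exists A.
  move=> u v w; have [A [[[_ skA] _] AG] SE] := SA u.
  by have := AG v w; rewrite /gm_form (Gsym _ (A v)) !SE (skA (gm_end G x v)); lra.
split=> // u; have [A uA SE] := SA u; exists A => //; split=> // v w.
have := GS u v w; have [[_ skA] _] := uA.
by rewrite /gm_form (Gsym _ (A v)) !SE (skA (gm_end G x v)); lra.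
Qed.

Lemma prolongationsP (Q : set (R * endo E)) (P : forall x, set (E x -> E x -> E x -> R)) :
  (forall x S, P x S <-> [/\ trilinear (V := E x) S, forall u v w, S u v w = - S u w v,
      forall u v w, cyclic_sum S u v w = 0 &
      forall p, Q p -> forall u v w, S u (p.2 x v) w = p.1 * S u v (p.2 x w)]) ->
  tensor_sections P = prolongations Q.
Proof.
move=> PP; apply/seteqP; split=> S.
  move=> [sS PS]; split=> //.
  - by move=> x; have /PP[] := PS x.
  - by move=> x; have /PP[] := PS x.
  - by move=> x; have /PP[] := PS x.
  - by move=> p Qp x; have /PP[_ _ _ h] := PS x; exact: h.
move=> [sS tS kS cS aS]; split=> // x; apply/PP.
by split=> [|u v w|u v w|p Qp u v w]; [exact: tS|exact: kS|exact: cS|exact: aS].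
Qed.

Section Projections.
Variables G J : endo E.
Hypotheses (G_sqr : forall x (u : E x), G x (G x u) = u)
  (G_sym : forall x (u v : E x), <|G x u, v|> = 1 * <|u, G x v|>)
  (GJ : forall x (u : E x), G x (J x u) = J x (G x u))
  (cJ : gen_complex J).
Variable c : R.
Hypothesis cc : c * c = 1.

Lemma projG_linear x : linear (fun u : E x => 2^-1 *: (u + c *: G x u)).
Proof.
move=> a u v; rewrite endo_linear !scalerDr !scalerA addrACA.
by congr (_ + _ + _); rewrite ?scalerA; congr (_ *: _); ring.
Qed.

Lemma projG_smooth (s : sect E) :
  smooth_field_in setT (fun x => 2^-1 *: (s x + c *: G x (s x))).
Proof. exact: (smooth_sect (2^-1 *: (s + c *: endo_app G s))). Qed.

(** For [c = 1] and [c = -1] this is the projection onto [E_+] and [E_-]; the relation [c * c = 1]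
    lets both signs be treated at once. *)
Definition projG : endo E := Endo _ projG_linear projG_smooth.

Lemma projGE x (u : E x) : projG x u = 2^-1 *: (u + c *: G x u). Proof. by []. Qed.

Lemma projG_G x (u : E x) : projG x (G x u) = c *: projG x u.
Proof.
rewrite !projGE G_sqr [RHS]scalerA mulrC -scalerA; congr (_ *: _).
by rewrite scalerDr scalerA cc scale1r addrC.
Qed.

Lemma G_projG x (u : E x) : G x (projG x u) = c *: projG x u.
Proof. by rewrite -projG_G projGE endoZ endoD endoZ. Qed.

Lemma projG_J x (u : E x) : projG x (J x u) = J x (projG x u).
Proof. by rewrite !projGE endoZ endoD endoZ GJ. Qed.

Lemma projG_id x (u : E x) : G x u = c *: u -> projG x u = u.
Proof.
move=> Gu; rewrite projGE Gu.
have -> : c *: (c *: u) = u by rewrite scalerA cc scale1r.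
exact: scale_half.
Qed.

Lemma projG_idem x (u : E x) : projG x (projG x u) = projG x u.
Proof. by rewrite projG_id // G_projG. Qed.

Lemma projG_0 x (u : E x) : G x u = - c *: u -> projG x u = 0.
Proof.
move=> Gu; rewrite projGE Gu.
have -> : c *: (- c *: u) = - u by rewrite scalerA mulrN cc scaleN1r.
by rewrite subrr scaler0.
Qed.

Lemma projG_sym x (u v : E x) : <|projG x u, v|> = <|u, projG x v|>.
Proof. by rewrite !projGE pairZl pairZr pairDl pairDr pairZl pairZr G_sym mul1r. Qed.

Lemma projG_compl x (u : E x) : projG x (u - projG x u) = 0.
Proof. by rewrite endoD endoN projG_idem subrr. Qed.

Definition stab_form x (S : E x -> E x -> E x -> R) :=
  prolong_form J S /\ forall u v w, S u (G x v) w = 1 * S u v (G x w).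

Section StabForm.
Variables (x : M) (S : E x -> E x -> E x -> R).
Hypothesis fS : stab_form S.

Lemma stab_form_proj u v w : S u (projG x v) w = S u v (projG x w).
Proof.
have [[[_ t2 t3] _ _ _] GS] := fS.
rewrite !projGE (linear_funZ (W := R^o) (t2 u w)) (linear_funZ (W := R^o) (t3 u v)).
rewrite (linear_funD (W := R^o) (t2 u w)) (linear_funD (W := R^o) (t3 u v)).
rewrite (linear_funZ (W := R^o) (t2 u w)) (linear_funZ (W := R^o) (t3 u v)).
by rewrite GS mul1r.
Qed.

(* The components of [S] with values in [u(E_+)] and direction in [E_-], or the
   other way round, are killed by the cyclic sum. *)
Lemma stab_form_pure u v w :
  S (projG x u) v w = S (projG x u) (projG x v) (projG x w).
Proof.
have [[[t1 t2 t3] kS cS _] _] := fS.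
have S0 a b : S a b 0 = 0 by exact: (linear_fun0 (W := R^o) (t3 a b)).
have z a b d : S a (projG x b) (d - projG x d) = 0.
  by rewrite stab_form_proj projG_compl S0.
rewrite -stab_form_proj projG_idem -[in LHS](subrKC (projG x v) v).
rewrite (linear_funD (W := R^o) (t2 _ w)) addrC.
suff -> : S (projG x u) (v - projG x v) w = 0 by rewrite add0r.
rewrite -[w in LHS](subrKC (projG x w) w) (linear_funD (W := R^o) (t3 _ _)).
rewrite kS z oppr0 add0r.
have := cS (projG x u) (v - projG x v) (w - projG x w).
by rewrite /cyclic_sum (kS (v - _)) !z oppr0 !addr0.
Qed.

(** Projecting the direction projects all three arguments, so the cyclic sum is that of [S] at the
    projected arguments. *)
Lemma stab_form_proj1 : stab_form (fun u v w => S (projG x u) v w).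
Proof.
have [[[t1 t2 t3] kS cS JS] GS] := fS; split=> //; split=> //.
  by split=> // v w a u u'; rewrite endo_linear t1.
move=> u v w; have := cS (projG x u) (projG x v) (projG x w).
by rewrite /cyclic_sum -!stab_form_pure.
Qed.

End StabForm.

Variable F : forall x, set (E x).
Hypothesis FP : forall x u, @F x u <-> G x u = c *: u.
Hypothesis FN : forall x u, Defs.orthogonal F x u <-> G x u = - c *: u.

Lemma projG_F x (u : E x) : @F x (projG x u).
Proof. by apply/FP; exact: G_projG. Qed.

Lemma projG_FN x (u : E x) : Defs.orthogonal F x (u - projG x u).
Proof.
apply/FN; move: (projG_compl u); move: (u - _) => d /eqP.
rewrite projGE scaler_eq0 invr_eq0 pnatr_eq0 /= addr_eq0 => /eqP dG.
have -> : G x d = c *: (c *: G x d) by rewrite scalerA cc scale1r.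
by rewrite [in RHS]dG scaleNr scalerN opprK.
Qed.

(** Conditions relative to [F] become global ones: vanishing on the orthogonal complement is [A]
    absorbing the projection, and preserving [F] is commuting with [G]. *)
Lemma u_subP x (A : E x -> E x) : u_sub F J x A <->
  [/\ is_so A, forall u, A (J x u) = J x (A u), forall u, A (G x u) = G x (A u) &
      forall u, A (projG x u) = A u].
Proof.
split=> [[lA FA NA skA JA]|[[lA skA] JA GA qA]].
  have Aq u : A (projG x u) = A u.
    have := NA _ (projG_FN u); rewrite (linear_funB lA) => /eqP.
    by rewrite subr_eq0 => /eqP.
  have AF u : @F x (A u) by rewrite -Aq; exact/FA/projG_F.
  have AFq u v : <|A u, v|> = <|A u, projG x v|>.
    have := projG_FN v (AF u); rewrite pairBl => /eqP; rewrite subr_eq0 => /eqP.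
    by rewrite ![<|_, A u|>]pairC.
  split=> //.
  - split=> // u v; rewrite AFq -(Aq u) skA; try exact: projG_F.
    by rewrite pairC -AFq pairC Aq.
  - by move=> u; rewrite -Aq projG_J JA ?Aq //; exact: projG_F.
  - move=> u; rewrite -Aq projG_G (linear_funZ lA) Aq.
    by apply/esym/FP/AF.
split=> //.
- by move=> u /FP Gu; apply/FP; rewrite -GA Gu (linear_funZ lA).
- by move=> u /FN Gu; rewrite -qA projG_0 ?(linear_fun0 lA).
Qed.

(** Since [S] factors through the projection in every argument, a cyclic sum that vanishes on [F]
    vanishes everywhere. *)
Lemma prolong_subP x S : prolong_sub F (u_sub F J) x S <->
  stab_form S /\ forall u v w, S (projG x u) v w = S u v w.
Proof.
split=> [[tS NS SA cS]|[fS qS]].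
  have [t1 t2 t3] := tS.
  have qS u v w : S (projG x u) v w = S u v w.
    have := NS _ (projG_FN u) v w; rewrite (linear_funB (W := R^o) (t1 v w)) => /eqP.
    by rewrite subr_eq0 => /eqP.
  have AS u : exists A : E x -> E x, [/\ is_so A, forall u, A (J x u) = J x (A u),
      forall u, A (G x u) = G x (A u), forall u, A (projG x u) = A u &
      forall v w, S u v w = <|A v, w|>].
    have [A /u_subP[soA JA GA qA] SE] := SA _ (projG_F u).
    by exists A; split=> // v w; rewrite -qS SE.
  have kS u v w : S u v w = - S u w v.
    by have [A [[_ skA] _ _ _ SE]] := AS u; rewrite !SE skA (pairC v).
  have q2 u v w : S u (projG x v) w = S u v w.
    by have [A [_ _ _ qA SE]] := AS u; rewrite !SE qA.
  split=> //; split; first split=> //.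
  - move=> u v w; have := cS _ _ _ (projG_F u) (projG_F v) (projG_F w).
    by rewrite /cyclic_sum !qS !q2 !(kS _ _ (projG x _)) !q2 -!kS.
  - move=> u v w; have [A [_ JA _ _ SE]] := AS u.
    by rewrite !SE JA (gc_skew cJ).
  - by move=> u v w; have [A [_ _ GA _ SE]] := AS u; rewrite !SE GA G_sym.
have [[tS kS cS JS] GS] := fS; have [t1 t2 t3] := tS.
split=> //.
- by move=> u /FN Gu v w; rewrite -qS projG_0 // (linear_fun0 (W := R^o) (t1 v w)).
- move=> u Fu; exists (fun v => riesz (ca_pair E) (S u v)); last by move=> v w; rewrite rieszP.
  apply/u_subP; split.
  + split; first exact: riesz_linear.
    by move=> v w; rewrite rieszP // (pairC v) rieszP.
  + move=> v; apply: (@pair_inj _ _ _ (ca_pair E)) => w.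
    by rewrite (gc_skew cJ) !rieszP.
  + move=> v; apply: (@pair_inj _ _ _ (ca_pair E)) => w.
    by rewrite G_sym !rieszP.
  + move=> v; apply: (@pair_inj _ _ _ (ca_pair E)) => w.
    (* [S_u] ignores the complement of [F]: once [u] is replaced by its projection, [stab_form_pure]
       projects the other two arguments as well. *)
    rewrite !rieszP // -qS -(qS u v) (stab_form_pure fS).
    by rewrite (stab_form_pure fS u v w) projG_idem.
Qed.

End Projections.
End Prolongations.

(** * The orthogonal splitting given by a generalized metric *)

Section GeneralizedMetric.
Variables (R : realType) (M : manifold R) (E : courant M) (G : gmetric E).
Local Notation "<| u , v |>" := (ca_pair E _ u v).
Local Notation Ge := (gm_end G).

(** Nondegeneracy on [E_-] makes the Gram matrix of a local frame invertible, which gives the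
    orthogonal projection onto [E_-]. *)
Lemma gm_split x (u : E x) : exists p, gm_neg G x p /\ gm_pos G x (u - p).
Proof.
have [W [k [e [_ Wx _ span free]]]] := gm_subbundle G x.
have Fx := span x Wx; have fr := free x Wx.
have F_span (c : 'I_k -> R) : gm_neg G x (\sum_i c i *: e i x).
  by rewrite Fx; exists c.
have nd (c : 'I_k -> R) : (forall j, <|\sum_i c i *: e i x, e j x|> = 0) ->
    \sum_i c i *: e i x = 0.
  move=> c0; apply: (@gm_nondeg _ _ _ G x _ (F_span c)) => v; rewrite Fx => -[d _ <-].
  rewrite (scalar_fun_sum _ _ _ _ (pair_linearr (ca_pair E) _)) big1 // => i _.
  by rewrite c0 mulr0.
pose c := gram_coord (ca_pair E x) (fun i => e i x) (fun j => <|u, e j x|>).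
exists (\sum_i c i *: e i x); split; first exact: F_span.
move=> v; rewrite Fx => -[d _ <-].
rewrite (scalar_fun_sum _ _ _ _ (pair_linearr (ca_pair E) _)) big1 // => i _.
rewrite pairBl (gram_coordP (fun v => pair_linear _ v) fr nd).
by rewrite subrr mulr0.
Qed.

Lemma gm_end_split x (p r : E x) : gm_neg G x p -> gm_pos G x r ->
  Ge x (p + r) = - p + r.
Proof. by move=> np pr; rewrite endoD (gm_endN np) (gm_endP pr). Qed.

Lemma gm_ind (P : forall x, E x -> Prop) :
  (forall x p r, gm_neg G x p -> gm_pos G x r -> P x (p + r)) -> forall x u, P x u.
Proof.
move=> H x u; have [p [np pr]] := gm_split u.
by rewrite -[u](subrKC p); exact: H.
Qed.

Lemma gm_sqr x (u : E x) : Ge x (Ge x u) = u.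
Proof.
move: x u; apply: gm_ind => x p r np pr.
by rewrite (gm_end_split np pr) endoD endoN (gm_endN np) (gm_endP pr) opprK.
Qed.

Lemma gm_sym x (u v : E x) : <|Ge x u, v|> = 1 * <|u, Ge x v|>.
Proof.
move: x u v; apply: (gm_ind (P := fun x u => forall v, <|Ge x u, v|> = 1 * <|u, Ge x v|>)).
move=> x p r np pr v; have [p' [np' pr']] := gm_split v.
have [r' vE] : exists r', v - p' = r' by exists (v - p').
have -> : v = p' + r' by rewrite -vE subrKC.
rewrite vE in pr'.
rewrite (gm_end_split np pr) (gm_end_split np' pr').
rewrite !pairDl !pairDr !pairNl !pairNr.
by rewrite (pr _ np') (pairC p r') (pr' _ np); ring.
Qed.

Lemma gm_posP x (u : E x) : gm_pos G x u <-> Ge x u = 1 *: u.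
Proof.
rewrite scale1r; split=> [|Gu v nv]; first exact: gm_endP.
have := gm_sym u v; rewrite Gu (gm_endN nv) pairNr; lra.
Qed.

Lemma gm_negP x (u : E x) : gm_neg G x u <-> Ge x u = -1 *: u.
Proof.
rewrite scaleN1r; split=> [|Gu]; first exact: gm_endN.
have [p [np pr]] := gm_split u; suff -> : u = p by [].
(* The difference lies in [E_+], so [G] fixes it, but [G] also negates both [u] and [p]. *)
have ep : u - p = - (u - p).
  by rewrite -{1}(gm_endP pr) endoD endoN Gu (gm_endN np) opprB opprK addrC.
apply: subr0_eq; rewrite -(scale_half (u - p)) {1}ep.
by rewrite addNr scaler0.
Qed.

Lemma gm_orth_posP x (u : E x) : Defs.orthogonal (gm_pos G) x u <-> Ge x u = - 1 *: u.
Proof.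
split=> [ou|Gu v /gm_posP]; last first.
  rewrite scale1r => Gv; have := gm_sym u v; rewrite Gu Gv pairZl; lra.
rewrite scaleN1r; apply/eqP; rewrite -addr_eq0 addrC; apply/eqP.
apply: (@pair_inj _ _ _ (ca_pair E)) => v.
(* Pairing [u] with [v + G v] is pairing [u + G u] with [v], for arbitrary [v]. *)
have pv : gm_pos G x (v + Ge x v).
  by apply/gm_posP; rewrite endoD gm_sqr scale1r addrC.
have := ou _ pv; rewrite pairDr pairDl gm_sym mul1r => ->.
by rewrite (linear_fun0 (W := R^o) (pair_linear _ v)).
Qed.

Lemma gm_orth_negP x (u : E x) : Defs.orthogonal (gm_neg G) x u <-> Ge x u = - -1 *: u.
Proof. by rewrite opprK; exact: gm_posP. Qed.

End GeneralizedMetric.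

(** * Projections onto [L] and [Lbar] *)

Section Eigenprojections.
Variables (R : realType) (M : manifold R) (E : courant M).
Local Notation EC x := (cplx (E x)).
Local Notation "''i'" := (0 +i* 1)%C.
Variable J : endo E.
Hypothesis cJ : gen_complex J.

(** These are [(1 - i J) / 2] and [(1 + i J) / 2], written on real and imaginary parts. *)
Definition eigenproj (t : bool) x (u : EC x) : EC x :=
  if t then (2^-1 *: (u.1 + J x u.2), 2^-1 *: (u.2 - J x u.1))
  else (2^-1 *: (u.1 - J x u.2), 2^-1 *: (u.2 + J x u.1)).

Lemma iscaleE x (u : EC x) : 'i *: u = (- u.2, u.1).
Proof. by congr pair; rewrite /= scale0r scale1r ?sub0r ?add0r. Qed.

Lemma Niscale x (u : EC x) : - 'i *: u = (u.2, - u.1).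
Proof. by rewrite scaleNr iscaleE -[LHS]/(- - u.2, - u.1) opprK. Qed.

Lemma eigenproj_sum x (u : EC x) : eigenproj true u + eigenproj false u = u.
Proof.
case: u => u v; rewrite -[LHS]/(_ + _, _ + _) /= -!scalerDr.
by rewrite ![_ + J x _ + _]addrACA ![_ - J x _ + _]addrACA subrr addNr !addr0 !scale_half.
Qed.

Lemma split_complexP t x (u : EC x) : split_gen_complex J t x u <->
  cendo J u = (if t then 'i else - 'i) *: u.
Proof.
case: t => //=; rewrite /eigenbundle01 /=.
split=> [/eigenbundle10P[/= h1 h2]|].
  rewrite Niscale /cendo h1 opprK; congr pair.
  by move: h2; rewrite endoN => <-; rewrite opprK.
by rewrite Niscale => -[h1 h2]; apply/eigenbundle10P; rewrite /= endoN h1 h2 !opprK.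
Qed.

Lemma eigenproj_J t x (u : EC x) :
  eigenproj t (cendo J u) = (if t then 'i else - 'i) *: eigenproj t u.
Proof.
case: t; rewrite ?iscaleE ?Niscale /eigenproj /cendo /= !(gc_sqr cJ) -!scalerN.
  by congr pair; congr (_ *: _); rewrite ?opprB ?opprK // addrC.
by congr pair; congr (_ *: _); rewrite ?opprB ?opprK // addrC.
Qed.

Lemma J_eigenproj t x (u : EC x) : cendo J (eigenproj t u) = eigenproj t (cendo J u).
Proof. by case: t; rewrite /eigenproj /cendo /= !endoZ !endoD ?endoN. Qed.

Lemma eigenproj_split t x (u : EC x) : split_gen_complex J t x (eigenproj t u).
Proof. by apply/split_complexP; rewrite J_eigenproj eigenproj_J. Qed.

End Eigenprojections.

(** * Pointwise direct sums for a generalized Kaehler structure *)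

Section KahlerPointwise.
Variables (R : realType) (M : manifold R) (E : courant M).
Variables (G : gmetric E) (J : endo E).
Hypothesis kGJ : gen_kahler G J.
Local Notation "<| u , v |>" := (ca_pair E _ u v).
Local Notation Ge := (gm_end G).
Local Notation sgn e := (if e then 1 else -1 : R).

Lemma kahler_J : gen_complex J. Proof. by case: kGJ. Qed.
Lemma kahler_comm x (u : E x) : Ge x (J x u) = J x (Ge x u).
Proof. by case: kGJ => _ ->. Qed.

Lemma sgn_sqr (e : bool) : sgn e * sgn e = 1.
Proof. by case: e; ring. Qed.

Local Notation gsqr := (@gm_sqr _ _ _ G).
Local Notation gsym := (@gm_sym _ _ _ G).

Lemma projG_sum x (u : E x) : projG Ge 1 x u + projG Ge (-1) x u = u.
Proof. by rewrite !projGE scale1r scaleN1r -scalerDr addrACA subrr addr0 scale_half. Qed.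

Lemma projG_projN x (u : E x) e :
  projG Ge (sgn e) x (projG Ge (- sgn e) x u) = 0.
Proof.
apply: projG_0; first exact: sgn_sqr.
by rewrite G_projG //; [exact: gsqr|rewrite mulrNN sgn_sqr].
Qed.

Lemma u_stabilizerP x (A : E x -> E x) : u_stabilizer G J x A <->
  [/\ is_so A, forall u, A (J x u) = J x (A u) & forall u, A (Ge x u) = Ge x (A u)].
Proof.
split=> [[[soA JA] GA]|[soA JA GA]].
  split=> // u; apply: (@pair_inj _ _ _ (ca_pair E)) => w.
  have := GA u w; rewrite /gm_form; have [_ skA] := soA.
  by rewrite (skA (Ge x u)); lra.
split=> // v w; rewrite /gm_form -GA; have [_ ->] := soA.
by rewrite addNr.
Qed.

Lemma u_sub_posP x (A : E x -> E x) : u_sub (gm_pos G) J x A <->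
  u_stabilizer G J x A /\ forall u, A (projG Ge 1 x u) = A u.
Proof.
have H := @u_subP _ _ _ Ge J gsqr kahler_comm 1 (mulr1 1) _
  (@gm_posP _ _ _ G) (@gm_orth_posP _ _ _ G) x A.
by split=> [/H[a b c d]|[/u_stabilizerP[a b c] d]];
  [split=> //; apply/u_stabilizerP|apply/H].
Qed.

Lemma u_sub_negP x (A : E x -> E x) : u_sub (gm_neg G) J x A <->
  u_stabilizer G J x A /\ forall u, A (projG Ge (-1) x u) = A u.
Proof.
have H := @u_subP _ _ _ Ge J gsqr kahler_comm (-1) (sgn_sqr false) _
  (@gm_negP _ _ _ G) (@gm_orth_negP _ _ _ G) x A.
by split=> [/H[a b c d]|[/u_stabilizerP[a b c] d]];
  [split=> //; apply/u_stabilizerP|apply/H].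
Qed.

(** The projection is symmetric and commutes with [A], so composing with it preserves skewness. *)
Lemma u_stabilizer_proj x (A : E x -> E x) e : u_stabilizer G J x A ->
  u_stabilizer G J x (A \o projG Ge (sgn e) x).
Proof.
move=> /u_stabilizerP[[lA skA] JA GA]; apply/u_stabilizerP.
have qA u : A (projG Ge (sgn e) x u) = projG Ge (sgn e) x (A u).
  by rewrite !projGE (linear_funZ lA) (linear_funD lA) (linear_funZ lA) GA.
have qsym u v := projG_sym gsym (sgn e) u v.
have qJ u := projG_J kahler_comm (sgn e) u.
have qG u : projG Ge (sgn e) x (Ge x u) = Ge x (projG Ge (sgn e) x u).
  by rewrite (projG_G gsqr (sgn_sqr e)) (G_projG gsqr (sgn_sqr e)).
move: (projG Ge (sgn e)) qA qsym qJ qG => q qA qsym qJ qG; split.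
- split=> [c u v|u v] /=; first by rewrite endo_linear lA.
  by rewrite skA qA qsym.
- by move=> u /=; rewrite -JA qJ.
- by move=> u /=; rewrite -GA qG.
Qed.

(** The two projections add up to the identity, which splits [A]; an [A] in both summands absorbs
    both projections, whose product is zero. *)
Lemma direct_sum_u x :
  direct_sum (u_sub (gm_pos G) J x) (u_sub (gm_neg G) J x) (u_stabilizer G J x).
Proof.
split.
  apply/seteqP; split=> A.
    move=> sA; exists (A \o projG Ge 1 x).
      apply/u_sub_posP; split; first exact: (u_stabilizer_proj true sA).
      by move=> u; congr A; exact: (projG_idem gsqr (mulr1 1)).
    exists (A \o projG Ge (-1) x).
      apply/u_sub_negP; split; first exact: (u_stabilizer_proj false sA).
      by move=> u; congr A; exact: (projG_idem gsqr (sgn_sqr false)).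
    apply/funext => u; have /u_stabilizerP[[lA _] _ _] := sA.
    by rewrite -[LHS]/(A _ + A _) -(linear_funD lA) projG_sum.
  move=> [B /u_sub_posP[/u_stabilizerP[[lB sB] JB GB] _]].
  move=> [C /u_sub_negP[/u_stabilizerP[[lC sC] JC GC] _]] <-.
  have addE u : (B + C) u = B u + C u by [].
  apply/u_stabilizerP; split; first split.
  - by move=> c u v; rewrite !addE lB lC scalerDr addrACA.
  - by move=> u v; rewrite !addE pairDl pairDr sB sC opprD.
  - by move=> u; rewrite !addE JB JC endoD.
  - by move=> u; rewrite !addE GB GC endoD.
apply/seteqP; split=> A.
  move=> [/u_sub_posP[/u_stabilizerP[[lA _] _ _] pA] /u_sub_negP[_ nA]].
  apply/funext => u; rewrite -nA -pA (projG_projN u true).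
  exact: linear_fun0 lA.
move=> ->; have s0 : u_stabilizer G J x 0.
  apply/u_stabilizerP; split; first split.
  - by move=> c u v; rewrite scaler0 addr0.
  - by move=> u v; rewrite pairC ?(linear_fun0 (W := R^o) (pair_linearr (ca_pair E) _)) ?oppr0.
  - by move=> u; rewrite endo0.
  - by move=> u; rewrite endo0.
by split; [apply/u_sub_posP|apply/u_sub_negP].
Qed.

Lemma prolong_stab_form x S : prolong (u_stabilizer G J) x S <-> stab_form Ge J S.
Proof. by apply: prolong_stabP; [exact: kahler_J|exact: gsym]. Qed.

Lemma prolong_sub_posP x S : prolong_sub (gm_pos G) (u_sub (gm_pos G) J) x S <->
  stab_form Ge J S /\ forall u v w, S (projG Ge 1 x u) v w = S u v w.
Proof.
exact: (prolong_subP gsqr gsym kahler_comm kahler_J (mulr1 1)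
  (@gm_posP _ _ _ G) (@gm_orth_posP _ _ _ G)).
Qed.

Lemma prolong_sub_negP x S : prolong_sub (gm_neg G) (u_sub (gm_neg G) J) x S <->
  stab_form Ge J S /\ forall u v w, S (projG Ge (-1) x u) v w = S u v w.
Proof.
exact: (prolong_subP gsqr gsym kahler_comm kahler_J (sgn_sqr false)
  (@gm_negP _ _ _ G) (@gm_orth_negP _ _ _ G)).
Qed.

Lemma stab_form0 x : stab_form Ge J (fun u v w : E x => 0).
Proof.
split=> [|u v w]; last by rewrite mulr0.
split=> [|u v w|u v w|u v w]; rewrite ?oppr0 ?mulr0 /cyclic_sum ?addr0 //.
by split=> [v w|u w|u v] c a b; rewrite mulr0 addr0.
Qed.

Lemma stab_formD x (S S' : E x -> E x -> E x -> R) :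
  stab_form Ge J S -> stab_form Ge J S' ->
  stab_form Ge J (fun u v w => S u v w + S' u v w).
Proof.
move=> [[[t1 t2 t3] kS cS JS] GS] [[[s1 s2 s3] kS' cS' JS'] GS'].
split=> [|u v w]; last by rewrite GS GS'; ring.
split=> [|u v w|u v w|u v w].
- by split=> [v w|u w|u v] c a b; rewrite ?t1 ?t2 ?t3 ?s1 ?s2 ?s3; ring.
- by rewrite kS kS'; ring.
- have := cS u v w; have := cS' u v w; rewrite /cyclic_sum => h1 h2.
  by rewrite -[RHS](addr0 0) -{1}h1 -h2; ring.
- by rewrite JS JS'; ring.
Qed.

Lemma stab_form_projS x (S : E x -> E x -> E x -> R) e : stab_form Ge J S ->
  stab_form Ge J (fun u v w => S (projG Ge (sgn e) x u) v w).
Proof. exact: (stab_form_proj1 gsqr (sgn_sqr e)). Qed.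

Lemma stab_form_projD x (S : E x -> E x -> E x -> R) u v w : stab_form Ge J S ->
  S (projG Ge 1 x u) v w + S (projG Ge (-1) x u) v w = S u v w.
Proof.
move=> [[[t1 _ _] _ _ _] _]; rewrite -[in RHS](projG_sum u).
by rewrite (linear_funD (W := R^o) (t1 v w)).
Qed.

(** The same argument as for endomorphisms, with the projections applied to the first argument of
    [S] only; [stab_form_pure] takes care of the others. *)
Lemma direct_sum_prolong x :
  direct_sum (prolong_sub (gm_pos G) (u_sub (gm_pos G) J) x)
             (prolong_sub (gm_neg G) (u_sub (gm_neg G) J) x)
             (prolong (u_stabilizer G J) x).
Proof.
split.
  apply/seteqP; split=> S.
    move=> /prolong_stab_form fS; exists (fun u v w => S (projG Ge 1 x u) v w).
      apply/prolong_sub_posP; split; first exact: (stab_form_projS true fS).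
      by move=> u v w; rewrite projG_idem //; [exact: gsqr|exact: mulr1].
    exists (fun u v w => S (projG Ge (-1) x u) v w).
      apply/prolong_sub_negP; split; first exact: (stab_form_projS false fS).
      by move=> u v w; rewrite projG_idem //; [exact: gsqr|exact: (sgn_sqr false)].
    apply/funext => u; apply/funext => v; apply/funext => w.
    exact: stab_form_projD.
  move=> [B /prolong_sub_posP[fB _]] [C /prolong_sub_negP[fC _]] <-.
  by apply/prolong_stab_form; exact: stab_formD fB fC.
apply/seteqP; split=> S.
  move=> [/prolong_sub_posP[[[[t1 _ _] _ _ _] _] pS] /prolong_sub_negP[_ nS]].
  apply/funext => u; apply/funext => v; apply/funext => w.
  rewrite -nS -pS (projG_projN u true).
  exact: (linear_fun0 (W := R^o) (t1 v w)).
by move=> ->; split; [apply/prolong_sub_posP|apply/prolong_sub_negP]; split=> //;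
  exact: stab_form0.
Qed.

End KahlerPointwise.

(** * Identification of the spaces in both parts of the theorem *)

Section MainProof.
Variables (R : realType) (M : manifold R) (E : courant M).
Local Notation "<| u , v |>" := (ca_pair E _ u v).
Local Notation EC x := (cplx (E x)).
Local Notation "''i'" := (0 +i* 1)%C.
Local Notation sgn e := (if e then 1 else -1 : R).

Lemma id_endo_linear x : linear (fun u : E x => u). Proof. by []. Qed.
Lemma id_endo_smooth (s : sect E) : smooth_field_in setT (fun x => s x).
Proof. exact: smooth_sect. Qed.
(** As the [q] of [typed_tensors] it imposes no condition beyond the type with respect to [J]. *)
Definition id_endo : endo E := Endo _ id_endo_linear id_endo_smooth.

Section GenComplex.
Variable J : endo E.
Hypothesis cJ : gen_complex J.

Lemma adapted_gen_complexE : adapted_gen_complex J = adapted [set (-1, J)].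
Proof.
apply/seteqP; split=> D [tD pD]; split=> //; first by move=> _ ->.
exact: (pD (-1, J)).
Qed.

Lemma tensor_sections_u :
  tensor_sections (prolong (u_bundle J)) = prolongations [set (-1, J)].
Proof.
apply: prolongationsP => x S; split.
  by move/(prolong_uP _ cJ) => [tS kS cS JS]; split=> // _ ->.
by move=> [tS kS cS JS]; apply/(prolong_uP _ cJ); split=> //; exact: (JS (-1, J)).
Qed.

Lemma S2_gen_complex :
  S2_sections (split_gen_complex J) true false = typed_tensors J id_endo.
Proof.
apply: (@S2_sections_typed _ _ _ _ _ (fun t x => @eigenproj _ _ _ J t x)).
- by move=> x u; rewrite big_bool; exact: (esym (eigenproj_sum J u)).
- by move=> t x u; exact: eigenproj_split.
- by move=> x u; exact: (eigenproj_J cJ true).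
- by move=> x u; exact: (eigenproj_J cJ false).
- by move=> x [u v].
- by move=> x [u v].
- by move=> [] x u Fu //; left; exact: ((split_complexP J false u).1 Fu).
- by move=> [] x u Fu //; left; exact: ((split_complexP J true u).1 Fu).
Qed.

Lemma re_sk_gen_complex :
  [set re_tensor (sk eta) | eta in S2_sections (split_gen_complex J) true false] =
  prolongations [set (-1, J)].
Proof.
rewrite S2_gen_complex; apply/seteqP; split=> S.
  by move=> [s ts <-]; case: (re_sk_typed ts).
move=> pS; have [//|//|s ts <-] := @exists_typed _ _ _ J id_endo S cJ _ pS.
by exists s.
Qed.

Lemma exists_adapted_gen_complex : adapted [set (-1, J)] !=set0.
Proof.
have idJ : endo_comp id_endo J = J by exact: endo_ext.
have cidJ : gen_complex (endo_comp id_endo J) by rewrite idJ.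
have sym_id x (u v : E x) : <|id_endo x u, v|> = 1 * <|u, id_endo x v|> by rewrite mul1r.
have [D [tD [DJ _]]] :=
  @exists_adapted _ _ E id_endo J (fun x u => erefl) sym_id (fun x u => erefl) cJ cidJ.
by exists D; split=> // _ ->.
Qed.

End GenComplex.

Section GenKahler.
Variables (G : gmetric E) (J : endo E).
Hypothesis kGJ : gen_kahler G J.
Local Notation Ge := (gm_end G).
Local Notation cJ := (kahler_J kGJ).
Local Notation gsqr := (@gm_sqr _ _ _ G).
Local Notation gsym := (@gm_sym _ _ _ G).
Local Notation gcomm := (kahler_comm kGJ).

(** A generalized connection preserves the scalar product, so differentiating [<G v, w>] leaves only
    the derivative of [G]. *)
Lemma form_parallelP D : form_parallel D (gm_form_sect G) <-> endo_parallel D Ge.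
Proof.
split=> [fp|/endo_parallelP DG u v w].
  apply/endo_parallelP => v x e; apply: (@pair_inj _ _ _ (ca_pair E)) => w.
  have /(congr1 (fun f : smoothfun M => f x)) := fp (extend e) v (extend w).
  rewrite /gm_form_sect !sfDE !sfNE !pair_sectE !endo_appE -[anchor_der _ _ _ x]/(ca_anchor E x _ _).
  rewrite (gconn_metric D) !endo_appE !extendE sf0E; lra.
apply: smoothfun_ext => x.
rewrite /gm_form_sect !sfDE !sfNE !pair_sectE !endo_appE -[anchor_der _ _ _ x]/(ca_anchor E x _ _).
by rewrite (gconn_metric D) !endo_appE DG sf0E; ring.
Qed.

Let Q : set (R * endo E) := [set p | p = (-1, J) \/ p = (1, Ge)].

Lemma adapted_gen_kahlerE : adapted_gen_kahler G J = adapted Q.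
Proof.
apply/seteqP; split=> D.
  by move=> [tD /form_parallelP fD pD]; split=> // _ [] ->.
move=> [tD pD]; split=> //; first by apply/form_parallelP; exact: (pD (1, Ge) (or_intror erefl)).
exact: (pD (-1, J) (or_introl erefl)).
Qed.

Lemma tensor_sections_stab :
  tensor_sections (prolong (u_stabilizer G J)) = prolongations Q.
Proof.
apply: prolongationsP => x S; split.
  move/(prolong_stab_form kGJ) => [[tS kS cS JS] GS].
  by split=> // _ [] ->; [exact: JS|exact: GS].
move=> [tS kS cS QS]; apply/(prolong_stab_form kGJ); split; first split=> //.
  exact: (QS (-1, J) (or_introl erefl)).
exact: (QS (1, Ge) (or_intror erefl)).
Qed.

Lemma exists_adapted_gen_kahler : adapted Q !=set0.
Proof.
have [_ _ cGJ] := kGJ.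
have [D [tD [DJ DG]]] := exists_adapted gsqr gsym gcomm cJ cGJ.
by exists D; split=> // _ [] ->.
Qed.

Lemma gm_sgnP e x (u : E x) :
  (if e then gm_pos G x else gm_neg G x) u <-> Ge x u = sgn e *: u.
Proof. by case: e; [exact: gm_posP|exact: gm_negP]. Qed.

Lemma S2_gen_kahler e : S2_sections (split_gen_kahler G J) (e, true) (e, false) =
  typed_tensors J (projG Ge (sgn e)).
Proof.
(* The fourfold projections are products of the commuting projections for [G] and [J]. *)
pose p (i : bool * bool) x (u : EC x) : EC x :=
  eigenproj J i.2 (cendo (projG Ge (sgn i.1)) u).
have qJ b x (u : EC x) : cendo (projG Ge (sgn b)) (cendo J u) = cendo J (cendo (projG Ge (sgn b)) u).
  by congr pair; exact: projG_J gcomm _ _ _.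
have qq b x (u : EC x) : cendo (projG Ge (sgn b)) (cendo (projG Ge (sgn b)) u) =
    cendo (projG Ge (sgn b)) u.
  congr pair; first exact: (projG_idem gsqr (sgn_sqr R b) u.1).
  exact: (projG_idem gsqr (sgn_sqr R b) u.2).
(* A summand of the other sign is killed by [q]; one of the same sign and the wrong type is excluded
   by its eigenvalue of [J]. *)
have other b t x u : split_gen_kahler G J (b, t) x u -> b <> e ->
    cendo (projG Ge (sgn e)) u = 0.
  move=> [[/gm_sgnP /= Gu1 /gm_sgnP /= Gu2] _] be.
  have se : sgn b = - sgn e by case: (b) (e) be => - [] //; rewrite opprK.
  by congr pair; apply: projG_0; rewrite ?sgn_sqr // -se.
apply: (@S2_sections_typed _ _ _ _ _ p).
- move=> x u; transitivity (\sum_b cendo (projG Ge (sgn b)) u).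
    rewrite big_bool; case: u => u v.
    by congr pair; exact/esym/projG_sum.
  rewrite -(pair_bigA _ (fun b t => p (b, t) x u)); apply: eq_bigr => b _.
  by rewrite big_bool; exact/esym/(eigenproj_sum J).
- move=> [b t] x u; split; last exact: (eigenproj_split cJ).
  have G2 (a : EC x) : (if b then gm_pos G x else gm_neg G x) a.1 /\
      (if b then gm_pos G x else gm_neg G x) a.2 <->
      Ge x a.1 = sgn b *: a.1 /\ Ge x a.2 = sgn b *: a.2.
    by split=> - [/gm_sgnP h1 /gm_sgnP h2].
  apply/G2; rewrite /p /=.
  have GE (w : E x) : Ge x (projG Ge (sgn b) x w) = sgn b *: projG Ge (sgn b) x w.
    exact: (G_projG gsqr (sgn_sqr R b) w).
  rewrite /cendo /eigenproj; move: (projG _ _) GE => q GE.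
  case: (t) => /=; rewrite !endoZ !endoD ?endoN !gcomm !GE !endoZ;
    by rewrite ?[LHS]scalerDr !scalerDr ?scalerN !scalerA ![2^-1 * _]mulrC.
- by move=> x u; rewrite /p qJ; exact: (eigenproj_J cJ true).
- by move=> x u; rewrite /p qJ; exact: (eigenproj_J cJ false).
- by move=> x u; exact: (congr1 (eigenproj J true (x := x)) (qq e x u)).
- by move=> x u; exact: (congr1 (eigenproj J false (x := x)) (qq e x u)).
- move=> [b t] x u Fu ne; have [be|be] := pselect (b = e); last by right; exact: other Fu be.
  left; case: t Fu ne => Fu ne; first by case: ne; rewrite be.
  by case: Fu => _ /(split_complexP J false).
- move=> [b t] x u Fu ne; have [be|be] := pselect (b = e); last by right; exact: other Fu be.
  left; case: t Fu ne => Fu ne; last by case: ne; rewrite be.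
  by case: Fu => _ /(split_complexP J true).
Qed.

(** Conversely to adding up two typed tensors, [S] is split by projecting its first argument to
    [E_+] and to [E_-]; each piece is pure, so it comes from a typed tensor for its own sign. *)
Lemma re_sk_gen_kahler :
  [set re_tensor (sk (ctensor_add etap etam))
    | etap in S2_sections (split_gen_kahler G J) (true, true) (true, false)
    & etam in S2_sections (split_gen_kahler G J) (false, true) (false, false)] =
  prolongations Q.
Proof.
rewrite !S2_gen_kahler.
have addE s t x (u v w : E x) : re_tensor (sk (ctensor_add s t)) u v w =
    re_tensor (sk s) u v w + re_tensor (sk t) u v w.
  rewrite /re_tensor /sk /ctensor_add.
  case: (s _ _ _ _) (s _ _ _ _) (t _ _ _ _) (t _ _ _ _) => [a a'] [b b'] [c c'] [d d'] /=.
  by ring.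
(* A tensor that only sees components of sign [e] sees [G] as the scalar [e]. *)
have Gtyped e s x (u v w : E x) : typed_tensors J (projG Ge (sgn e)) s ->
    re_tensor (sk s) u (Ge x v) w = sgn e * re_tensor (sk s) u v w.
  move=> ts; have [[_ tS _ _ _] oS] := re_sk_typed ts; have [_ t2 _] := tS x.
  rewrite -(oS x u (Ge x v) w).2 (projG_G gsqr (sgn_sqr R e)).
  by rewrite (linear_funZ (W := R^o) (t2 u w)) (oS x u v w).2.
apply/seteqP; split=> S.
  move=> [s ts [t tt <-]].
  have [[s1 t1 k1 c1 J1] _] := re_sk_typed ts; have [[s2 t2 k2 c2 J2] _] := re_sk_typed tt.
  split.
  - move=> u v w; apply: smooth_in_ext (smooth_inD openT (s1 u v w) (s2 u v w)).
      exact: openT.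
    by move=> x _; rewrite addE.
  - move=> x; have [l1 l2 l3] := t1 x; have [m1 m2 m3] := t2 x.
    by split=> [v w|u w|u v] c a b; rewrite !addE ?l1 ?l2 ?l3 ?m1 ?m2 ?m3; ring.
  - by move=> x u v w; rewrite !addE k1 k2; ring.
  - move=> x u v w; have := c1 x u v w; have := c2 x u v w.
    by rewrite /cyclic_sum !addE; lra.
  - move=> _ [] -> x u v w /=; rewrite !addE.
      by rewrite (J1 _ erefl) (J2 _ erefl) /=; ring.
    rewrite (Gtyped true s) // (Gtyped false t) //.
    rewrite (k1 x u v) (k2 x u v) [re_tensor (sk s) u v _]k1 [re_tensor (sk t) u v _]k2.
    by rewrite (Gtyped true s) // (Gtyped false t) //; ring.
move=> [sS tS kS cS QS].
have JS := QS (-1, J) (or_introl erefl); have GS := QS (1, Ge) (or_intror erefl).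
have fS x : stab_form Ge J (S x).
  split; last exact: GS.
  by split; [exact: tS|exact: kS|exact: cS|exact: JS].
pose Sq e : tensor3 E := fun x (u v w : E x) => S x (projG Ge (sgn e) x u) v w.
have fSq e x : stab_form Ge J (Sq e x) by exact: stab_form_projS.
have H e : exists2 s, typed_tensors J (projG Ge (sgn e)) s & re_tensor (sk s) = Sq e.
  apply: exists_typed; first exact: cJ.
  - by move=> x u; exact: projG_J gcomm _ _ _.
  - split.
    + by move=> u v w; exact: (sS (endo_app (projG Ge (sgn e)) u) v w).
    + by move=> x; case: (fSq e x) => [[]].
    + by move=> x; case: (fSq e x) => [[]].
    + by move=> x; case: (fSq e x) => [[]].
    + by move=> _ -> x; case: (fSq e x) => [[_ _ _ h] _]; exact: h.
  - move=> x u v w; rewrite /Sq (projG_idem gsqr (sgn_sqr R e)); split=> //.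
    rewrite (stab_form_pure gsqr (sgn_sqr R e) (fS x) u v w).
    rewrite (stab_form_pure gsqr (sgn_sqr R e) (fS x) u (projG _ _ x v) w).
    by rewrite (projG_idem gsqr (sgn_sqr R e)).
have [s ts sE] := H true; have [t tt tE] := H false.
exists s => //; exists t => //.
apply: functional_extensionality_dep => x.
apply/funext => u; apply/funext => v; apply/funext => w.
by rewrite addE sE tE; exact: (stab_form_projD _ _ _ (fS x)).
Qed.

End GenKahler.

End MainProof.

Theorem theorem15 (R : realType) (M : manifold R) (E : courant M)
    (evenE : ~~ odd (vb_rank E)) :
  (* (i) *)
  (forall J : endo E, gen_complex J ->
     let V := [set re_tensor (sk eta) | eta in
                 S2_sections (split_gen_complex J) true false] in
     affine_over (adapted_gen_complex J) V /\
     V = tensor_sections (prolong (u_bundle J)))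
  /\
  (* (ii) *)
  (forall (G : gmetric E) (J : endo E), gen_kahler G J ->
     let V := [set re_tensor (sk (ctensor_add etap etam))
               | etap in S2_sections (split_gen_kahler G J)
                           (true, true) (true, false)
               & etam in S2_sections (split_gen_kahler G J)
                           (false, true) (false, false)] in
     [/\ affine_over (adapted_gen_kahler G J) V,
         V = tensor_sections (prolong (u_stabilizer G J)),
         forall x, direct_sum (u_sub (gm_pos G) J x) (u_sub (gm_neg G) J x)
                     (u_stabilizer G J x),
         forall x, u_stabilizer G J x `<=` u_bundle J x &
         forall x, direct_sum (prolong_sub (gm_pos G) (u_sub (gm_pos G) J) x)
                     (prolong_sub (gm_neg G) (u_sub (gm_neg G) J) x)
                     (prolong (u_stabilizer G J) x)]).
Proof.
split=> [J cJ V|G J kGJ V].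
  rewrite /V (re_sk_gen_complex cJ) tensor_sections_u // adapted_gen_complexE.
  split=> //; apply: affine_adapted; last exact: exists_adapted_gen_complex.
  by move=> _ -> x u v; exact: gc_skew.
split.
- rewrite /V (re_sk_gen_kahler kGJ) adapted_gen_kahlerE.
  apply: affine_adapted; last exact: exists_adapted_gen_kahler.
  by move=> _ [] -> x u v /=; [exact: gc_skew (kahler_J kGJ) _ _ _|exact: gm_sym].
- by rewrite /V (re_sk_gen_kahler kGJ) tensor_sections_stab.
- by move=> x; exact: direct_sum_u.
- by move=> x A [].
- by move=> x; exact: direct_sum_prolong.
Qed.
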